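(* Whenever $f,g\in VMO\cap L^\infty(\mathbb{T})$, the sequence of matrices $\{T_n(fg)-T_n(f)T_n(g)\}_{n\ge 1}$ converges to $\{O_n\}$ in Type 2 strong cluster sense. Moreover, $VMO\cap L^\infty(\mathbb{T})$ is the largest $C^*$-subalgebra of $L^\infty(\mathbb{T})$ with this property; that is, $VMO\cap L^\infty(\mathbb{T})$ is a $C^*$-subalgebra of $L^\infty(\mathbb{T})$ with this property, and if $M$ is any $C^*$-subalgebra of $L^\infty(\mathbb{T})$ such that $\{T_n(fg)-T_n(f)T_n(g)\}_{n\ge 1}$ converges to $\{O_n\}$ in Type 2 strong cluster sense for all $f,g\in M$, then $M\subseteq VMO\cap L^\infty(\mathbb{T})$.
   Context: $\mathbb{T}$ is the unit circle and $L^2(\mathbb{T})=L^2(\mathbb{T},\frac{1}{2\pi}d\theta)$. $L^\infty(\mathbb{T})$ is the $C^*$-algebra of essentially bounded functions with pointwise operations, complex conjugation as involution, and the essential supremum norm. For an integrable function $f$ on $\mathbb{T}$, $f_n$ ($n\in\mathbb{Z}$) denotes its $n$-th Fourier coefficient. Toeplitz matrix: $T_n(f)=(f_{i-j})_{0\le i,j<n}$, an $n\times n$ matrix. $O_n$ is the $n\times n$ zero matrix. $VMO$: let $f\in L^2(\mathbb{T})$. For an interval (arc) $I$ of $\mathbb{T}$ of length $|I|$, let $f_I=\frac{1}{|I|}\int_I f(\theta)\,d\theta$. Then $f\in VMO$ if $$\lim_{|I|\to 0}\left[\frac{1}{|I|}\int_I|f(\theta)-f_I|^2\,d\theta\right]^{1/2}=0$$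 (the limit being uniform over intervals $I$ with $|I|\to 0$). Type 2 strong cluster sense: a sequence $\{A_n\}$, with each $A_n$ a complex $n\times n$ matrix, converges to $\{O_n\}$ in Type 2 strong cluster sense if for every $\epsilon>0$ there exist positive integers $N_{1,\epsilon}$ and $N_{2,\epsilon}$ (depending on $\epsilon$ but not on $n$) such that for every $n>N_{2,\epsilon}$ one can write $A_n=R_n+N_n$ with $\operatorname{rank}(R_n)\le N_{1,\epsilon}$ and $\|N_n\|<\epsilon$ (operator norm). *)

(* Defs.v *)
From mathcomp Require Import all_boot all_order all_algebra.
From mathcomp Require Import all_classical all_reals all_analysis.
From mathcomp Require Import ess_sup_inf complex.

Set Implicit Arguments.
Unset Strict Implicit.
Unset Printing Implicit Defensive.

Import Order.TTheory GRing.Theory Num.Theory.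
Import numFieldNormedType.Exports.

Local Open Scope classical_set_scope.
Local Open Scope ring_scope.
Local Open Scope complex_scope.

(* A function on the unit circle is represented by the 2 pi-periodic function
   [t |-> f (e^{i t})] on the line.  Elements of L^2 and L^oo are represented
   by functions; equality almost everywhere is dealt with in
   [Cstar_subalgebra] and [Cstar_subalgebra_ae] below. *)
Definition periodic2pi {R : realType} (f : R -> R[i]) : Prop :=
  forall t : R, f (t + 2 * pi) = f t.

(* [complex] carries no measurable structure in the libraries: measurability
   and integration are taken componentwise. *)
Definition cmeasurable {R : realType} (f : R -> R[i]) : Prop :=
  measurable_fun [set: R] (fun t => complex.Re (f t)) /\
  measurable_fun [set: R] (fun t => complex.Im (f t)).

Definition cintegral {R : realType} (D : set R) (f : R -> R[i]) : R[i] :=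
  (\int[lebesgue_measure]_(t in D) complex.Re (f t)) +i*
  (\int[lebesgue_measure]_(t in D) complex.Im (f t)).

Definition L2circle {R : realType} : set (R -> R[i]) :=
  [set f | [/\ periodic2pi f, cmeasurable f &
     (\int[lebesgue_measure]_(t in `[0%R, (2 * pi)%R])
        (Normc.normc (f t) ^+ 2)%:E < +oo)%E]].

(* For a periodic function, the essential supremum over the line is the
   essential supremum over the circle. *)
Definition Linfty_norm {R : realType} (f : R -> R[i]) : \bar R :=
  ess_sup lebesgue_measure (fun t : R => (Normc.normc (f t))%:E).

Definition Linfty {R : realType} : set (R -> R[i]) :=
  [set f | [/\ periodic2pi f, cmeasurable f & (Linfty_norm f < +oo)%E]].

(* The arc starting at angle [a] and of length [l]. *)
Definition arc {R : realType} (a l : R) : set R := `[a, a + l].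

Definition arc_mean {R : realType} (f : R -> R[i]) (a l : R) : R[i] :=
  (l^-1)%:C * cintegral (arc a l) f.

Definition arc_oscillation {R : realType} (f : R -> R[i]) (a l : R) : R :=
  Num.sqrt (l^-1 * \int[lebesgue_measure]_(t in arc a l)
                     (Normc.normc (f t - arc_mean f a l) ^+ 2)).

Definition VMO {R : realType} : set (R -> R[i]) :=
  [set f | L2circle f /\
    forall e : R, 0 < e -> exists2 d : R, 0 < d &
      forall a l : R, 0 < l -> l <= 2 * pi -> l < d ->
        arc_oscillation f a l < e].

Definition expi {R : realType} (x : R) : R[i] := cos x +i* sin x.

Definition fourier {R : realType} (f : R -> R[i]) (k : int) : R[i] :=
  ((2 * pi)^-1)%:C *
  cintegral `[0, 2 * pi] (fun t => f t * expi (- (k%:~R * t))).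

Definition toeplitz {R : realType} (f : R -> R[i]) (n : nat) : 'M[R[i]]_n :=
  \matrix_(i < n, j < n) fourier f (i%:Z - j%:Z).

Definition vnorm {R : realType} {n : nat} (x : 'cV[R[i]]_n) : R :=
  Num.sqrt (\sum_(i < n) Normc.normc (x i 0) ^+ 2).

Definition opnorm {R : realType} {n : nat} (A : 'M[R[i]]_n) : R :=
  sup [set vnorm (A *m x) | x in [set x : 'cV[R[i]]_n | vnorm x <= 1]].

(* Convergence of [A] to the zero matrices; only the terms of positive index
   matter, since [N2] is positive. *)
Definition type2_strong_cluster0 {R : realType}
    (A : forall n : nat, 'M[R[i]]_n) : Prop :=
  forall e : R, 0 < e ->
  exists N1 N2 : nat, [/\ (0 < N1)%N, (0 < N2)%N &
    forall n : nat, (N2 < n)%N ->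
    exists Rn Nn : 'M[R[i]]_n,
      [/\ A n = Rn + Nn, (\rank Rn <= N1)%N & opnorm Nn < e]].

Definition toeplitz_defect {R : realType} (f g : R -> R[i]) (n : nat) :
    'M[R[i]]_n :=
  toeplitz (fun t => f t * g t) n - toeplitz f n *m toeplitz g n.

Definition toeplitz_cluster_property {R : realType} (M : set (R -> R[i])) :
    Prop :=
  forall f g : R -> R[i], M f -> M g ->
    type2_strong_cluster0 (toeplitz_defect f g).

(* A norm-closed star-subalgebra of L^oo, not required to contain the unit.
   Closedness for the essential supremum seminorm makes such a set saturated
   for almost everywhere equality (see [Cstar_subalgebra_ae]), so that it is
   the same thing as a set of classes of functions. *)
Record Cstar_subalgebra {R : realType} (M : set (R -> R[i])) : Prop := {
  Cstar_sub : M `<=` Linfty;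
  Cstar_zero : M (fun=> 0);
  Cstar_add : forall f g, M f -> M g -> M (fun t => f t + g t);
  Cstar_scale : forall (c : R[i]) f, M f -> M (fun t => c * f t);
  Cstar_mul : forall f g, M f -> M g -> M (fun t => f t * g t);
  Cstar_conj : forall f, M f -> M (fun t => (f t)^*);
  Cstar_closed : forall f, Linfty f ->
    (forall e : R, 0 < e ->
       exists2 g, M g & (Linfty_norm (fun t => (f t - g t)%R) < e%:E)%E) ->
    M f
}.

Lemma Cstar_subalgebra_ae (R : realType) (M : set (R -> R[i]))
    (f g : R -> R[i]) :
  Cstar_subalgebra M -> M f -> Linfty g ->
  {ae lebesgue_measure, forall t, f t = g t} -> M g.
Proof.
move=> HM Mf Lg fg; apply: (Cstar_closed HM Lg) => e e0; exists f => //.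
apply: (@le_lt_trans _ _ 0%E); last by rewrite lte_fin.
apply/ess_supP; apply: (@filterS _ _ (ae_filter_ringOfSetsType _) _ _ _ fg) => t ->.
by rewrite subrr Normc.normc0.
Qed.

(* Main.v *)
Require Import Defs.
From mathcomp Require Import all_boot all_order all_algebra.
From mathcomp Require Import all_classical all_reals all_analysis.
From mathcomp Require Import ess_sup_inf complex measurable_realfun.
From mathcomp Require Import ring lra zify.
From mathcomp Require Import sesquilinear spectral polyXY polyrcf.

(** A bounded function [f] acts on the circle by multiplication.  Write [X] for the
trigonometric polynomial with coefficient vector [x], whose modes lie in [[0, n)],
and [bq 0 n a] for the energy of [a] in the modes outside this window.  The matrix
[T_n(fg) - T_n(f) T_n(g)] collects the part of [g X] that leaves the window and is
brought back by [f]; by [defect_form] its form is the residual of Bessel's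
inequality for the pair [g X], [conj(f) Y].  Both halves of the theorem are
estimates of [bq 0 n (g X)].

Vanishing mean oscillation implies the cluster property.  Let
[Var z f = P_z |f|^2 - |P_z f|^2], with [P_z] the Poisson average at the point [z]
of the disc.  It tends to zero at the boundary when the mean oscillation vanishes
([vmo_Var]), because a Poisson average is an average over a short arc up to a small
tail.  Hence [f = h + g] with [h] a trigonometric polynomial and [g] the limit in
the mean of trigonometric polynomials [p] such that [Var z p <= eta^2] in the whole
disc ([vmo_approx]).  The polynomial [h] contributes a matrix of rank at most twice
its degree, since only the rows or columns near the two ends of the window see it
([rank_defect_l], [rank_defect_r]).  The part of [p X] outside the window is
controlled by the Hankel forms of [p] and of its conjugate, and these are bounded by
[4 eta] ([hankel_bound], [approximable_bq]), so that [g] contributes a small norm.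

The bound on Hankel forms is Fefferman's duality between H^1 and BMO in Garsia's
norm.  A Hankel form is the integral of [dbar G (u v)'] against [log (1 / |z|^2)],
where [G] is the harmonic extension of [p]; the product rule and the Cauchy-Schwarz
inequality reduce it to the Carleson embedding for [|dbar G|^2 log (1 / |z|^2)],
which Green's formula proves with the explicit function
[(1 + phi + phi^2 / 2) |v|^2] ([carleson_embedding]).  All functions involved are
polynomials in [z] and its conjugate, and the integral over the disc is the
functional [Lam] on their coefficients, which is positive on the polynomials that
are nonnegative in the disc ([Lam_pos]).

The cluster property implies vanishing mean oscillation.  A C*-algebra [M] contains
[conj(f)] with [f], and the defect of the pair [conj(f)], [f] has the positive
quadratic form [bq 0 n (f X)].  Take for [X] a Dirichlet kernel with [m]
consecutive modes, at either end of the window.  If [bq 0 m (f X)] were at least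
[dl m] for arbitrarily large [m], a lacunary family of such kernels would be nearly
orthonormal after normalization, and a matrix of bounded rank is small on some
member of a large nearly orthonormal family ([low_rank_small]).  So
[bq 0 m (f X) = o(m)] ([cluster_decay]): [f X] is close to a trigonometric
polynomial of degree less than [m].  On an arc of length [c / m] where [X] peaks,
[X] and that polynomial are nearly constant, hence so is [f] ([decay_vmo]).

That the bounded functions of vanishing mean oscillation form a C*-algebra follows
from the estimate of the oscillation of a product by those of the factors.  Elements
of [Linfty] enter through everywhere bounded representatives ([Linfty_rep]). *)

Set Implicit Arguments.
Unset Strict Implicit.
Unset Printing Implicit Defensive.

Import Order.TTheory GRing.Theory Num.Theory.
Import numFieldNormedType.Exports.
Import Defs.

Local Open Scope classical_set_scope.
Local Open Scope ring_scope.
Local Open Scope complex_scope.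

Local Notation Re := complex.Re.
Local Notation Im := complex.Im.
Reserved Notation "x ^J" (at level 1, format "x ^J").
Notation "x ^J" := (conjc x).

(** * Means of real functions over the circle and over arcs *)

Section RealMean.
Context {R : realType}.
Notation mu := (@lebesgue_measure R).
Implicit Types (p q : R -> R) (a l s t : R).

(** Bounded functions, rather than essentially bounded ones: every product of two of
them has a mean, and inequalities may be checked at all points. *)
Definition brv q : Prop :=
  [/\ forall t, q (t + 2 * pi) = q t, measurable_fun [set: R] q &
      exists M, forall t, `|q t| <= M].

Lemma brv_cst c : brv (fun=> c).
Proof. by split=> //; exists `|c|. Qed.

Lemma brvD p q : brv p -> brv q -> brv (fun t => p t + q t).
Proof.
move=> [pp mp [M pM]] [pq mq [N qN]]; split.
- by move=> t; rewrite pp pq.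
- exact: measurable_funD.
- by exists (M + N) => t; rewrite (le_trans (ler_normD _ _))// lerD.
Qed.

Lemma brvM p q : brv p -> brv q -> brv (fun t => p t * q t).
Proof.
move=> [pp mp [M pM]] [pq mq [N qN]]; split.
- by move=> t; rewrite pp pq.
- exact: measurable_funM.
- by exists (M * N) => t; rewrite normrM ler_pM.
Qed.

Lemma brvZ c q : brv q -> brv (fun t => c * q t).
Proof. by apply: brvM; exact: brv_cst. Qed.

Lemma brvN q : brv q -> brv (fun t => - q t).
Proof.
by move=> /(brvZ (-1)); congr brv; apply/funext => t; rewrite mulN1r.
Qed.

Lemma brvB p q : brv p -> brv q -> brv (fun t => p t - q t).
Proof. by move=> bp bq; apply: brvD => //; exact: brvN. Qed.

Lemma brv_shift s q : brv q -> brv (fun t => q (t + s)).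
Proof.
move=> [pq mq [N qN]]; split.
- by move=> t; rewrite addrAC pq.
- by apply: (measurableT_comp mq); exact: measurable_funD.
- by exists N.
Qed.

Lemma arc_measurable a l : measurable (arc a l).
Proof. exact: measurable_itv. Qed.

Lemma mu_arc a l : 0 <= l -> mu (arc a l) = l%:E.
Proof.
move=> l0; rewrite /arc lebesgue_measure_itv/= lte_fin ltrDl.
case: ltP => [_|l0']; first by rewrite -EFinD; congr EFin; lra.
by congr EFin; apply/le_anti; rewrite l0.
Qed.

Lemma brv_integrable q a b : brv q -> mu.-integrable `[a, b] (EFin \o q).
Proof.
move=> [_ mq [M qM]]; apply: measurable_bounded_integrable => //=.
- by rewrite lebesgue_measure_itv/=; case: ifP => _; rewrite -?EFinD ltry.
- exact: measurable_funTS.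
- exists M; split; first exact: num_real.
  by move=> x /ltW Mx t _ /=; rewrite (le_trans (qM t)).
Qed.

Lemma mu_shift s (A : set R) : measurable A ->
  pushforward mu ((fun t => t + s) : _ -> measurableTypeR R) A = mu A.
Proof.
move=> mA; apply/esym/lebesgue_measure_unique => //=.
  exact: measurable_funD.
move=> ? _ [[a b]] _ <-; rewrite /pushforward /=.
rewrite (_ : _ @^-1` _ = `]a - s, b - s]%classic); last first.
  by apply/seteqP; split=> x /=; rewrite !in_itv/= ltrBlDr lerBrDr.
by rewrite !lebesgue_measure_itv/= !lte_fin ltrD2r -!EFinB; case: ifP => // _;
  congr EFin; lra.
Qed.

Lemma int_shift q a b s : brv q ->
  \int[mu]_(t in `[a, b]) q (t + s) = \int[mu]_(t in `[(a + s)%R, (b + s)%R]) q t.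
Proof.
move=> bq; rewrite /Rintegral; congr fine.
have mphi : measurable_fun [set: R] (fun t : R => t + s).
  exact: measurable_funD.
have im : (fun t => t + s) @^-1` `[(a + s)%R, (b + s)%R]%classic = `[a, b]%classic.
  by apply/seteqP; split=> x /=; rewrite !in_itv/= !lerD2r.
rewrite -im; transitivity
  (\int[pushforward mu ((fun t => (t + s)%R) : _ -> measurableTypeR R)]_(y in
    `[(a + s)%R, (b + s)%R]) (q y)%:E)%E.
  rewrite (@integral_pushforward _ _ (measurableTypeR R) (measurableTypeR R) R
    (fun t : R => t + s) mphi mu `[(a + s)%R, (b + s)%R] (fun y => (q y)%:E))//.
  - by apply/measurable_EFinP; case: bq.
  - by rewrite im; exact: brv_integrable (brv_shift s bq).
by apply: eq_measure_integral => A mA _; exact: mu_shift.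
Qed.

Lemma int_split q a b c : brv q -> a <= c -> c <= b ->
  \int[mu]_(t in `[a, b]) q t =
  \int[mu]_(t in `[a, c]) q t + \int[mu]_(t in `[c, b]) q t.
Proof.
move=> bq ac cb.
have := @Rintegral_itvB R q (BLeft a) (BRight b) c (brv_integrable a b bq).
rewrite !bnd_simp ac cb => /(_ isT isT).
rewrite Rintegral_itv_obnd_cbnd; first by move=> <-; ring.
by apply: integrableS (brv_integrable c b bq) => //; apply: subset_itvr;
  rewrite bnd_simp.
Qed.

Lemma brv_periodz q (k : int) t : brv q -> q (t + k%:~R * (2 * pi)) = q t.
Proof.
move=> [pq _ _]; have pn n : forall t, q (t + n%:R * (2 * pi)) = q t.
  elim: n => [|n IH] {}t; first by rewrite mul0r addr0.
  by rewrite -natr1 mulrDl mul1r addrA pq IH.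
case: k => n; first exact: pn.
rewrite NegzE mulrNz mulNr.
by have := pn n.+1 (t - n.+1%:R * (2 * pi)); rewrite subrK.
Qed.

(** The window is moved by an integer number of periods to an origin in
[[0, 2 pi]], where splitting it at [2 pi] and shifting one piece gives back the
full turn from zero. *)
Lemma int_period q s : brv q ->
  \int[mu]_(t in `[s, (s + 2 * pi)%R]) q t = \int[mu]_(t in `[0, (2 * pi)%R]) q t.
Proof.
move=> bq; have tp0 : 0 < 2 * pi :> R by rewrite mulr_gt0// pi_gt0.
set k := Num.floor (s / (2 * pi)).
pose s0 := s - k%:~R * (2 * pi).
have s00 : 0 <= s0 by rewrite subr_ge0 -ler_pdivlMr// floor_le.
have s01 : s0 <= 2 * pi.
  rewrite lerBlDl -{2}[2 * pi]mul1r -mulrDl -ler_pdivrMr//.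
  by have := ltW (floorD1_gt (s / (2 * pi))); rewrite intrD.
have bqs : brv (fun t => q (t + k%:~R * (2 * pi))) by exact: brv_shift.
rewrite (_ : s = s0 + k%:~R * (2 * pi)); last by rewrite subrK.
rewrite [s0 + _ + 2 * pi]addrAC -int_shift//.
rewrite (_ : (fun t => q (t + k%:~R * (2 * pi))) = q); last first.
  by apply/funext => t; rewrite brv_periodz.
rewrite (@int_split q s0 _ (2 * pi))//; last by rewrite lerDr.
rewrite (@int_split q 0 (2 * pi) s0)// [LHS]addrC; congr (_ + _).
have := int_shift 0 s0 (2 * pi) bq; rewrite add0r => <-.
by apply: eq_Rintegral => t _; case: bq => ->.
Qed.

Lemma int_arc_shift q a l s : brv q ->
  \int[mu]_(t in arc a l) q (t + s) = \int[mu]_(t in arc (a + s) l) q t.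
Proof. by move=> bq; rewrite /arc int_shift// addrAC. Qed.

Lemma int_arcD p q a l : brv p -> brv q ->
  \int[mu]_(t in arc a l) (p t + q t) =
  \int[mu]_(t in arc a l) p t + \int[mu]_(t in arc a l) q t.
Proof. by move=> bp bq; rewrite /arc RintegralD//; exact: brv_integrable. Qed.

Lemma int_arcZ c q a l : brv q ->
  \int[mu]_(t in arc a l) (c * q t) = c * \int[mu]_(t in arc a l) q t.
Proof. by move=> bq; rewrite /arc RintegralZl//; exact: brv_integrable. Qed.

Lemma int_arc_le p q a l : brv p -> brv q -> (forall t, arc a l t -> p t <= q t) ->
  \int[mu]_(t in arc a l) p t <= \int[mu]_(t in arc a l) q t.
Proof. by move=> bp bq pq; apply: le_Rintegral => //;
  [exact: arc_measurable|exact: brv_integrable|exact: brv_integrable].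
Qed.

Lemma int_arc_cst c a l : 0 <= l -> \int[mu]_(_ in arc a l) c = c * l.
Proof.
move=> l0; have := mu_arc a l0; rewrite /arc => ma.
rewrite Rintegral_cst; last exact: measurable_itv.
congr (_ * _); exact: (congr1 fine ma).
Qed.

Definition Er q : R := (2 * pi)^-1 * \int[mu]_(t in `[0, (2 * pi)%R]) q t.

Let tp0 : 0 < 2 * pi :> R. Proof. by rewrite mulr_gt0// pi_gt0. Qed.

Let arc0 : `[0, (2 * pi)%R]%classic = arc 0 (2 * pi) :> set R.
Proof. by rewrite /arc add0r. Qed.

Lemma ErD p q : brv p -> brv q -> Er (fun t => p t + q t) = Er p + Er q.
Proof. by move=> bp bq; rewrite /Er arc0 int_arcD// mulrDr. Qed.

Lemma ErZ c q : brv q -> Er (fun t => c * q t) = c * Er q.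
Proof. by move=> bq; rewrite /Er arc0 int_arcZ// mulrCA. Qed.

Lemma ErN q : brv q -> Er (fun t => - q t) = - Er q.
Proof.
by move=> /(ErZ (-1)); rewrite mulN1r => <-; congr Er; apply/funext => t;
  rewrite mulN1r.
Qed.

Lemma Er_cst c : Er (fun=> c) = c.
Proof. by rewrite /Er arc0 int_arc_cst ?ltW// mulrCA mulVf ?mulr1// gt_eqF. Qed.

Lemma Er_le p q : brv p -> brv q -> (forall t, p t <= q t) -> Er p <= Er q.
Proof.
move=> bp bq pq; rewrite /Er ler_wpM2l ?invr_ge0 ?(ltW tp0)// arc0.
exact: int_arc_le.
Qed.

Lemma Er_shift s q : brv q -> Er (fun t => q (t + s)) = Er q.
Proof.
move=> bq; rewrite /Er arc0 int_arc_shift//; congr (_ * _).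
by rewrite /arc !add0r int_period.
Qed.

(** By periodicity an arc may be completed to a full turn from its origin. *)
Lemma int_arc_le_Er q a l : brv q -> (forall t, 0 <= q t) -> 0 <= l ->
  l <= 2 * pi -> \int[mu]_(t in arc a l) q t <= 2 * pi * Er q.
Proof.
move=> bq q0 l0 l2; rewrite /Er mulrA divff ?gt_eqF// mul1r -(int_period a)//.
rewrite (@int_split q a (a + 2 * pi) (a + l))//.
- by rewrite /arc lerDl Rintegral_ge0.
- by rewrite lerDl.
- by rewrite lerD2l.
Qed.

End RealMean.

(** * Complex means and Fourier coefficients *)

Section ComplexMean.
Context {R : realType}.
Notation C := R[i].
Implicit Types (x y z : C) (f g : R -> C).

Definition nsq z : R := Re z ^+ 2 + Im z ^+ 2.

Lemma nsqE z : (nsq z)%:C = z * z^J.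
Proof. by case: z => a b; rewrite /nsq; simpc; congr Complex => /=; ring. Qed.

Lemma normc_sqr z : Normc.normc z ^+ 2 = nsq z.
Proof. by case: z => a b; rewrite /= sqr_sqrtr// addr_ge0 ?sqr_ge0. Qed.

Lemma nsq_ge0 z : 0 <= nsq z.
Proof. by rewrite addr_ge0 ?sqr_ge0. Qed.

Lemma nsqM x y : nsq (x * y) = nsq x * nsq y.
Proof. by case: x y => a b [c d]; rewrite /nsq /=; ring. Qed.

Lemma nsqJ x : nsq x^J = nsq x.
Proof. by case: x => a b; rewrite /nsq /= sqrrN. Qed.

Lemma nsqN x : nsq (- x) = nsq x.
Proof. by case: x => a b; rewrite /nsq /= !sqrrN. Qed.

Lemma nsq0 : nsq 0 = 0.
Proof. by rewrite /nsq/= expr0n addr0. Qed.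

Lemma nsq_real (a : R) : nsq a%:C = a ^+ 2.
Proof. by rewrite /nsq/= expr0n addr0. Qed.

Lemma nsqD x y : nsq (x + y) = nsq x + nsq y + 2 * Re (x * y^J).
Proof. by case: x y => a b [c d]; rewrite /nsq /=; ring. Qed.

Lemma nsqD_le x y : nsq (x + y) <= 2 * nsq x + 2 * nsq y.
Proof.
case: x y => a b [c d]; rewrite /nsq /=.
have := sqr_ge0 (a - c); have := sqr_ge0 (b - d); nra.
Qed.

Lemma nsq_eq0 x : nsq x = 0 -> x = 0.
Proof.
case: x => a b /eqP; rewrite /nsq/= paddr_eq0 ?sqr_ge0// !sqrf_eq0.
by move=> /andP[/eqP -> /eqP ->].
Qed.

Lemma cReD x y : Re (x + y) = Re x + Re y. Proof. by case: x y => ? ? []. Qed.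
Lemma cImD x y : Im (x + y) = Im x + Im y. Proof. by case: x y => ? ? []. Qed.
Lemma cReM x y : Re (x * y) = Re x * Re y - Im x * Im y.
Proof. by case: x y => ? ? []. Qed.
Lemma cImM x y : Im (x * y) = Re x * Im y + Im x * Re y.
Proof. by case: x y => ? ? []. Qed.
Lemma cReJ x : Re x^J = Re x. Proof. by case: x. Qed.
Lemma cImJ x : Im x^J = - Im x. Proof. by case: x. Qed.

Lemma conjcM x y : (x * y)^J = x^J * y^J. Proof. exact: rmorphM. Qed.
Lemma conjcD x y : (x + y)^J = x^J + y^J. Proof. exact: rmorphD. Qed.
Lemma conjcN x : (- x)^J = - x^J. Proof. exact: rmorphN. Qed.
Lemma conjc_sum (I : Type) (r : seq I) (P : pred I) (F : I -> C) :
  (\sum_(i <- r | P i) F i)^J = \sum_(i <- r | P i) (F i)^J.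
Proof. exact: rmorph_sum. Qed.

Lemma complexP x y : Re x = Re y -> Im x = Im y -> x = y.
Proof. by case: x y => ? ? [? ?] /= -> ->. Qed.

Lemma cRe_sum (I : Type) (r : seq I) (P : pred I) (F : I -> C) :
  Re (\sum_(i <- r | P i) F i) = \sum_(i <- r | P i) Re (F i).
Proof. by elim/big_rec2: _ => // i a b _ <-; rewrite cReD. Qed.

(** Positivity of a hermitian form of two variables on all combinations of two
vectors is the Cauchy-Schwarz inequality. *)
Lemma CS_of_pos (a c : R) (b : C) : 0 <= c ->
  (forall l : C, 0 <= a + 2 * Re (l * b) + nsq l * c) -> nsq b <= a * c.
Proof.
move=> c0' H; have a0 : 0 <= a.
  by have := H 0; rewrite mul0r nsq0 mul0r /= !mulr0 !addr0.
have Hb (s : R) : 0 <= a - 2 * s * nsq b + s ^+ 2 * nsq b * c.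
  have := H (- (s%:C * b^J)); rewrite nsqN nsqM nsqJ nsq_real.
  rewrite (_ : Re _ = - (s * nsq b)); first by congr (_ <= _); ring.
  by case: (b) => u v; rewrite /nsq/=; ring.
have b0 := nsq_ge0 b.
have [c0|c0|c0] := ltrgt0P c.
- have := Hb c^-1.
  rewrite (_ : a - _ + _ = a - c^-1 * nsq b); last by field; lra.
  by rewrite subr_ge0 mulrC ler_pdivrMr.
- by rewrite ltNge c0' in c0.
- rewrite c0 mulr0.
  have [->//|bn0] := eqVneq (nsq b) 0.
  have := Hb ((a + 1) / (nsq b)).
  rewrite c0 (_ : a - _ + _ = a - 2 * (a + 1)); last by field.
  by lra.
Qed.

Definition bcv f : Prop := brv (fun t => Re (f t)) /\ brv (fun t => Im (f t)).

Lemma bcv_ext f g : (forall t, f t = g t) -> bcv f -> bcv g.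
Proof. by move=> fg; rewrite (funext fg). Qed.

Lemma bcv_real (q : R -> R) : brv q -> bcv (fun t => (q t)%:C).
Proof. by move=> bq; split=> //=; exact: brv_cst. Qed.

Lemma bcv_cst z : bcv (fun=> z).
Proof. by split; exact: brv_cst. Qed.

Lemma bcvD f g : bcv f -> bcv g -> bcv (fun t => f t + g t).
Proof.
move=> [f1 f2] [g1 g2]; split.
  by under eq_fun do rewrite cReD; exact: brvD.
by under eq_fun do rewrite cImD; exact: brvD.
Qed.

Lemma bcvM f g : bcv f -> bcv g -> bcv (fun t => f t * g t).
Proof.
move=> [f1 f2] [g1 g2]; split.
  by under eq_fun do rewrite cReM; apply: brvB; exact: brvM.
by under eq_fun do rewrite cImM; apply: brvD; exact: brvM.
Qed.

Lemma bcvZ z f : bcv f -> bcv (fun t => z * f t).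
Proof. by apply: bcvM; exact: bcv_cst. Qed.

Lemma bcvN f : bcv f -> bcv (fun t => - f t).
Proof. by move=> /(bcvZ (-1)); apply: bcv_ext => t; rewrite mulN1r. Qed.

Lemma bcvB f g : bcv f -> bcv g -> bcv (fun t => f t - g t).
Proof. by move=> bf bg; apply: bcvD => //; exact: bcvN. Qed.

Lemma bcvJ f : bcv f -> bcv (fun t => (f t)^J).
Proof.
move=> [f1 f2]; split; first by under eq_fun do rewrite cReJ.
by under eq_fun do rewrite cImJ; exact: brvN.
Qed.

Lemma bcv_sum (I : Type) (r : seq I) (P : pred I) (F : I -> R -> C) :
  (forall i, bcv (F i)) -> bcv (fun t => \sum_(i <- r | P i) F i t).
Proof.
move=> bF; elim: r => [|i r IH].
  by under eq_fun do rewrite big_nil; exact: bcv_cst.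
under eq_fun do rewrite big_cons.
by case: (P i) => //; exact: bcvD.
Qed.

Lemma brv_nsq f : bcv f -> brv (fun t => nsq (f t)).
Proof. by move=> [f1 f2]; apply: brvD; apply: brvM. Qed.

Lemma bcv_bound f : bcv f -> exists M : R, forall t, nsq (f t) <= M.
Proof.
move=> /brv_nsq[_ _ [M HM]]; exists M => t.
by rewrite (le_trans _ (HM t))// ler_norm.
Qed.

Definition E f : C := Er (fun t => Re (f t)) +i* Er (fun t => Im (f t)).

Lemma E_ext f g : (forall t, f t = g t) -> E f = E g.
Proof. by move=> fg; rewrite (funext fg). Qed.

Lemma ED f g : bcv f -> bcv g -> E (fun t => f t + g t) = E f + E g.
Proof.
move=> [f1 f2] [g1 g2]; apply: complexP; rewrite /= -ErD//.
  by congr Er; apply/funext => t; rewrite cReD.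
by congr Er; apply/funext => t; rewrite cImD.
Qed.

Lemma EZ z f : bcv f -> E (fun t => z * f t) = z * E f.
Proof.
move=> [f1 f2]; apply: complexP; rewrite ?cReM ?cImM /= -!ErZ//.
  rewrite -ErN; last exact: brvZ.
  rewrite -ErD; [|exact: brvZ|by apply: brvN; exact: brvZ].
  by congr Er; apply/funext => t; rewrite cReM.
rewrite -ErD; [|exact: brvZ|exact: brvZ].
by congr Er; apply/funext => t; rewrite cImM.
Qed.

Lemma EN f : bcv f -> E (fun t => - f t) = - E f.
Proof.
by move=> bf; rewrite -mulN1r -EZ//; apply: E_ext => t; rewrite mulN1r.
Qed.

Lemma EB f g : bcv f -> bcv g -> E (fun t => f t - g t) = E f - E g.
Proof. by move=> bf bg; rewrite ED ?EN//; exact: bcvN. Qed.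

Lemma EJ f : bcv f -> E (fun t => (f t)^J) = (E f)^J.
Proof.
move=> [f1 f2]; apply: complexP; rewrite /=.
  by congr Er; apply/funext => t; rewrite cReJ.
by rewrite -ErN//; congr Er; apply/funext => t; rewrite cImJ.
Qed.

Lemma E_cst z : E (fun=> z) = z.
Proof. by apply: complexP; rewrite /= Er_cst. Qed.

Lemma E_sum (I : Type) (r : seq I) (P : pred I) (F : I -> R -> C) :
  (forall i, bcv (F i)) ->
  E (fun t => \sum_(i <- r | P i) F i t) = \sum_(i <- r | P i) E (F i).
Proof.
move=> bF; elim: r => [|i r IH].
  by rewrite big_nil -[RHS]E_cst; apply: E_ext => t; rewrite big_nil.
rewrite big_cons (_ : E _ = E (fun t =>
  (if P i then F i t else 0) + \sum_(i <- r | P i) F i t)); last first.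
  by apply: E_ext => t; rewrite big_cons; case: ifP => _; rewrite ?add0r.
have bi : bcv (fun t => if P i then F i t else 0).
  by case: (P i); [exact: bF|exact: bcv_cst].
rewrite (ED bi); last exact: bcv_sum.
by rewrite IH; case: ifP => _ //; rewrite E_cst add0r.
Qed.

Lemma E_shift s f : bcv f -> E (fun t => f (t + s)) = E f.
Proof.
move=> [f1 f2]; rewrite /E.
by rewrite (Er_shift s f1) (Er_shift s f2).
Qed.

Lemma E_real (q : R -> R) : E (fun t => (q t)%:C) = (Er q)%:C.
Proof. by apply: complexP => //=; rewrite Er_cst. Qed.

Lemma E_nsq f : E (fun t => f t * (f t)^J) = (Er (fun t => nsq (f t)))%:C.
Proof. by rewrite -E_real; apply: E_ext => t; rewrite nsqE. Qed.

Lemma Er_nsq_ge0 f : bcv f -> 0 <= Er (fun t => nsq (f t)).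
Proof.
move=> bf; rewrite -(Er_cst 0); apply: Er_le (brv_cst 0) (brv_nsq bf) _.
by move=> t; exact: nsq_ge0.
Qed.

Lemma Er_nsqD f g : bcv f -> bcv g -> Er (fun t => nsq (f t + g t)) =
  Er (fun t => nsq (f t)) + Er (fun t => nsq (g t))
  + 2 * Re (E (fun t => f t * (g t)^J)).
Proof.
move=> bf bg; have bfg : bcv (fun t => f t * (g t)^J).
  by apply: bcvM => //; exact: bcvJ.
have bf2 := brv_nsq bf; have bg2 := brv_nsq bg.
rewrite /= -ErZ; last by case: bfg.
rewrite -!ErD//; [|exact: brvD|by apply: brvZ; case: bfg].
by congr Er; apply/funext => t; rewrite nsqD.
Qed.

Lemma Er_nsqD_le f g : bcv f -> bcv g -> Er (fun t => nsq (f t + g t)) <=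
  2 * Er (fun t => nsq (f t)) + 2 * Er (fun t => nsq (g t)).
Proof.
move=> bf bg; have bf2 := brv_nsq bf; have bg2 := brv_nsq bg.
rewrite -!ErZ// -ErD; [|exact: brvZ|exact: brvZ].
apply: Er_le => [||t]; last exact: nsqD_le.
  by apply: brv_nsq; exact: bcvD.
by apply: brvD; exact: brvZ.
Qed.

Lemma Er_nsqZ z f : bcv f ->
  Er (fun t => nsq (z * f t)) = nsq z * Er (fun t => nsq (f t)).
Proof.
move=> bf; rewrite -ErZ; last exact: brv_nsq.
by congr Er; apply/funext => t; rewrite nsqM.
Qed.

Lemma CS_E f g : bcv f -> bcv g -> nsq (E (fun t => f t * (g t)^J)) <=
  Er (fun t => nsq (f t)) * Er (fun t => nsq (g t)).
Proof.
move=> bf bg; apply: CS_of_pos => [|l]; first exact: Er_nsq_ge0.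
have bl : bcv (fun t => l^J * g t) by exact: bcvZ.
have := Er_nsq_ge0 (bcvD bf bl); rewrite Er_nsqD// Er_nsqZ// nsqJ.
rewrite (_ : E (fun t => f t * (l^J * g t)^J) = l * E (fun t => f t * (g t)^J)).
  by congr (_ <= _); ring.
rewrite -EZ; last by apply: bcvM => //; exact: bcvJ.
by apply: E_ext => t /=; rewrite conjcM conjcK mulrCA.
Qed.

Definition ek (k : int) (t : R) : C := expi (k%:~R * t).

Lemma expiD (s t : R) : expi (s + t) = expi s * expi t :> C.
Proof. by apply: complexP; rewrite /= ?cosD ?sinD//; ring. Qed.

Lemma expi0 : expi 0 = 1 :> C.
Proof. by rewrite /expi cos0 sin0. Qed.

Lemma expiJ (t : R) : (expi t)^J = expi (- t) :> C.
Proof. by rewrite /expi cosN sinN. Qed.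

Lemma nsq_expi (t : R) : nsq (expi t) = 1.
Proof. by rewrite /nsq/= cos2Dsin2. Qed.

Lemma ekD k l t : ek (k + l) t = ek k t * ek l t.
Proof. by rewrite /ek -expiD -mulrDl intrD. Qed.

Lemma ek0 t : ek 0 t = 1.
Proof. by rewrite /ek mul0r expi0. Qed.

Lemma ekJ k t : (ek k t)^J = ek (- k) t.
Proof. by rewrite /ek expiJ mulrNz mulNr. Qed.

Lemma nsq_ek k t : nsq (ek k t) = 1.
Proof. exact: nsq_expi. Qed.

Lemma ekDt k s t : ek k (s + t) = ek k s * ek k t.
Proof. by rewrite /ek -expiD -mulrDr. Qed.

Lemma bcv_expi : bcv (@expi R).
Proof.
have e2 : 2 * pi = pi *+ 2 :> R by rewrite mulr2n mulrDl mul1r.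
split; split=> [t||].
- by rewrite /= e2 cosD2pi.
- by apply: continuous_measurable_fun; exact: continuous_cos.
- by exists 1 => t; exact: cos_max.
- by rewrite /= e2 sinD2pi.
- by apply: continuous_measurable_fun; exact: continuous_sin.
- by exists 1 => t; exact: sin_max.
Qed.

Lemma bcv_ek k : bcv (ek k).
Proof.
have pos n : bcv (ek n%:Z).
  elim: n => [|n IH]; first by apply: bcv_ext (bcv_cst 1) => t; rewrite ek0.
  rewrite -addn1 PoszD; apply: (bcv_ext (f := fun t => ek n t * expi t)).
    by move=> t; rewrite ekD /ek mul1r.
  by apply: bcvM => //; exact: bcv_expi.
case: k => n; first exact: pos.
by apply: bcv_ext (bcvJ (pos n.+1)) => t; rewrite ekJ.
Qed.

(** A mode changes sign under a suitable rotation, which preserves means. *)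
Lemma E_ek k : E (ek k) = (k == 0)%:R.
Proof.
have [->|k0] := eqVneq k 0.
  by rewrite -[RHS]E_cst; apply: E_ext => t; rewrite ek0.
have kn : k%:~R != 0 :> R by rewrite intr_eq0.
have := E_shift (pi / k%:~R) (bcv_ek k).
rewrite (E_ext (g := fun t => - 1 * ek k t)); last first.
  move=> t; rewrite ekDt mulrC; congr (_ * _).
  rewrite /ek mulrCA divff// mulr1 /expi cospi sinpi.
  by apply: complexP => //=; rewrite oppr0.
rewrite EZ; last exact: bcv_ek.
rewrite mulN1r; case: (E _) => a b [Ha Hb].
by apply: complexP => /=; lra.
Qed.

Definition coef f (k : int) : C := E (fun t => f t * ek (- k) t).

Lemma fourierE f k : fourier f k = coef f k.
Proof.
rewrite /fourier (_ : (fun t => f t * expi (- (k%:~R * t))) =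
  (fun t => f t * ek (- k) t)).
  by apply: complexP; rewrite /= ?mul0r ?subr0 ?addr0.
by apply/funext => t; rewrite /ek mulrNz mulNr.
Qed.

Lemma bcv_coef f k : bcv f -> bcv (fun t => f t * ek k t).
Proof. by move=> bf; apply: bcvM => //; exact: bcv_ek. Qed.

Lemma fcoefD f g k : bcv f -> bcv g ->
  coef (fun t => f t + g t) k = coef f k + coef g k.
Proof.
move=> bf bg; rewrite /coef -ED; [|exact: bcv_coef|exact: bcv_coef].
by apply: E_ext => t; rewrite mulrDl.
Qed.

Lemma fcoefZ z f k : bcv f -> coef (fun t => z * f t) k = z * coef f k.
Proof.
move=> bf; rewrite /coef -EZ; last exact: bcv_coef.
by apply: E_ext => t; rewrite mulrA.
Qed.

Lemma fcoefJ f k : bcv f -> coef (fun t => (f t)^J) k = (coef f (- k))^J.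
Proof.
move=> bf; rewrite /coef -EJ; last exact: bcv_coef.
by rewrite /coef; apply: E_ext => t /=; rewrite conjcM ekJ opprK.
Qed.

Lemma coef_ek f j k : coef (fun t => ek j t * f t) k = coef f (k - j).
Proof.
by apply: E_ext => t; rewrite mulrAC -ekD mulrC opprB.
Qed.

End ComplexMean.

(** * Windows of modes *)

Section Windows.
Context {R : realType}.
Notation C := R[i].
Implicit Types (x y z : C) (f g a b : R -> C) (lo k : int) (n m : nat).

(** Trigonometric polynomials with modes in the window [[lo, lo + n)]. *)
Definition tp lo n (c : 'I_n -> C) (t : R) : C :=
  \sum_(j < n) c j * ek (lo + j%:Z) t.

Lemma bcv_tp lo n (c : 'I_n -> C) : bcv (tp lo c).
Proof. by apply: bcv_sum => j; apply: bcvZ; exact: bcv_ek. Qed.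

Lemma E_tpJ a lo n (c : 'I_n -> C) : bcv a ->
  E (fun t => a t * (tp lo c t)^J) = \sum_(j < n) (c j)^J * coef a (lo + j%:Z).
Proof.
move=> ba; rewrite (E_ext (g := fun t =>
  \sum_(j < n) (c j)^J * (a t * ek (- (lo + j%:Z)) t))); last first.
  move=> t; rewrite /tp conjc_sum mulr_sumr; apply: eq_bigr => j _.
  by rewrite conjcM ekJ mulrCA.
rewrite E_sum => [|j]; last by apply: bcvZ; exact: bcv_coef.
by apply: eq_bigr => j _; rewrite EZ//; exact: bcv_coef.
Qed.

Lemma coef_tp lo n (c : 'I_n -> C) k :
  coef (tp lo c) k = \sum_(j < n) c j * (lo + j%:Z == k)%:R.
Proof.
rewrite /coef (E_ext (g := fun t => \sum_(j < n) c j * ek (lo + j%:Z - k) t)).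
  rewrite E_sum => [|j]; last by apply: bcvZ; exact: bcv_ek.
  apply: eq_bigr => j _; rewrite EZ ?E_ek ?subr_eq0//; exact: bcv_ek.
by move=> t; rewrite /tp mulr_suml; apply: eq_bigr => j _;
  rewrite (ekD (lo + j%:Z) (- k)) mulrA.
Qed.

Lemma coef_tp_in lo n (c : 'I_n -> C) (i : 'I_n) :
  coef (tp lo c) (lo + i%:Z) = c i.
Proof.
rewrite coef_tp (bigD1 i)//= eqxx mulr1 big1 ?addr0// => j ji.
by rewrite (inj_eq (addrI _)) eqz_nat (inj_eq val_inj) (negbTE ji) mulr0.
Qed.

Lemma Er_nsq_tp lo n (c : 'I_n -> C) :
  Er (fun t => nsq (tp lo c t)) = \sum_(j < n) nsq (c j).
Proof.
have := E_nsq (tp lo c); rewrite E_tpJ; last exact: bcv_tp.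
under eq_bigr do rewrite coef_tp_in mulrC -nsqE.
by rewrite -(rmorph_sum (real_complex R)) => -[].
Qed.

Definition energy lo n a : R := \sum_(i < n) nsq (coef a (lo + i%:Z)).

Definition proj lo n a := tp lo (fun j : 'I_n => coef a (lo + j%:Z)).

(** The form of the projection onto the modes outside the window. *)
Definition bes lo n a b : C := E (fun t => a t * (b t)^J) -
  \sum_(i < n) coef a (lo + i%:Z) * (coef b (lo + i%:Z))^J.

Definition bq lo n a : R := Er (fun t => nsq (a t)) - energy lo n a.

Lemma bes_resid lo n a b : bcv a -> bcv b -> bes lo n a b =
  E (fun t => (a t - proj lo n a t) * (b t - proj lo n b t)^J).
Proof.
move=> ba bb.
have bpa : bcv (proj lo n a) by exact: bcv_tp.
have bpb : bcv (proj lo n b) by exact: bcv_tp.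
have baJ := bcvJ ba; have bbJ := bcvJ bb.
have bpaJ := bcvJ bpa; have bpbJ := bcvJ bpb.
rewrite (E_ext (g := fun t => a t * (b t)^J - proj lo n a t * (b t)^J
   - (a t * (proj lo n b t)^J - proj lo n a t * (proj lo n b t)^J))); last first.
  by move=> t; rewrite conjcD conjcN; ring.
have ab : forall u v, bcv u -> bcv v -> bcv (fun t => u t * v t) by move=> *; exact: bcvM.
rewrite !EB; try by do ?[exact: ab|apply: bcvB].
rewrite !E_tpJ//.
rewrite (_ : E (fun t => proj lo n a t * (b t)^J) =
  \sum_(i < n) coef a (lo + i%:Z) * (coef b (lo + i%:Z))^J); last first.
  rewrite (E_ext (g := fun t => (b t * (proj lo n a t)^J)^J)); last first.
    by move=> t; rewrite conjcM conjcK mulrC.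
  rewrite EJ; last exact: ab.
  rewrite E_tpJ// conjc_sum; apply: eq_bigr => i _.
  by rewrite conjcM conjcK.
rewrite -sumrB [X in _ - X]big1 ?subr0// => i _.
by rewrite coef_tp_in subrr.
Qed.

Lemma bes_diag lo n a : bes lo n a a = (bq lo n a)%:C.
Proof.
rewrite /bes /bq E_nsq rmorphB /= /energy; congr (_ - _).
rewrite (rmorph_sum (real_complex R)) /=.
by apply: eq_bigr => i _; rewrite -nsqE.
Qed.

Lemma bq_resid lo n a : bcv a ->
  bq lo n a = Er (fun t => nsq (a t - proj lo n a t)).
Proof.
move=> ba; have := bes_resid lo n ba ba.
by rewrite bes_diag E_nsq => -[].
Qed.

Lemma bcv_resid lo n a : bcv a -> bcv (fun t => a t - proj lo n a t).
Proof. by move=> ba; apply: bcvB => //; exact: bcv_tp. Qed.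

Lemma bq_ge0 lo n a : bcv a -> 0 <= bq lo n a.
Proof. by move=> ba; rewrite bq_resid//; exact/Er_nsq_ge0/bcv_resid. Qed.

Lemma energy_ge0 lo n a : 0 <= energy lo n a.
Proof. by apply: sumr_ge0 => i _; exact: nsq_ge0. Qed.

Lemma energy_le lo n a : bcv a -> energy lo n a <= Er (fun t => nsq (a t)).
Proof. by move=> /(bq_ge0 lo n); rewrite subr_ge0. Qed.

Lemma bq_le lo n a : bq lo n a <= Er (fun t => nsq (a t)).
Proof. by rewrite gerBl energy_ge0. Qed.

Lemma CS_bes lo n a b : bcv a -> bcv b ->
  nsq (bes lo n a b) <= bq lo n a * bq lo n b.
Proof.
move=> ba bb; rewrite bes_resid// !bq_resid//.
by apply: CS_E; exact: bcv_resid.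
Qed.

Lemma bqD_le lo n a b : bcv a -> bcv b ->
  bq lo n (fun t => a t + b t) <= 2 * bq lo n a + 2 * bq lo n b.
Proof.
move=> ba bb; rewrite !bq_resid//; last exact: bcvD.
rewrite (_ : (fun t => nsq (_ - _)) = (fun t => nsq ((a t - proj lo n a t) +
   (b t - proj lo n b t)))).
  by apply: Er_nsqD_le; exact: bcv_resid.
apply/funext => t; congr nsq.
rewrite (_ : proj lo n (fun t => a t + b t) t = proj lo n a t + proj lo n b t).
  by ring.
rewrite /proj /tp -big_split; apply: eq_bigr => i _ /=.
by rewrite fcoefD// mulrDl.
Qed.

Lemma bq_ek lo n j a : bq lo n (fun t => ek j t * a t) = bq (lo - j) n a.
Proof.
rewrite /bq; congr (_ - _).
  by congr Er; apply/funext => t; rewrite nsqM nsq_ek mul1r.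
by apply: eq_bigr => i _; rewrite coef_ek addrAC.
Qed.

Lemma bqZ lo n z a : bcv a -> bq lo n (fun t => z * a t) = nsq z * bq lo n a.
Proof.
move=> ba; rewrite /bq Er_nsqZ// mulrBr; congr (_ - _).
by rewrite mulr_sumr; apply: eq_bigr => i _; rewrite fcoefZ// nsqM.
Qed.

Lemma energy_cat lo n m a :
  energy lo (n + m) a = energy lo n a + energy (lo + n%:Z) m a.
Proof.
rewrite /energy big_split_ord /=; congr (_ + _).
by apply: eq_bigr => i _; rewrite PoszD addrA.
Qed.

(** The window [[0, m)] is the intersection of [[0, n)] and [[m - n, m)], whose
union is again a window: Bessel's inequality on that union compares the three
residual energies. *)
Lemma bq_two_ends m n a : bcv a -> (m <= n)%N ->
  bq 0 m a <= bq 0 n a + bq (m%:Z - n%:Z) n a.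
Proof.
move=> ba mn; rewrite /bq.
have e1 : energy 0 n a = energy 0 m a + energy m%:Z (n - m) a.
  by rewrite -{1}(subnKC mn) energy_cat add0r.
have e2 : energy (m%:Z - n%:Z) (n + (n - m)) a =
    energy (m%:Z - n%:Z) n a + energy m%:Z (n - m) a.
  by rewrite energy_cat subrK.
have := energy_le (m%:Z - n%:Z) (n + (n - m)) ba.
rewrite e2 e1; lra.
Qed.

End Windows.

(** * The form of the Toeplitz defect *)

Section Matrices.
Context {R : realType}.
Notation C := R[i].
Implicit Types (f g : R -> C) (n m : nat).

Lemma CS_sum n (a b : 'I_n -> C) :
  nsq (\sum_(i < n) a i * b i) <= (\sum_(i < n) nsq (a i)) * \sum_(i < n) nsq (b i).
Proof.
have := CS_E (bcv_tp 0 a) (bcv_tp 0 (fun i => (b i)^J)).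
rewrite !Er_nsq_tp E_tpJ; last exact: bcv_tp.
under eq_bigr do rewrite coef_tp_in conjcK mulrC.
by under [X in _ <= _ * X]eq_bigr do rewrite nsqJ.
Qed.

Definition vsq n (x : 'cV[C]_n) : R := \sum_(i < n) nsq (x i 0).

Lemma vsq_ge0 n (x : 'cV[C]_n) : 0 <= vsq x.
Proof. by apply: sumr_ge0 => i _; exact: nsq_ge0. Qed.

Lemma vnormE n (x : 'cV[C]_n) : vnorm x = Num.sqrt (vsq x).
Proof.
by rewrite /vnorm; congr Num.sqrt; apply: eq_bigr => i _; rewrite normc_sqr.
Qed.

Lemma vsq0 n : vsq (0 : 'cV[C]_n) = 0.
Proof. by apply: big1 => i _; rewrite mxE nsq0. Qed.

Lemma vsqZ n z (x : 'cV[C]_n) : vsq (z *: x) = nsq z * vsq x.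
Proof. by rewrite mulr_sumr; apply: eq_bigr => i _; rewrite mxE nsqM. Qed.

Lemma vsqD_le n (x y : 'cV[C]_n) : vsq (x + y) <= 2 * vsq x + 2 * vsq y.
Proof.
rewrite !mulr_sumr -big_split; apply: ler_sum => i _ /=.
by rewrite mxE; exact: nsqD_le.
Qed.

Lemma mx_bounded n (A : 'M[C]_n) :
  exists B : R, forall x : 'cV[C]_n, vsq (A *m x) <= B * vsq x.
Proof.
exists (\sum_(i < n) \sum_(j < n) nsq (A i j)) => x.
rewrite mulr_suml; apply: ler_sum => i _.
by rewrite mxE; exact: CS_sum.
Qed.

Lemma opnorm_le n (A : 'M[C]_n) (c : R) : 0 <= c ->
  (forall x : 'cV[C]_n, vsq (A *m x) <= c ^+ 2 * vsq x) -> opnorm A <= c.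
Proof.
move=> c0 H; apply: ge_sup.
  by exists 0; exists 0; rewrite /= ?mulmx0 vnormE vsq0 sqrtr0// ler01.
move=> _ [x /= x1 <-]; rewrite vnormE.
rewrite -[leRHS](ger0_norm c0) -sqrtr_sqr ler_wsqrtr// (le_trans (H x))//.
rewrite -[leRHS]mulr1 ler_wpM2l ?sqr_ge0//.
move: x1; rewrite vnormE -[X in _ <= X]sqrtr1.
by rewrite ler_sqrt// ler01.
Qed.

Lemma opnorm_vsq n (A : 'M[C]_n) (e : R) : opnorm A < e ->
  forall x : 'cV[C]_n, vsq (A *m x) <= e ^+ 2 * vsq x.
Proof.
move=> Ae x; have [B HB] := mx_bounded A.
have ub : has_ubound [set vnorm (A *m x) | x in [set x : 'cV[C]_n | vnorm x <= 1]].
  exists (Num.sqrt `|B|) => _ [y /= y1 <-]; rewrite vnormE ler_wsqrtr//.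
  have yy : vsq y <= 1.
    by move: y1; rewrite vnormE -[X in _ <= X]sqrtr1 ler_sqrt// ler01.
  rewrite (le_trans (HB y))// (le_trans (y := `|B| * vsq y))//.
    by rewrite ler_wpM2r ?vsq_ge0// ler_norm.
  by rewrite -[leRHS]mulr1 ler_wpM2l.
have key y : vsq y <= 1 -> vsq (A *m y) <= e ^+ 2.
  move=> y1; have : vnorm (A *m y) <= opnorm A.
    apply: ub_le_sup => //; exists y => //=.
    by rewrite vnormE -[X in _ <= X]sqrtr1 ler_wsqrtr.
  rewrite vnormE => /le_lt_trans/(_ Ae) lte.
  have e0 : 0 < e by rewrite (le_lt_trans _ lte)// sqrtr_ge0.
  by rewrite -(sqr_sqrtr (vsq_ge0 _)) ler_sqr ?nnegrE ?sqrtr_ge0 ?ltW.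
have [x0|x0] := eqVneq (vsq x) 0.
  by have := HB x; rewrite x0 !mulr0.
have xp : 0 < vsq x by rewrite lt_neqAle eq_sym x0 vsq_ge0.
pose s := (Num.sqrt (vsq x))^-1.
have s2 : s ^+ 2 * vsq x = 1 by rewrite exprVn sqr_sqrtr ?vsq_ge0// mulVf.
have := key (s%:C *: x); rewrite -scalemxAr !vsqZ nsq_real s2 => /(_ (lexx _)).
move=> H; rewrite -[leLHS]mul1r -s2 mulrAC ler_wpM2r ?vsq_ge0//.
Qed.

Definition cv n (x : 'cV[C]_n) : 'I_n -> C := fun j => x j 0.

(** The product of the truncated matrices leaves out what multiplication by [g]
sends outside the window [[0, n)] and multiplication by [f] brings back; this is
the residual of Bessel's inequality for the window. *)
Lemma defect_form f g n (x y : 'cV[C]_n) : bcv f -> bcv g ->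
  \sum_(i < n) (y i 0)^J * (toeplitz_defect f g n *m x) i 0 =
  bes 0 n (fun t => g t * tp 0 (cv x) t) (fun t => (f t)^J * tp 0 (cv y) t).
Proof.
move=> bf bg; have bfg : bcv (fun t => f t * g t) by exact: bcvM.
have coefX h (bh : bcv h) (c : 'I_n -> C) k :
    coef (fun t => h t * tp 0 c t) k = \sum_(j < n) c j * coef h (k - j%:Z).
  rewrite /coef (E_ext (g := fun t => \sum_(j < n) c j * (h t * ek (- (k - j%:Z)) t))).
    rewrite E_sum => [|j]; last by apply: bcvZ; exact: bcv_coef.
    by apply: eq_bigr => j _; rewrite EZ//; exact: bcv_coef.
  move=> t; rewrite /tp mulr_sumr mulr_suml; apply: eq_bigr => j _.
  by rewrite opprB add0r ekD; ring.
have e1 : E (fun t => (g t * tp 0 (cv x) t) * ((f t)^J * tp 0 (cv y) t)^J) =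
    \sum_(i < n) (y i 0)^J * \sum_(j < n)
      coef (fun t => f t * g t) (i%:Z - j%:Z) * x j 0.
  rewrite (E_ext (g := fun t => (f t * g t * tp 0 (cv x) t) * (tp 0 (cv y) t)^J)).
    rewrite E_tpJ; last by apply: bcvM => //; exact: bcv_tp.
    apply: eq_bigr => i _; rewrite coefX// add0r; congr (_ * _).
    by apply: eq_bigr => j _; rewrite mulrC.
  by move=> t; rewrite conjcM conjcK; ring.
have e2 : \sum_(l < n) coef (fun t => g t * tp 0 (cv x) t) (0 + l%:Z) *
      (coef (fun t => (f t)^J * tp 0 (cv y) t) (0 + l%:Z))^J =
    \sum_(i < n) (y i 0)^J * \sum_(j < n)
      (\sum_(l < n) coef f (i%:Z - l%:Z) * coef g (l%:Z - j%:Z)) * x j 0.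
  transitivity (\sum_(l < n) \sum_(i < n) \sum_(j < n)
      (y i 0)^J * (coef f (i%:Z - l%:Z) * coef g (l%:Z - j%:Z) * x j 0)).
    apply: eq_bigr => l _; rewrite add0r coefX// coefX; last exact: bcvJ.
    rewrite conjc_sum mulr_sumr; apply: eq_bigr => i _.
    rewrite mulr_suml; apply: eq_bigr => j _.
    by rewrite fcoefJ// conjcM conjcK opprB /cv; ring.
  rewrite exchange_big; apply: eq_bigr => i _ /=.
  rewrite exchange_big mulr_sumr; apply: eq_bigr => j _ /=.
  by rewrite mulr_suml mulr_sumr.
rewrite /bes e1 e2 -sumrB; apply: eq_bigr => i _.
rewrite -mulrBr mxE -sumrB; congr (_ * _); apply: eq_bigr => j _.
rewrite !mxE fourierE mulrBl; congr (_ - _ * _).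
by apply: eq_bigr => l _; rewrite !mxE !fourierE.
Qed.

Lemma defect_vsq f g n (K L : R) : bcv f -> bcv g ->
  (forall x : 'cV[C]_n, bq 0 n (fun t => g t * tp 0 (cv x) t) <= K * vsq x) ->
  (forall y : 'cV[C]_n, bq 0 n (fun t => (f t)^J * tp 0 (cv y) t) <= L * vsq y) ->
  forall x, vsq (toeplitz_defect f g n *m x) <= K * L * vsq x.
Proof.
move=> bf bg HK HL x; set y := _ *m x.
have := defect_form x y bf bg; rewrite -/y.
rewrite (_ : \sum_i _ = (vsq y)%:C); last first.
  rewrite (rmorph_sum (real_complex R)) /=; apply: eq_bigr => i _.
  by rewrite nsqE mulrC.
move=> e; have bX : bcv (fun t => g t * tp 0 (cv x) t).
  by apply: bcvM => //; exact: bcv_tp.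
have bY : bcv (fun t => (f t)^J * tp 0 (cv y) t).
  by apply: bcvM; [exact: bcvJ|exact: bcv_tp].
have := CS_bes 0 n bX bY; rewrite -e nsq_real => H.
have H2 : vsq y ^+ 2 <= (K * vsq x) * (L * vsq y).
  apply: (le_trans H); apply: ler_pM => //; exact: bq_ge0.
have [y0|y0] := eqVneq (vsq y) 0.
  rewrite y0; have [x0|x0] := eqVneq (vsq x) 0; first by rewrite x0 mulr0.
  have xp : 0 < vsq x by rewrite lt_neqAle eq_sym x0 vsq_ge0.
  have k0 : 0 <= K.
    by rewrite -(pmulr_lge0 _ xp) (le_trans _ (HK x))// bq_ge0.
  have l0 : 0 <= L.
    rewrite -(pmulr_lge0 _ xp) (le_trans _ (HL x))// bq_ge0//.
    by apply: bcvM; [exact: bcvJ|exact: bcv_tp].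
  by rewrite mulr_ge0 ?mulr_ge0// vsq_ge0.
have yp : 0 < vsq y by rewrite lt_neqAle eq_sym y0 vsq_ge0.
by rewrite -(ler_pM2r yp); move: H2; rewrite expr2; lra.
Qed.

End Matrices.

(** * Matrices of low rank on nearly orthonormal families *)

Section LowRank.
Context {R : realType}.
Notation C := R[i].
Implicit Types (n m k : nat).

Definition ip n (x y : 'cV[C]_n) : C := \sum_(i < n) x i 0 * (y i 0)^J.

Lemma vsq_ip n (x : 'cV[C]_n) : (vsq x)%:C = ip x x.
Proof.
rewrite (rmorph_sum (real_complex R)) /=; apply: eq_bigr => i _.
exact: nsqE.
Qed.

(** A matrix factors through the orthogonal projection onto its row space, whose
dimension is its rank. *)
Lemma orthonormal_row_space n (A : 'M[C]_n) :
  exists Q : 'M[C]_(\rank A, n),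
    (forall i j, \sum_(l < n) Q i l * (Q j l)^J = (i == j)%:R) /\
    A = A *m (\matrix_(l, j) (Q j l)^J) *m Q.
Proof.
pose Q := schmidt (row_base A).
have uQ : Q \is unitarymx by apply: schmidt_unitarymx; exact: rank_leq_row.
have QQ : Q *m (\matrix_(l, j) (Q j l)^J) = 1%:M.
  rewrite -[RHS](unitarymxP uQ); congr (_ *m _).
  by apply/matrixP => i j; rewrite !mxE.
exists Q; split=> [i j|].
  have /matrixP/(_ i j) := QQ; rewrite !mxE => <-.
  by apply: eq_bigr => l _; rewrite mxE.
have /submxP[W AW] : (A <= Q)%MS.
  by rewrite (eqmx_schmidt_free (row_base_free A)) eq_row_base.
have := congr1 (fun M => W *m M *m Q) QQ.
by rewrite mulmx1 mulmxA -AW.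
Qed.

Lemma vsq_adjoint n r (Q : 'M[C]_(r, n)) (z : 'cV[C]_r) :
  (forall i j, \sum_(l < n) Q i l * (Q j l)^J = (i == j)%:R) ->
  vsq ((\matrix_(l < n, j < r) (Q j l)^J) *m z) = vsq z.
Proof.
move=> QQ; apply: (@complexI R); rewrite !vsq_ip /ip.
transitivity (\sum_(l < n) \sum_(j < r) \sum_(i < r)
   (z j 0 * (z i 0)^J) * (Q i l * (Q j l)^J)).
  apply: eq_bigr => l _; rewrite mxE conjc_sum mulr_suml.
  apply: eq_bigr => j _; rewrite mulr_sumr; apply: eq_bigr => i _.
  by rewrite !mxE conjcM conjcK; ring.
rewrite exchange_big; apply: eq_bigr => j _ /=.
rewrite exchange_big /= (bigD1 j)//= -mulr_sumr QQ eqxx mulr1 big1 ?addr0//.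
by move=> i ij; rewrite -mulr_sumr QQ (negbTE ij) mulr0.
Qed.

Lemma Re_young (s : R) (a b : C) : 0 < s ->
  2 * Re (a * b^J) <= s * nsq a + s^-1 * nsq b.
Proof.
move=> s0; have := nsq_ge0 (s%:C * a - b); rewrite nsqD nsqM nsqN nsq_real.
rewrite (_ : Re _ = - (s * Re (a * b^J))); last first.
  by case: a b => u v [w z]; rewrite /=; ring.
move=> H; rewrite -(ler_pM2l s0).
rewrite mulrDr !mulrA divff ?gt_eqF// mul1r; move: H; lra.
Qed.

Lemma vsqD n (x y : 'cV[C]_n) : vsq (x + y) = vsq x + vsq y + 2 * Re (ip x y).
Proof.
rewrite /ip cRe_sum mulr_sumr -!big_split; apply: eq_bigr => i _ /=.
by rewrite mxE nsqD.
Qed.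

Lemma ip_suml n k (x : 'I_k -> 'cV[C]_n) (y : 'cV[C]_n) :
  ip (\sum_(i < k) x i) y = \sum_(i < k) ip (x i) y.
Proof.
rewrite /ip exchange_big; apply: eq_bigr => l _ /=.
by rewrite summxE mulr_suml.
Qed.

Lemma ipJ n (x y : 'cV[C]_n) : (ip x y)^J = ip y x.
Proof.
by rewrite /ip conjc_sum; apply: eq_bigr => i _; rewrite conjcM conjcK mulrC.
Qed.

Lemma ipZl n z (x y : 'cV[C]_n) : ip (z *: x) y = z * ip x y.
Proof. by rewrite /ip mulr_sumr; apply: eq_bigr => i _; rewrite mxE mulrA. Qed.

Lemma ipZr n z (x y : 'cV[C]_n) : ip x (z *: y) = z^J * ip x y.
Proof. by rewrite -ipJ ipZl conjcM ipJ. Qed.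

Lemma ip_sumr n k (x : 'I_k -> 'cV[C]_n) (y : 'cV[C]_n) :
  ip y (\sum_(i < k) x i) = \sum_(i < k) ip y (x i).
Proof.
by rewrite -ipJ ip_suml conjc_sum; apply: eq_bigr => i _; rewrite ipJ.
Qed.

(** Nearly orthonormal vectors satisfy Bessel's inequality up to a factor two:
test the positivity of the squared distance to half of the expected
projection. *)
Lemma almost_bessel n k (x : 'I_k -> 'cV[C]_n) (q : 'cV[C]_n) :
  (forall j, vsq (x j) = 1) ->
  (forall i j, i != j -> nsq (ip (x i) (x j)) <= k%:R ^- 2) ->
  \sum_(j < k) nsq (ip q (x j)) <= 2 * vsq q.
Proof.
move=> x1 xx; set S := \sum_j _.
case: k x x1 xx @S => [|k'] x x1 xx S.
  by rewrite /S big_ord0 mulr_ge0// vsq_ge0.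
set k := k'.+1 in x x1 xx S *.
have k0 : 0 < k%:R :> R by rewrite ltr0n.
pose c j := ip q (x j); pose p : 'cV[C]_n := \sum_(j < k) c j *: x j.
have S0 : 0 <= S by apply: sumr_ge0 => j _; exact: nsq_ge0.
have qp : Re (ip q p) = S.
  rewrite ip_sumr cRe_sum; apply: eq_bigr => j _.
  by rewrite ipZr /c mulrC -nsqE.
(* the Gram matrix is within 1/k of the identity entrywise *)
have vp : vsq p <= 2 * S.
  have -> : vsq p = \sum_(i < k) \sum_(j < k) Re (c i * (c j)^J * ip (x i) (x j)).
    have := vsq_ip p => /(congr1 (@complex.Re R)) /= ->; rewrite {1}/p ip_suml cRe_sum.
    apply: eq_bigr => i _; rewrite ipZl /p ip_sumr mulr_sumr cRe_sum.
    by apply: eq_bigr => j _; rewrite ipZr mulrA.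
  apply: (@le_trans _ _ (\sum_(i < k) \sum_(j < k)
      ((i == j)%:R * nsq (c i) + (2 * k%:R)^-1 * (nsq (c i) + nsq (c j))))).
    apply: ler_sum => i _; apply: ler_sum => j _.
    have [<-|ij] := eqVneq i j.
      rewrite -vsq_ip x1 mulr1 -nsqE /= mul1r lerDl.
      apply: mulr_ge0; last by apply: addr_ge0; exact: nsq_ge0.
      by rewrite invr_ge0 mulr_ge0 ?ltW.
    have := @Re_young k%:R (c i * ip (x i) (x j)) (c j) k0.
    rewrite mulrAC nsqM mul0r add0r.
    have : k%:R * (nsq (c i) * nsq (ip (x i) (x j))) <= k%:R^-1 * nsq (c i).
      rewrite (_ : k%:R^-1 * _ = k%:R * (nsq (c i) * k%:R ^- 2)); last first.
        by field; rewrite gt_eqF.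
      by rewrite ler_wpM2l// ler_wpM2l ?nsq_ge0// xx.
    by rewrite invfM; lra.
  under eq_bigr => i _.
    rewrite big_split /= -mulr_sumr big_split /= sumr_const card_ord -/S.
    rewrite (bigD1 i)//= eqxx mul1r big1 => [|j ji]; last first.
      by rewrite eq_sym (negbTE ji) mul0r.
    over.
  rewrite big_split /= -mulr_sumr big_split /= -[\sum_(i < k) nsq (c i)]/S.
  rewrite big_split /= !sumr_const card_ord.
  rewrite mul0rn addr0 sumrMnl -/S -(mulr_natr S).
  suff -> : S + (2 * k%:R)^-1 * (S * k%:R + S * k%:R) = 2 * S by [].
  by field; rewrite gt_eqF.
have := vsq_ge0 (q + (- (2^-1)%:C) *: p).
rewrite vsqD vsqZ nsqN nsq_real ipZr.
rewrite (_ : Re _ = - 2^-1 * S); first by move: vp; lra.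
by rewrite -qp; case: (ip q p) => u v; rewrite /=; ring.
Qed.

(** Two families are treated at once because a Dirichlet kernel is later placed at
both ends of a window, and both copies have to be good for the same index. *)
Lemma low_rank_small n k (A : 'M[C]_n) (N1 : nat) (B : R)
    (x x' : 'I_k -> 'cV[C]_n) :
  (0 < k)%N -> (\rank A <= N1)%N ->
  (forall z : 'cV[C]_n, vsq (A *m z) <= B * vsq z) -> 0 <= B ->
  (forall j, vsq (x j) = 1) ->
  (forall i j, i != j -> nsq (ip (x i) (x j)) <= k%:R ^- 2) ->
  (forall j, vsq (x' j) = 1) ->
  (forall i j, i != j -> nsq (ip (x' i) (x' j)) <= k%:R ^- 2) ->
  exists j, vsq (A *m x j) <= B * (4 * N1%:R / k%:R) /\
            vsq (A *m x' j) <= B * (4 * N1%:R / k%:R).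
Proof.
move=> k0 rA AB B0 x1 xx x'1 xx'.
have [Q [QQ AQ]] := orthonormal_row_space A.
have Qb (y : 'I_k -> 'cV[C]_n) : (forall j, vsq (y j) = 1) ->
    (forall i j, i != j -> nsq (ip (y i) (y j)) <= k%:R ^- 2) ->
    \sum_(j < k) vsq (Q *m y j) <= 2 * N1%:R.
  move=> y1 yy; rewrite /vsq exchange_big /=.
  apply: (@le_trans _ _ (\sum_(i < \rank A) 2)); last first.
    by rewrite sumr_const card_ord -[_ *+ \rank A]mulr_natr ler_wpM2l// ler_nat.
  apply: ler_sum => i _.
  pose q : 'cV[C]_n := \col_l (Q i l)^J.
  have := almost_bessel q y1 yy.
  rewrite (_ : vsq q = 1) ?mulr1.
    congr (_ <= _); apply: eq_bigr => j _; rewrite -nsqJ ipJ mxE.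
    by congr nsq; apply: eq_bigr => l _; rewrite mxE conjcK mulrC.
  apply: (@complexI R); rewrite vsq_ip /ip.
  transitivity ((i == i)%:R : C); last by rewrite eqxx.
  rewrite -(QQ i i); apply: eq_bigr => l _.
  by rewrite !mxE conjcK mulrC.
have AQle z : vsq (A *m z) <= B * vsq (Q *m z).
  rewrite (_ : A *m z = A *m ((\matrix_(l, j) (Q j l)^J) *m (Q *m z))).
    by rewrite (le_trans (AB _))// vsq_adjoint.
  by rewrite !mulmxA -AQ.
(* pigeonhole: the projections onto the row space have total energy at most
   twice its dimension in each of the two families *)
have [j Hj] : exists j, vsq (Q *m x j) + vsq (Q *m x' j) <= 4 * N1%:R / k%:R.
  apply: contrapT => H.
  have : \sum_(j < k) (vsq (Q *m x j) + vsq (Q *m x' j)) >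
      \sum_(j < k) (4 * N1%:R / k%:R).
    apply: ltr_sum => [|j _].
      by apply/hasP; exists (Ordinal k0) => //; exact: mem_index_enum.
    by rewrite ltNge; apply/negP => Hj; apply: H; exists j.
  rewrite sumr_const card_ord -[_ *+ k]mulr_natr divfK ?pnatr_eq0 -?lt0n//.
  rewrite big_split /= => H2.
  have := Qb x x1 xx; have := Qb x' x'1 xx'; lra.
exists j; split; apply: (le_trans (AQle _)); rewrite ler_wpM2l// (le_trans _ Hj)//.
  by rewrite lerDl vsq_ge0.
by rewrite lerDr vsq_ge0.
Qed.

End LowRank.

(** * The cluster property and Dirichlet kernels *)

Section ClusterToDecay.
Context {R : realType}.
Notation C := R[i].
Implicit Types (f : R -> C) (n m d k : nat) (t s : R).

Lemma sum_window (V : nmodType) n d m (F : nat -> V) : (d + m <= n)%N ->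
  \sum_(i < n) (if (d <= i < d + m)%N then F (i - d)%N else 0) =
  \sum_(j < m) F j.
Proof.
move=> dmn; rewrite -(subnKC dmn) -addnA big_split_ord /= big1 ?add0r; last first.
  by move=> i _; rewrite leqNgt ltn_ord.
rewrite big_split_ord /= [X in _ + X]big1 ?addr0; last first.
  by move=> i _; rewrite ltn_add2l ltnNge !leq_addr.
by apply: eq_bigr => i _; rewrite leq_addr ltn_add2l ltn_ord addKn.
Qed.

Definition dirichlet m t : R -> C := tp 0 (fun j : 'I_m => ek (- j%:Z) t).

Lemma bcv_dirichlet m t : bcv (dirichlet m t).
Proof. exact: bcv_tp. Qed.

(** The coefficients of a Dirichlet kernel, moved to the window that starts at
[d]. *)
Definition dvec n d m t : 'cV[C]_n :=
  \col_i (if (d <= i < d + m)%N then ek (- (i - d)%N%:Z) t else 0).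

Lemma tp_dvec n d m t s : (d + m <= n)%N ->
  tp 0 (cv (dvec n d m t)) s = ek d s * dirichlet m t s.
Proof.
move=> dmn; rewrite /tp /dirichlet /tp mulr_sumr.
rewrite -(sum_window (fun j => ek d s * (ek (- j%:Z) t * ek (0 + j%:Z) s)) dmn).
apply: eq_bigr => i _; rewrite /cv mxE.
case: ifP => [/andP[di _]|_]; last by rewrite mul0r.
rewrite mulrCA -ekD; congr (_ * ek _ s).
by rewrite !add0r -PoszD subnKC.
Qed.

Lemma vsq_dvec n d m t : (d + m <= n)%N -> vsq (dvec n d m t) = m%:R.
Proof.
move=> dmn; transitivity (\sum_(j < m) (1 : R)); last first.
  by rewrite sumr_const card_ord.
rewrite -(sum_window (fun=> (1 : R)) dmn); apply: eq_bigr => i _; rewrite mxE.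
by case: ifP => _; rewrite ?nsq_ek// nsq0.
Qed.

Lemma ip_dvec n d m t d' m' t' : (d + m <= n)%N ->
  nsq (ip (dvec n d m t) (dvec n d' m' t')) <= m%:R ^+ 2.
Proof.
move=> dmn.
rewrite (_ : ip _ _ = \sum_(i < n) dvec n d m t i 0 *
    (if (d <= i < d + m)%N then (dvec n d' m' t' i 0)^J else 0)).
  apply: (le_trans (CS_sum _ _)); rewrite expr2 -{1}(vsq_dvec t dmn).
  rewrite ler_wpM2l ?vsq_ge0//.
  apply: (@le_trans _ _ (\sum_(j < m) 1)); last by rewrite sumr_const card_ord.
  rewrite -(sum_window (fun=> (1 : R)) dmn); apply: ler_sum => i _.
  case: ifP => _; rewrite ?nsq0// nsqJ mxE.
  by case: ifP => _; rewrite ?nsq0// nsq_ek.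
apply: eq_bigr => i _; rewrite [in RHS]mxE; case: ifP => [di|]; last first.
  by rewrite mxE => ->; rewrite mul0r mulr0.
by congr (_ * _); rewrite mxE di.
Qed.

Lemma Re_le_of_nsq (z : C) (c : R) : 0 <= c -> nsq z <= c ^+ 2 -> Re z <= c.
Proof.
move=> c0 zc; have [z0|z0] := ltP (Re z) 0; first exact: le_trans (ltW z0) c0.
rewrite -(ler_pXn2r (ltn0Sn 1)) ?nnegrE//; apply: le_trans zc.
by rewrite /nsq lerDl sqr_ge0.
Qed.

Lemma bq_mul_le f n (M : R) : bcv f -> (forall t, nsq (f t) <= M) ->
  forall x : 'cV[C]_n, bq 0 n (fun t => f t * tp 0 (cv x) t) <= M * vsq x.
Proof.
move=> bf fM x; apply: (le_trans (bq_le _ _ _)).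
have bt := bcv_tp 0 (cv x).
rewrite /vsq -(Er_nsq_tp 0 (cv x)) -ErZ; last exact: brv_nsq.
apply: Er_le => [||t]; first by apply: brv_nsq; exact: bcvM.
- by apply: brvZ; exact: brv_nsq.
- by rewrite nsqM ler_wpM2r ?nsq_ge0.
Qed.

(** A failure of the conclusion provides kernels with arbitrarily many modes on
which the defect of the pair [conj(f)], [f] is bounded below.  When the numbers of
modes grow fast enough the normalized kernels are nearly orthonormal, whatever
their positions in a common window, and the part of bounded rank cannot account for
all of them. *)
Lemma cluster_decay f : bcv f ->
  type2_strong_cluster0 (toeplitz_defect (fun t => (f t)^J) f) ->
  forall e : R, 0 < e -> exists m0, forall m t, (m0 <= m)%N ->
    bq 0 m (fun s => f s * dirichlet m t s) <= e * m%:R.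
Proof.
move=> bf Hcl dl dl0; apply: contrapT => Hno.
have /choice[pick Hpick] : forall m0, exists mt : nat * R, (m0 <= mt.1)%N /\
    dl * mt.1%:R < bq 0 mt.1 (fun s => f s * dirichlet mt.1 mt.2 s).
  move=> m0; apply: contrapT => H; apply: Hno; exists m0 => m t mm.
  by rewrite leNgt; apply/negP => Hm; apply: H; exists (m, t).
have [M fM] := bcv_bound bf.
have M0 : 0 <= M by rewrite (le_trans (nsq_ge0 (f 0)) (fM 0)).
pose e := dl / 8; have e0 : 0 < e by rewrite divr_gt0.
have [N1 [N2 [_ _ HN]]] := Hcl e e0.
(* bound for the low rank part, as a difference of the defect and a small matrix *)
pose B := 2 * M ^+ 2 + 2 * e ^+ 2.
have B0 : 0 <= B by rewrite /B; have := sqr_ge0 M; have := sqr_ge0 e; lra.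
(* enough vectors for the low rank part to be smaller than e on one of them *)
have [k k0 Hk] : exists2 k, (0 < k)%N & B * (4 * N1%:R / k%:R) <= e ^+ 2.
  pose k := (Num.truncn (B * 4 * N1%:R / e ^+ 2)).+1.
  exists k => //; have kp : 0 < k%:R :> R by rewrite ltr0n.
  have : B * 4 * N1%:R / e ^+ 2 < k%:R by exact: truncnS_gt.
  rewrite ltr_pdivrMr ?exprn_gt0// => /ltW H.
  by rewrite !mulrA ler_pdivrMr// [leRHS]mulrC.
(* [ip_dvec] bounds the inner product of normalized kernels with [m_i < m_j] modes
   by the square root of [m_i / m_j], hence the growth by a factor [k^2] *)
pose q := fix q (j : nat) : nat * R :=
  if j is j'.+1 then pick (k ^ 2 * (q j').1)%N else pick 1%N.
pose ms j := (q j).1; pose ts j := (q j).2.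
have ms_bad j : dl * (ms j)%:R <
    bq 0 (ms j) (fun s => f s * dirichlet (ms j) (ts j) s).
  by case: j => [|j]; [exact: (Hpick 1%N).2|exact: (Hpick _).2].
have ms_step j : (k ^ 2 * ms j <= ms j.+1)%N.
  by have [] := Hpick (k ^ 2 * (q j).1)%N.
have ms_gt0 j : (0 < ms j)%N.
  elim: j => [|j IH]; first by have [] := Hpick 1%N.
  by rewrite (leq_trans _ (ms_step j))// muln_gt0 expn_gt0 k0.
have ms_le i j : (i <= j)%N -> (ms i <= ms j)%N.
  move=> /subnK <-; elim: (j - i)%N => // l IH; rewrite addSn.
  by rewrite (leq_trans IH)// (leq_trans _ (ms_step _))// leq_pmull// expn_gt0 k0.
have ms_lt i j : (i < j)%N -> (k ^ 2 * ms i <= ms j)%N.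
  by move=> ij; rewrite (leq_trans (ms_step i))// ms_le.
pose n := (N2.+1 + ms k)%N.
have msn (j : 'I_k) : (ms j <= n)%N.
  by apply: (leq_trans (ms_le j k (ltnW (ltn_ord j)))); exact: leq_addl.
have [Rn [Nn [Dn rR nN]]] := HN n (leq_addr _ _).
set D := toeplitz_defect _ _ _ in Dn.
have Nb := opnorm_vsq nN.
have Db : forall z, vsq (D *m z) <= M * M * vsq z.
  apply: defect_vsq => //; first exact: bcvJ.
    exact: bq_mul_le.
  by move=> y; have := bq_mul_le bf fM y; congr (_ <= _); congr bq;
    apply/funext => t; rewrite conjcK.
have Rb z : vsq (Rn *m z) <= B * vsq z.
  have -> : Rn = D + - Nn by rewrite Dn addrK.
  rewrite mulmxDl; apply: (le_trans (vsqD_le _ _)).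
  rewrite /B [leRHS]mulrDl; apply: lerD.
    by rewrite -mulrA ler_wpM2l// expr2.
  by rewrite mulNmx -scaleN1r vsqZ nsqN -mulrA ler_wpM2l// nsq_real expr1n mul1r.
pose x (d : 'I_k -> nat) (j : 'I_k) : 'cV[C]_n :=
  ((Num.sqrt (ms j)%:R)^-1)%:C *: dvec n (d j) (ms j) (ts j).
have x1 (d : 'I_k -> nat) : (forall j, d j + ms j <= n)%N -> forall j, vsq (x d j) = 1.
  move=> dn j; rewrite vsqZ vsq_dvec// nsq_real exprVn sqr_sqrtr//.
  by rewrite mulVf// pnatr_eq0 -lt0n.
have xx (d : 'I_k -> nat) : (forall j, d j + ms j <= n)%N ->
    forall i j, i != j -> nsq (ip (x d i) (x d j)) <= k%:R ^- 2.
  move=> dn.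
  have wl (i j : 'I_k) : (i < j)%N -> nsq (ip (x d i) (x d j)) <= k%:R ^- 2.
    move=> ij; rewrite ipZl ipZr !nsqM nsqJ !nsq_real !exprVn !sqr_sqrtr//.
    have mi : 0 < (ms i)%:R :> R by rewrite ltr0n.
    have mj : 0 < (ms j)%:R :> R by rewrite ltr0n.
    have kp : 0 < k%:R :> R by rewrite ltr0n.
    have := ip_dvec (ts i) (d j) (ms j) (ts j) (dn i).
    have : k%:R ^+ 2 * (ms i)%:R <= (ms j)%:R :> R.
      by rewrite -natrX -natrM ler_nat; exact: ms_lt.
    set N := nsq _; move=> h1 h2.
    apply: (@le_trans _ _ ((ms i)%:R^-1 * ((ms j)%:R^-1 * (ms i)%:R ^+ 2))).
      by apply: ler_wpM2l; [rewrite invr_ge0 ltW|apply: ler_wpM2l => //; rewrite invr_ge0 ltW].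
    rewrite (_ : _ * _ = (ms i)%:R / (ms j)%:R); last first.
      by field; rewrite !gt_eqF.
    by rewrite ler_pdivrMr// mulrC -ler_pdivrMr ?invr_gt0 ?exprn_gt0// invrK mulrC.
  move=> i j; rewrite neq_ltn => /orP[|ji]; first exact: wl.
  by rewrite -nsqJ ipJ wl.
(* each kernel is placed at both ends of the window, as [bq_two_ends] requires *)
pose d0 (j : 'I_k) := 0%N; pose d1 (j : 'I_k) := (n - ms j)%N.
have d0n j : (d0 j + ms j <= n)%N by rewrite add0n.
have d1n j : (d1 j + ms j <= n)%N by rewrite subnK.
have [j [H0 H1]] := low_rank_small k0 rR Rb B0 (x1 _ d0n) (xx _ d0n)
  (x1 _ d1n) (xx _ d1n).
have bqx (d : 'I_k -> nat) : (forall j, d j + ms j <= n)%N ->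
    vsq (Rn *m x d j) <= B * (4 * N1%:R / k%:R) ->
    bq 0 n (fun s => ek (d j) s * (f s * dirichlet (ms j) (ts j) s)) <=
      2 * e * (ms j)%:R.
  move=> dn Hd; have mj : 0 < (ms j)%:R :> R by rewrite ltr0n.
  have Re_ip (y : 'cV[C]_n) : vsq y <= e ^+ 2 -> Re (ip y (x d j)) <= e.
    move=> ye; apply: Re_le_of_nsq (ltW e0) _.
    rewrite /ip (le_trans (CS_sum _ _))//; rewrite -[leRHS]mulr1.
    apply: ler_pM => //; [exact: vsq_ge0|by apply: sumr_ge0 => i _; exact: nsq_ge0|].
    rewrite -[leRHS](x1 _ dn j); apply: ler_sum => i _.
    by rewrite nsqJ.
  have : bq 0 n (fun s => f s * tp 0 (cv (x d j)) s) <= 2 * e.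
    have := defect_form (x d j) (x d j) (bcvJ bf) bf.
    rewrite (_ : (fun t => (((f t)^J)^J * _)) = (fun t => f t * tp 0 (cv (x d j)) t)).
      rewrite bes_diag -/D Dn => /(congr1 (@complex.Re R)) /= <-.
      have colD (y z : 'cV[C]_n) i : (y + z) i 0 = y i 0 + z i 0 by rewrite mxE.
      have sp : \sum_i (x d j i 0)^J * ((Rn + Nn) *m x d j) i 0 =
          ip (Rn *m x d j) (x d j) + ip (Nn *m x d j) (x d j).
        rewrite /ip -big_split; apply: eq_bigr => i _ /=.
        by rewrite mulmxDl colD mulrDr !(mulrC _^J).
      rewrite sp cReD (_ : 2 * e = e + e); last by ring.
      apply: lerD.
        by apply: Re_ip; exact: le_trans Hd Hk.
      by apply: Re_ip; have := Nb (x d j); rewrite x1// mulr1.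
    by apply/funext => t; rewrite conjcK.
  rewrite (_ : (fun s => f s * tp 0 (cv (x d j)) s) = (fun s =>
     ((Num.sqrt (ms j)%:R)^-1)%:C *
       (ek (d j) s * (f s * dirichlet (ms j) (ts j) s)))).
    rewrite bqZ; last first.
      by apply: bcvM; [exact: bcv_ek|apply: bcvM => //; exact: bcv_dirichlet].
    by rewrite nsq_real exprVn sqr_sqrtr ?(ltW mj)// (mulrC _^-1) ler_pdivrMr.
  apply/funext => s; rewrite (mulrCA (ek _ s)) -(tp_dvec _ _ (dn j)) [RHS]mulrCA.
  congr (_ * _).
  rewrite /tp mulr_sumr; apply: eq_bigr => i _.
  by rewrite /cv mxE mulrA.
have := bqx _ d0n H0; have := bqx _ d1n H1; have := ms_bad j.
have bfd : bcv (fun s => f s * dirichlet (ms j) (ts j) s).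
  by apply: bcvM => //; exact: bcv_dirichlet.
have := bq_two_ends bfd (msn j).
rewrite !bq_ek /d0 /d1 subr0 sub0r -subzn// opprB /e.
set b1 := bq _ _ _; set b2 := bq _ _ _; set b3 := bq _ _ _.
have : 0 < (ms j)%:R :> R by rewrite ltr0n.
move: (dl0) => ? ? ? ? ? ?; nra.
Qed.
End ClusterToDecay.

(** * From Dirichlet kernels to the oscillation on arcs *)

Section Trigo.
Context {R : realType}.
Implicit Types x : R.

Lemma sin_mvt x : 0 <= x -> exists2 c, 0 <= c <= x & sin x = cos c * x.
Proof.
move=> x0; have [|c cx] := @MVT_segment R sin cos 0 x x0 (fun y _ => is_derive_sin y).
  by apply: continuous_subspaceT; exact: continuous_sin.
by rewrite sin0 !subr0 => ->; exists c => //; move: cx; rewrite in_itv.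
Qed.

Lemma sqr_sin_le x : sin x ^+ 2 <= x ^+ 2.
Proof.
wlog x0 : x / 0 <= x.
  move=> H; have [|/ltW x0] := leP 0 x; first exact: H.
  by rewrite -[leRHS]sqrrN -[leLHS]sqrrN -sinN H// oppr_ge0.
have [c _ ->] := sin_mvt x0.
by rewrite exprMn ler_piMl ?sqr_ge0//.
Qed.

Lemma cos_half x : cos x = 1 - 2 * sin (x / 2) ^+ 2.
Proof.
rewrite {1}(splitr x) cosD; have := cos2Dsin2 (x / 2); rewrite !expr2; lra.
Qed.

Lemma cos_ge x : 1 - x ^+ 2 / 2 <= cos x.
Proof.
rewrite cos_half; have := sqr_sin_le (x / 2); rewrite exprMn exprVn; lra.
Qed.

Lemma nsq_expi1 x : nsq (expi x - 1) <= x ^+ 2.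
Proof.
rewrite /nsq /= ; have := cos2Dsin2 x; have := cos_ge x; rewrite subr0.
by move=> h1 h2; rewrite sqrrB expr1n; lra.
Qed.

End Trigo.

Section Oscillation.
Context {R : realType}.
Notation C := R[i].
Notation mu := (@lebesgue_measure R).
Implicit Types (f : R -> C) (a l t s : R).

Definition osc2 f a l : R :=
  l^-1 * \int[mu]_(t in arc a l) nsq (f t - arc_mean f a l).

Lemma arc_meanE f a l : arc_mean f a l =
  (l^-1 * \int[mu]_(t in arc a l) Re (f t)) +i*
  (l^-1 * \int[mu]_(t in arc a l) Im (f t)).
Proof. by rewrite /arc_mean /cintegral; apply: complexP => /=; ring. Qed.

Lemma real_variance (q : R -> R) a l (k m : R) : 0 < l -> brv q ->
  m = l^-1 * \int[mu]_(t in arc a l) q t ->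
  \int[mu]_(t in arc a l) ((q t - m) ^+ 2) <=
  \int[mu]_(t in arc a l) ((q t - k) ^+ 2).
Proof.
move=> l0 bq mE.
have bqm : brv (fun t => q t - m) by apply: brvB => //; exact: brv_cst.
have bqm2 : brv (fun t => (q t - m) ^+ 2) by exact: brvM.
have b1 : brv (fun t => 2 * (m - k) * (q t - m)) by exact: brvZ.
rewrite (_ : (fun t => (q t - k) ^+ 2) = (fun t => (q t - m) ^+ 2 +
   (2 * (m - k) * (q t - m) + (m - k) ^+ 2))); last first.
  by apply/funext => t; ring.
rewrite int_arcD//; last by apply: brvD => //; exact: brv_cst.
rewrite int_arcD//; last exact: brv_cst.
rewrite int_arcZ// int_arcD//; last exact: brv_cst.
rewrite !int_arc_cst ?(ltW l0)// (_ : \int[mu]_(t in arc a l) q t = m * l); last first.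
  by rewrite mE mulrAC mulVf ?mul1r// gt_eqF.
have : 0 <= (m - k) ^+ 2 * l by rewrite mulr_ge0 ?sqr_ge0 ?ltW.
lra.
Qed.

Lemma osc2_le f a l (k : C) : 0 < l -> bcv f ->
  osc2 f a l <= l^-1 * \int[mu]_(t in arc a l) nsq (f t - k).
Proof.
move=> l0 [f1 f2]; rewrite /osc2 ler_wpM2l ?invr_ge0 ?(ltW l0)// arc_meanE.
have split (z : C) : \int[mu]_(t in arc a l) nsq (f t - z) =
    \int[mu]_(t in arc a l) ((Re (f t) - Re z) ^+ 2) +
    \int[mu]_(t in arc a l) ((Im (f t) - Im z) ^+ 2).
  have b1 : brv (fun t => Re (f t) - Re z) by apply: brvB => //; exact: brv_cst.
  have b2 : brv (fun t => Im (f t) - Im z) by apply: brvB => //; exact: brv_cst.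
  rewrite -int_arcD//; [|exact: brvM|exact: brvM].
  by apply: eq_Rintegral => t _; rewrite /nsq; case: (f t) => ? ?; case: (z) => ? ?.
by rewrite !split /=; apply: lerD; apply: real_variance.
Qed.

Lemma osc2_ge0 f a l : 0 < l -> 0 <= osc2 f a l.
Proof.
move=> l0; rewrite mulr_ge0 ?invr_ge0 ?(ltW l0)// Rintegral_ge0// => t _.
exact: nsq_ge0.
Qed.

(** The oscillation condition of [VMO] with squared oscillations. *)
Definition vmo f : Prop := forall e : R, 0 < e -> exists2 d : R, 0 < d &
  forall a l : R, 0 < l -> l <= 2 * pi -> l < d -> osc2 f a l < e.

(** Let [X] be the Dirichlet kernel of [m] modes centred at the origin of an arc of
length close to [c / m], and [Y] the projection of [f X] onto its window.  On the
arc [X] is close to [m], and [Y] is close to a constant because its energy is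
at most [M m]; as [f X - Y] has energy [o(m)] over the circle, [f] is close to the
constant [Y(a) / m] in the mean over the arc. *)
Lemma decay_vmo f : bcv f ->
  (forall e : R, 0 < e -> exists m0, forall m t, (m0 <= m)%N ->
    bq 0 m (fun s => f s * dirichlet m t s) <= e * m%:R) ->
  vmo f.
Proof.
move=> bf Hdec e e0.
have [M fM] := bcv_bound bf.
have M0 : 0 <= M by rewrite (le_trans (nsq_ge0 (f 0)) (fM 0)).
(* [c] makes the variation of [X] and [Y] over the arc contribute at most [e / 4];
   the energy of [f X - Y], divided by [m^2] and by the length [c / m], costs
   a factor [1 / c], which [dl] absorbs *)
pose c := Num.min 2^-1 (e / (128 * (M + 1))).
have c0 : 0 < c by rewrite lt_min invr_gt0 ltr0n /= divr_gt0 ?mulr_gt0 ?ltr0n// ltr_wpDl.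
have c1 : c <= 2^-1 by rewrite ge_min lexx.
have cM : 32 * M * c ^+ 2 <= e / 4.
  have cM1 : c * (128 * (M + 1)) <= e.
    by rewrite -ler_pdivlMr ?mulr_gt0 ?ltr_wpDl// ge_min lexx orbT.
  have : M * c ^+ 2 <= M * c by rewrite ler_wpM2l// expr2; nra.
  by move: cM1 c0; nra.
pose dl := c * e / 512.
have dl0 : 0 < dl by rewrite divr_gt0 ?mulr_gt0 ?ltr0n.
have [m0 Hm0] := Hdec dl dl0.
exists (c / m0.+1%:R); first by rewrite divr_gt0// ltr0n.
move=> a l l0 l2 ld.
pose m := Num.truncn (c / l).
have cl0 : 0 <= c / l by rewrite divr_ge0// ltW.
have ml : m%:R * l <= c by rewrite -ler_pdivlMr// truncn_le.
have mm0 : (m0.+1 <= m)%N.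
  by rewrite truncn_ge_nat// ler_pdivlMr// mulrC -ler_pdivlMr ?ltr0n// ltW.
have m_gt0 : 0 < m%:R :> R by rewrite ltr0n (leq_trans _ mm0).
have mlc : c / 2 <= m%:R * l.
  have : c / l < m.+1%:R by exact: truncnS_gt.
  rewrite ltr_pdivrMr// -natr1.
  have : 1 <= m%:R :> R by rewrite ler1n (leq_trans _ mm0).
  by move: l0; nra.
set X := dirichlet m a.
have bX : bcv X by exact: bcv_dirichlet.
have bfX : bcv (fun s => f s * X s) by exact: bcvM.
pose Y := proj 0 m (fun s => f s * X s).
pose u s := f s * X s - Y s.
have bu : bcv u by exact: bcv_resid.
have Eu : Er (fun t => nsq (u t)) <= dl * m%:R.
  by rewrite -bq_resid// Hm0// (leq_trans _ mm0).
have sum1 : \sum_(j < m) (1 : R) = m%:R by rewrite sumr_const card_ord.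
(* on the arc all modes of index below [m] stay close to their value at [a] *)
have ekc s (k : 'I_m) : arc a l s -> nsq (ek k s - ek k a) <= c ^+ 2.
  rewrite /arc /= in_itv /= => /andP[as_ sal].
  have -> : ek k s - ek k a = ek k a * (expi (k%:R * (s - a)) - 1) :> C.
    by rewrite mulrBr mulr1 /ek -expiD -mulrDr (addrC a) subrK.
  rewrite nsqM nsq_ek mul1r (le_trans (nsq_expi1 _))//.
  rewrite ler_sqr ?nnegrE ?(ltW c0)//; last by rewrite mulr_ge0// subr_ge0.
  apply: le_trans ml; apply: ler_pM => //; first by rewrite subr_ge0.
    by rewrite ler_nat ltnW.
  by rewrite lerBlDl.
have Xm s : arc a l s -> nsq (m%:R - X s) <= c ^+ 2 * m%:R ^+ 2.
  move=> sI; rewrite (_ : _ - _ = \sum_(k < m) (- ek (- k%:Z) a) * (ek k s - ek k a)).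
    rewrite (le_trans (CS_sum _ _))//.
    under eq_bigr do rewrite nsqN nsq_ek.
    rewrite sum1 mulrC expr2 mulrA ler_wpM2r//.
    rewrite -[X in _ * X]sum1 mulr_sumr; apply: ler_sum => k _.
    by rewrite mulr1 ekc.
  rewrite (_ : m%:R = \sum_(k < m) (1 : C)); last by rewrite sumr_const card_ord.
  rewrite /X /dirichlet /tp -sumrB; apply: eq_bigr => k _.
  by rewrite add0r mulNr mulrBr -ekD addNr ek0 opprB.
have Y2 : \sum_(j < m) nsq (coef (fun s => f s * X s) (0 + j%:Z)) <= M * m%:R.
  apply: (le_trans (energy_le 0 m bfX)).
  rewrite (_ : m%:R = Er (fun t => nsq (X t))).
    rewrite -ErZ; last exact: brv_nsq.
    apply: Er_le => [||t]; first exact: brv_nsq.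
      by apply: brvZ; exact: brv_nsq.
    by rewrite nsqM ler_wpM2r ?nsq_ge0.
  by rewrite /X /dirichlet Er_nsq_tp -sum1; apply: eq_bigr => j _; rewrite nsq_ek.
have Ys s : arc a l s -> nsq (Y s - Y a) <= M * c ^+ 2 * m%:R ^+ 2.
  move=> sI; rewrite /Y /proj /tp -sumrB.
  under eq_bigr do rewrite -mulrBr.
  rewrite (le_trans (CS_sum _ _))//.
  rewrite (_ : M * _ * _ = (M * m%:R) * (c ^+ 2 * m%:R)); last by ring.
  apply: ler_pM => //; try by apply: sumr_ge0 => i _; exact: nsq_ge0.
  rewrite -[X in _ * X]sum1 mulr_sumr; apply: ler_sum => k _.
  by rewrite mulr1 add0r ekc.
(* the constant that [f] is compared with *)
pose k := Y a / m%:R.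
have mC (z : C) : m%:R * (z / m%:R) = z.
  by rewrite mulrC divfK// pnatr_eq0 -lt0n (leq_trans _ mm0).
have k2 : nsq k <= M.
  have Ya : nsq (Y a) <= M * m%:R ^+ 2.
    rewrite /Y /proj /tp (le_trans (CS_sum _ _))// expr2 mulrA.
    apply: ler_pM => //; try by apply: sumr_ge0 => i _; exact: nsq_ge0.
    by rewrite -sum1; apply: ler_sum => j _; rewrite nsq_ek.
  have := congr1 nsq (mC (Y a)); rewrite nsqM -/k -(rmorph_nat (real_complex R)).
  rewrite nsq_real => e1; rewrite -e1 mulrC ler_pM2r// in Ya.
  by rewrite exprn_gt0.
have ptw s : arc a l s ->
    nsq (f s - k) <= 8 / m%:R ^+ 2 * nsq (u s) + 32 * M * c ^+ 2.
  move=> sI; have m2 : 0 < m%:R ^+ 2 :> R by rewrite exprn_gt0.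
  have X4 : m%:R ^+ 2 / 4 <= nsq (X s).
    have := Xm s sI; rewrite -(rmorph_nat (real_complex R)) => hX.
    have : nsq m%:R%:C <= 2 * nsq (m%:R%:C - X s) + 2 * nsq (X s).
      by rewrite -[X in nsq X <= _](subrK (X s)); exact: nsqD_le.
    rewrite nsq_real; move: hX; set N := nsq (_ - _).
    have : c ^+ 2 * m%:R ^+ 2 <= 4^-1 * m%:R ^+ 2.
      by rewrite ler_wpM2r ?(ltW m2)// expr2; move: (c) c0 c1 => z z0 z1; nra.
    by lra.
  have e1 : (f s - k) * X s = u s + ((Y s - Y a) + k * (m%:R - X s)).
    by have := mC (Y a); rewrite /u mulrBr (mulrC k) => {1}<-; rewrite /k; ring.
  have := congr1 nsq e1; rewrite nsqM => e2.
  have h1 := nsqD_le (u s) ((Y s - Y a) + k * (m%:R - X s)).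
  have h2 := nsqD_le (Y s - Y a) (k * (m%:R - X s)).
  have h3 := Ys s sI; have h4 : nsq (k * (m%:R - X s)) <= M * c ^+ 2 * m%:R ^+ 2.
    by rewrite nsqM -mulrA; apply: ler_pM; rewrite ?nsq_ge0// Xm.
  have h5 : nsq (f s - k) * (m%:R ^+ 2 / 4) <= nsq (f s - k) * nsq (X s).
    by rewrite ler_wpM2l ?nsq_ge0.
  rewrite -(ler_pM2r (_ : 0 < m%:R ^+ 2 / 4)); last by rewrite divr_gt0.
  rewrite (_ : (8 / _ * _ + _) * _ = 2 * nsq (u s) + 8 * (M * c ^+ 2 * m%:R ^+ 2)).
    by move: e2 h1 h2 h3 h4 h5; lra.
  by field; rewrite gt_eqF.
have bu2 := brv_nsq bu.
have : osc2 f a l <= l^-1 * (8 / m%:R ^+ 2 * (2 * pi * (dl * m%:R)) + 32 * M * c ^+ 2 * l).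
  apply: (le_trans (osc2_le a k l0 bf)); rewrite ler_wpM2l ?invr_ge0 ?(ltW l0)//.
  apply: (@le_trans _ _ (\int[mu]_(t in arc a l)
     (8 / m%:R ^+ 2 * nsq (u t) + 32 * M * c ^+ 2))).
    apply: int_arc_le => //; first by apply: brv_nsq; apply: bcvB => //; exact: bcv_cst.
    by apply: brvD; [exact: brvZ|exact: brv_cst].
  have b8 : brv (fun t => 8 / m%:R ^+ 2 * nsq (u t)) by exact: brvZ.
  rewrite int_arcD//; last exact: brv_cst.
  rewrite (int_arcZ (8 / m%:R ^+ 2) a l bu2) int_arc_cst ?(ltW l0)//.
  rewrite lerD2r ler_wpM2l ?divr_ge0 ?exprn_ge0//.
  have u0 t : 0 <= nsq (u t) by exact: nsq_ge0.
  apply: (le_trans (int_arc_le_Er a bu2 u0 (ltW l0) l2)).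
  by rewrite ler_wpM2l// mulr_ge0// pi_ge0.
rewrite (_ : l^-1 * _ = 16 * pi * dl / (m%:R * l) + 32 * M * c ^+ 2); last first.
  by field; rewrite !gt_eqF.
move=> /le_lt_trans; apply.
have pi4 : pi <= 4 :> R by have := @pihalf_lt2 R; lra.
have : 16 * pi * dl / (m%:R * l) <= e / 4.
  rewrite ler_pdivrMr ?mulr_gt0//.
  apply: (@le_trans _ _ (e / 4 * (c / 2))).
    rewrite /dl; have := mulr_gt0 c0 e0; nra.
  by rewrite ler_wpM2l// divr_ge0// ltW.
lra.
Qed.
End Oscillation.

(** * The algebra of functions of vanishing mean oscillation *)

Section VmoAlgebra.
Context {R : realType}.
Notation C := R[i].
Notation mu := (@lebesgue_measure R).
Implicit Types (f g : R -> C) (a l t s : R).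

Definition av a l (q : R -> R) : R := l^-1 * \int[mu]_(t in arc a l) q t.

Lemma osc2E f a l :
  osc2 f a l = av a l (fun t => nsq (f t - arc_mean f a l)).
Proof. by []. Qed.

Lemma avD a l p q : brv p -> brv q ->
  av a l (fun t => p t + q t) = av a l p + av a l q.
Proof. by move=> bp bq; rewrite /av int_arcD// mulrDr. Qed.

Lemma avZ a l c q : brv q -> av a l (fun t => c * q t) = c * av a l q.
Proof. by move=> bq; rewrite /av int_arcZ// mulrCA. Qed.

Lemma av_cst a l c : 0 < l -> av a l (fun=> c) = c.
Proof.
by move=> l0; rewrite /av int_arc_cst ?(ltW l0)// mulrCA mulVf ?mulr1// gt_eqF.
Qed.

Lemma av_le a l p q : 0 < l -> brv p -> brv q -> (forall t, p t <= q t) ->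
  av a l p <= av a l q.
Proof.
move=> l0 bp bq pq; rewrite /av ler_wpM2l ?invr_ge0 ?(ltW l0)//.
by apply: int_arc_le => // t _; exact: pq.
Qed.

Lemma brv_nsqB f (z : C) : bcv f -> brv (fun t => nsq (f t - z)).
Proof. by move=> bf; apply: brv_nsq; apply: bcvB => //; exact: bcv_cst. Qed.

Lemma osc2_bound f a l (M : R) : 0 < l -> bcv f -> (forall t, nsq (f t) <= M) ->
  osc2 f a l <= M.
Proof.
move=> l0 bf fM; apply: (le_trans (osc2_le a 0 l0 bf)).
rewrite -[leRHS](av_cst a M l0); apply: av_le => //; first exact: brv_nsqB.
  exact: brv_cst.
by move=> t; rewrite subr0.
Qed.

Lemma arc_mean_bound f a l (M : R) : 0 < l -> bcv f -> (forall t, nsq (f t) <= M) ->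
  nsq (arc_mean f a l) <= 4 * M.
Proof.
move=> l0 bf fM; rewrite -[leLHS](av_cst a _ l0).
apply: (@le_trans _ _ (av a l (fun t => 2 * M + 2 * nsq (f t - arc_mean f a l)))).
  apply: av_le => // [||t]; first exact: brv_cst.
    by apply: brvD; [exact: brv_cst|apply: brvZ; exact: brv_nsqB].
  have := nsqD_le (f t) (- (f t - arc_mean f a l)).
  by rewrite nsqN opprB addrC subrK; have := fM t; lra.
rewrite avD; [|exact: brv_cst|by apply: brvZ; exact: brv_nsqB].
rewrite av_cst// avZ; last exact: brv_nsqB.
by have := osc2_bound a l0 bf fM; rewrite osc2E; lra.
Qed.

Lemma osc2D f g a l : 0 < l -> bcv f -> bcv g ->
  osc2 (fun t => f t + g t) a l <= 2 * osc2 f a l + 2 * osc2 g a l.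
Proof.
move=> l0 bf bg; set mf := arc_mean f a l; set mg := arc_mean g a l.
apply: (le_trans (osc2_le a (mf + mg) l0 (bcvD bf bg))).
have b1 := brv_nsqB mf bf; have b2 := brv_nsqB mg bg.
have e1 : av a l (fun t => 2 * nsq (f t - mf)) = 2 * osc2 f a l := avZ a l _ b1.
have e2 : av a l (fun t => 2 * nsq (g t - mg)) = 2 * osc2 g a l := avZ a l _ b2.
rewrite -e1 -e2.
rewrite -avD; [|exact: brvZ|exact: brvZ].
apply: av_le => // [||t].
- by apply: brv_nsqB; exact: bcvD.
- by apply: brvD; exact: brvZ.
- by rewrite opprD addrACA; exact: nsqD_le.
Qed.

Lemma osc2M f g a l (M : R) : 0 < l -> bcv f -> bcv g ->
  (forall t, nsq (f t) <= M) -> (forall t, nsq (g t) <= M) ->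
  osc2 (fun t => f t * g t) a l <= 2 * M * osc2 f a l + 8 * M * osc2 g a l.
Proof.
move=> l0 bf bg fM gM; set mf := arc_mean f a l; set mg := arc_mean g a l.
apply: (le_trans (osc2_le a (mf * mg) l0 (bcvM bf bg))).
have b1 := brv_nsqB mf bf; have b2 := brv_nsqB mg bg.
have e1 : av a l (fun t => 2 * M * nsq (f t - mf)) = (2 * M) * osc2 f a l := avZ a l _ b1.
have e2 : av a l (fun t => 8 * M * nsq (g t - mg)) = (8 * M) * osc2 g a l := avZ a l _ b2.
rewrite -e1 -e2.
rewrite -avD; [|exact: brvZ|exact: brvZ].
apply: av_le => // [||t].
- by apply: brv_nsqB; exact: bcvM.
- by apply: brvD; exact: brvZ.
have -> : f t * g t - mf * mg = (f t - mf) * g t + mf * (g t - mg) by ring.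
apply: (le_trans (nsqD_le _ _)); rewrite (nsqM (f t - mf)) (nsqM mf); apply: lerD.
  rewrite -mulrA ler_wpM2l// mulrC ler_wpM2r ?nsq_ge0//.
rewrite mulrA ler_wpM2r ?nsq_ge0//.
by have := arc_mean_bound a l0 bf fM; rewrite -/mf; lra.
Qed.

Lemma vmoD f g : bcv f -> bcv g -> vmo f -> vmo g -> vmo (fun t => f t + g t).
Proof.
move=> bf bg vf vg e e0; have e4 : 0 < e / 4 by rewrite divr_gt0.
have [d d0 Hd] := vf _ e4; have [d' d'0 Hd'] := vg _ e4.
exists (Num.min d d') => [|a l l0 l2]; first by rewrite lt_min d0.
rewrite lt_min => /andP[ld ld'].
have := osc2D a l0 bf bg; have := Hd a l l0 l2 ld; have := Hd' a l l0 l2 ld'.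
by move: (osc2 f a l) (osc2 g a l) (osc2 _ a l) => x y z; lra.
Qed.

Lemma vmoM f g : bcv f -> bcv g -> vmo f -> vmo g -> vmo (fun t => f t * g t).
Proof.
move=> bf bg vf vg e e0.
have [M1 fM1] := bcv_bound bf; have [M2 gM2] := bcv_bound bg.
pose M := Num.max 1 (Num.max M1 M2).
have M0 : 0 < M by rewrite lt_max ltr01.
have fM t : nsq (f t) <= M by rewrite (le_trans (fM1 t))// !le_max lexx !orbT.
have gM t : nsq (g t) <= M by rewrite (le_trans (gM2 t))// !le_max lexx !orbT.
have e4 : 0 < e / (16 * M) by rewrite divr_gt0 ?mulr_gt0.
have [d d0 Hd] := vf _ e4; have [d' d'0 Hd'] := vg _ e4.
exists (Num.min d d') => [|a l l0 l2]; first by rewrite lt_min d0.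
rewrite lt_min => /andP[ld ld'].
have M16 : 0 < 16 * M by rewrite mulr_gt0.
have h1 : osc2 f a l * (16 * M) < e by rewrite -ltr_pdivlMr//; exact: Hd.
have h2 : osc2 g a l * (16 * M) < e by rewrite -ltr_pdivlMr//; exact: Hd'.
apply: (le_lt_trans (osc2M a l0 bf bg fM gM)).
by move: (osc2 f a l) (osc2 g a l) h1 h2 => x y; lra.
Qed.

Lemma vmo_cst (z : C) : vmo (fun=> z).
Proof.
move=> e e0; exists 1 => // a l l0 _ _.
apply: (le_lt_trans (osc2_le a z l0 (bcv_cst z))).
rewrite -/(av a l _) (_ : (fun t : R => nsq (z - z)) = fun=> 0) ?av_cst//.
by apply/funext => t; rewrite subrr nsq0.
Qed.

Lemma osc2J f a l : 0 < l -> bcv f -> osc2 (fun t => (f t)^J) a l <= osc2 f a l.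
Proof.
move=> l0 bf; apply: (le_trans (osc2_le a (arc_mean f a l)^J l0 (bcvJ bf))).
rewrite le_eqVlt; apply/orP; left; apply/eqP; congr (_ * _).
by apply: eq_Rintegral => t _; rewrite -conjcN -conjcD nsqJ.
Qed.

Lemma vmoJ f : bcv f -> vmo f -> vmo (fun t => (f t)^J).
Proof.
move=> bf vf e e0; have [d d0 Hd] := vf e e0; exists d; first exact: d0.
move=> a l l0 l2 ld.
exact: le_lt_trans (osc2J a l0 bf) (Hd a l l0 l2 ld).
Qed.

(** Approximation in the mean over all arcs is enough for closedness; uniform
approximation provides it. *)
Lemma vmo_closed f : bcv f -> (forall e : R, 0 < e ->
  exists2 g, bcv g /\ vmo g & forall a l, 0 < l -> av a l (fun t => nsq (f t - g t)) <= e) ->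
  vmo f.
Proof.
move=> bf H e e0; have e8 : 0 < e / 8 by rewrite divr_gt0.
have [g [bg vg] fg] := H _ e8; have [d d0 Hd] := vg _ e8.
exists d => // a l l0 l2 ld; have bfg := bcvB bf bg.
have := osc2D a l0 bfg bg; under eq_fun do rewrite subrK.
have : osc2 (fun t => f t - g t) a l <= e / 8.
  apply: (le_trans (osc2_le a 0 l0 bfg)).
  by under eq_Rintegral do rewrite subr0; exact: fg.
have := Hd a l l0 l2 ld.
by move: (osc2 (fun t => f t - g t) a l) (osc2 g a l) (osc2 _ a l) => x y z; lra.
Qed.

End VmoAlgebra.

(** * Bounded representatives of essentially bounded functions *)

Section Representatives.
Context {R : realType}.
Notation C := R[i].
Notation mu := (@lebesgue_measure R).
Local Notation aeS := (@filterS _ _ (ae_filter_ringOfSetsType mu)).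
Local Notation aeS2 := (@filterS2 _ _ (ae_filter_ringOfSetsType mu)).
Implicit Types (f g : R -> C) (a l t s : R).

(** [f0] is an everywhere bounded function in the class of [f]. *)
Definition rep f f0 : Prop :=
  [/\ periodic2pi f, cmeasurable f, bcv f0 &
      {ae mu, forall t, f t = f0 t}].

Lemma cmeas_bcv f : bcv f -> cmeasurable f.
Proof. by case=> [[_ ? _] [_ ? _]]; split. Qed.

Lemma cmeasM f g : cmeasurable f -> cmeasurable g -> cmeasurable (fun t => f t * g t).
Proof.
move=> [f1 f2] [g1 g2]; split.
  by under eq_fun do rewrite cReM; apply: measurable_funB; exact: measurable_funM.
by under eq_fun do rewrite cImM; apply: measurable_funD; exact: measurable_funM.
Qed.

Lemma cmeasD f g : cmeasurable f -> cmeasurable g -> cmeasurable (fun t => f t + g t).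
Proof.
move=> [f1 f2] [g1 g2]; split.
  by under eq_fun do rewrite cReD; exact: measurable_funD.
by under eq_fun do rewrite cImD; exact: measurable_funD.
Qed.

Lemma cmeasJ f : cmeasurable f -> cmeasurable (fun t => (f t)^J).
Proof.
move=> [f1 f2]; split; first by under eq_fun do rewrite cReJ.
by under eq_fun do rewrite cImJ; exact: measurable_funN.
Qed.

Lemma measurable_nsq f : cmeasurable f -> measurable_fun [set: R] (fun t => nsq (f t)).
Proof. by move=> [f1 f2]; apply: measurable_funD; exact: measurable_funX. Qed.

Lemma rep_bcv f : bcv f -> rep f f.
Proof.
move=> bf; split=> //; last by apply: aeW.
- by move=> t; case: bf => -[p1 _ _] [p2 _ _]; apply: complexP.
- exact: cmeas_bcv.
Qed.

Lemma repD f f0 g g0 : rep f f0 -> rep g g0 ->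
  rep (fun t => f t + g t) (fun t => f0 t + g0 t).
Proof.
move=> [p1 m1 b1 a1] [p2 m2 b2 a2]; split.
- by move=> t; rewrite p1 p2.
- exact: cmeasD.
- exact: bcvD.
- by move: a1 a2; apply: aeS2 => t -> ->.
Qed.

Lemma repM f f0 g g0 : rep f f0 -> rep g g0 ->
  rep (fun t => f t * g t) (fun t => f0 t * g0 t).
Proof.
move=> [p1 m1 b1 a1] [p2 m2 b2 a2]; split.
- by move=> t; rewrite p1 p2.
- exact: cmeasM.
- exact: bcvM.
- by move: a1 a2; apply: aeS2 => t -> ->.
Qed.

Lemma repJ f f0 : rep f f0 -> rep (fun t => (f t)^J) (fun t => (f0 t)^J).
Proof.
move=> [p1 m1 b1 a1]; split.
- by move=> t; rewrite p1.
- exact: cmeasJ.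
- exact: bcvJ.
- by move: a1; apply: aeS => t ->.
Qed.

Lemma rep_Linfty f f0 : rep f f0 -> Linfty f.
Proof.
move=> [p m b a]; split=> //; have [M HM] := bcv_bound b.
apply: (@le_lt_trans _ _ (Num.sqrt M)%:E); last by rewrite ltry.
apply/ess_supP; move: a; apply: aeS => t ->; rewrite lee_fin.
have -> : Normc.normc (f0 t) = Num.sqrt (nsq (f0 t)).
  rewrite -normc_sqr sqrtr_sqr ger0_norm//.
  by case: (f0 t) => ? ? /=; exact: sqrtr_ge0.
exact: ler_wsqrtr.
Qed.

Lemma Linfty_rep f : Linfty f -> exists f0, rep f f0.
Proof.
move=> [p m nf].
have [M HM] : exists M : R, (Linfty_norm f <= M%:E)%E.
  move: nf; case: (Linfty_norm f) => [r||]//=.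
  - by move=> _; exists r.
  - by move=> _; exists 0; rewrite leNye.
pose f0 t := if nsq (f t) <= M ^+ 2 then f t else 0.
have f0M t : nsq (f0 t) <= M ^+ 2.
  by rewrite /f0; case: ifP => // _; rewrite nsq0 sqr_ge0.
have sq (x y : R) : x ^+ 2 <= y ^+ 2 -> `|x| <= `|y|.
  by move=> xy; rewrite -!sqrtr_sqr ler_wsqrtr.
have mc : measurable_fun [set: R] (fun t => nsq (f t) <= M ^+ 2).
  by apply: measurable_fun_ler => //; exact: measurable_nsq.
exists f0; split=> //.
  split; split=> [t||].
  - by rewrite /f0 p.
  - rewrite (_ : (fun t => Re (f0 t)) =
        (fun t => if nsq (f t) <= M ^+ 2 then Re (f t) else 0)).
      by apply: measurable_fun_ifT => //; case: m.
    by apply/funext => t; rewrite /f0; case: ifP.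
  - exists `|M| => t; apply: sq; apply: le_trans (f0M t).
    by rewrite lerDl sqr_ge0.
  - by rewrite /f0 p.
  - rewrite (_ : (fun t => Im (f0 t)) =
        (fun t => if nsq (f t) <= M ^+ 2 then Im (f t) else 0)).
      by apply: measurable_fun_ifT => //; case: m.
    by apply/funext => t; rewrite /f0; case: ifP.
  - exists `|M| => t; apply: sq; apply: le_trans (f0M t).
    by rewrite lerDr sqr_ge0.
move/ess_supP : HM; apply: aeS => t; rewrite lee_fin => fM.
rewrite /f0 ifT// -normc_sqr ler_sqr// nnegrE//.
  by case: (f t) => ? ? /=; exact: sqrtr_ge0.
by rewrite (le_trans _ fM)//; case: (f t) => ? ? /=; exact: sqrtr_ge0.
Qed.

Lemma Rint_ae (p q : R -> R) a b : measurable_fun [set: R] p ->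
  measurable_fun [set: R] q -> {ae mu, forall t, p t = q t} ->
  \int[mu]_(t in `[a, b]) p t = \int[mu]_(t in `[a, b]) q t.
Proof.
move=> mp mq pq; rewrite /Rintegral; congr fine; apply: ae_eq_integral => //.
- by apply: measurable_funTS; exact/measurable_EFinP.
- by apply: measurable_funTS; exact/measurable_EFinP.
- by move: pq; apply: aeS => t ->.
Qed.

Lemma cint_ae f g a b : cmeasurable f -> cmeasurable g ->
  {ae mu, forall t, f t = g t} -> cintegral `[a, b] f = cintegral `[a, b] g.
Proof.
move=> [f1 f2] [g1 g2] fg; rewrite /cintegral; congr Complex; apply: Rint_ae => //.
  by move: fg; apply: aeS => t ->.
by move: fg; apply: aeS => t ->.
Qed.

Lemma fourier_rep f f0 k : rep f f0 -> fourier f k = fourier f0 k.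
Proof.
move=> [_ mf bf ff]; rewrite /fourier; congr (_ * _); apply: cint_ae.
- apply: cmeasM => //; apply: cmeas_bcv; apply: bcv_ext (bcv_ek (- k)) => t.
  by rewrite /ek mulrNz mulNr.
- apply: cmeasM; first exact: cmeas_bcv.
  apply: cmeas_bcv; apply: bcv_ext (bcv_ek (- k)) => t.
  by rewrite /ek mulrNz mulNr.
- by move: ff; apply: aeS => t ->.
Qed.

Lemma toeplitz_rep f f0 n : rep f f0 -> toeplitz f n = toeplitz f0 n.
Proof.
by move=> rf; apply/matrixP => i j; rewrite !mxE; exact: fourier_rep.
Qed.

Lemma defect_rep f f0 g g0 n : rep f f0 -> rep g g0 ->
  toeplitz_defect f g n = toeplitz_defect f0 g0 n.
Proof.
move=> rf rg; rewrite /toeplitz_defect (toeplitz_rep n rf) (toeplitz_rep n rg).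
by rewrite (toeplitz_rep n (repM rf rg)).
Qed.

Lemma arc_oscillation_rep f f0 a l : rep f f0 ->
  arc_oscillation f a l = Num.sqrt (osc2 f0 a l).
Proof.
move=> [_ mf bf ff]; rewrite /arc_oscillation /osc2.
have -> : arc_mean f a l = arc_mean f0 a l.
  by rewrite /arc_mean; congr (_ * _); apply: cint_ae => //; exact: cmeas_bcv.
congr (Num.sqrt (_ * _)).
rewrite (_ : (fun t => Normc.normc (f t - arc_mean f0 a l) ^+ 2) =
  (fun t => nsq (f t - arc_mean f0 a l))); last first.
  by apply/funext => t; rewrite normc_sqr.
have mc (z : C) : cmeasurable (fun=> z) by exact: cmeas_bcv (bcv_cst z).
apply: Rint_ae.
- by apply: measurable_nsq; exact: cmeasD.
- by apply: measurable_nsq; apply: cmeasD => //; exact: cmeas_bcv.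
- by move: ff; apply: aeS => t ->.
Qed.

Lemma L2circle_rep f f0 : rep f f0 -> L2circle f.
Proof.
move=> [pf mf bf ff]; split=> //.
have [M HM] := bcv_bound bf.
have mn := measurable_nsq mf.
rewrite (_ : (fun t => (Normc.normc (f t) ^+ 2)%:E) = (fun t => (nsq (f t))%:E)).
  have -> : (\int[mu]_(t in `[0%R, (2 * pi)%R]) (nsq (f t))%:E =
      \int[mu]_(t in `[0%R, (2 * pi)%R]) (nsq (f0 t))%:E)%E.
    apply: ae_eq_integral => //.
    - by apply: measurable_funTS; exact/measurable_EFinP.
    - by apply: measurable_funTS; apply/measurable_EFinP; case: (brv_nsq bf).
    - by move: ff; apply: aeS => t ->.
  have := brv_integrable 0 (2 * pi) (brv_nsq bf) => /integrableP[_].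
  apply: le_lt_trans; apply: ge0_le_integral => //.
  - by move=> t _; rewrite lee_fin nsq_ge0.
  - by apply: measurable_funTS; apply/measurable_EFinP; case: (brv_nsq bf).
  - apply: measurable_funTS; apply: measurableT_comp => //.
    by apply/measurable_EFinP; case: (brv_nsq bf).
  - by move=> t _; rewrite lee_fin /= ler_norm.
by apply/funext => t; rewrite normc_sqr.
Qed.

Lemma VMO_rep f f0 : rep f f0 -> VMO f <-> vmo f0.
Proof.
move=> rf; split=> [[_ H] e e0|H].
  have se0 : 0 < Num.sqrt e by rewrite sqrtr_gt0.
  have [d d0 Hd] := H _ se0; exists d; first exact: d0.
  move=> a l l0 l2 ld; have := Hd a l l0 l2 ld.
  by rewrite (arc_oscillation_rep _ _ rf) ltr_sqrt.
split=> [|e e0]; first exact: L2circle_rep rf.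
have se0 : 0 < e ^+ 2 by rewrite exprn_gt0.
have [d d0 Hd] := H _ se0; exists d; first exact: d0.
move=> a l l0 l2 ld; have := Hd a l l0 l2 ld.
rewrite (arc_oscillation_rep _ _ rf) -(@ltr_sqrt _ _ (e ^+ 2)) ?sqrtr_sqr//.
by rewrite gtr0_norm.
Qed.

Lemma VMO_Linfty_rep f : (VMO `&` Linfty) f <-> exists2 f0, rep f f0 & vmo f0.
Proof.
split=> [[vf /Linfty_rep[f0 rf]]|[f0 rf vf]].
  by exists f0 => //; exact/(VMO_rep rf).
by split; [exact/(VMO_rep rf)|exact: rep_Linfty rf].
Qed.

Lemma VMO_Linfty_Cstar : Cstar_subalgebra (@VMO R `&` @Linfty R).
Proof.
split.
- by move=> f [].
- by apply/VMO_Linfty_rep; exists (fun=> 0); [exact: rep_bcv (bcv_cst 0)|exact: vmo_cst].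
- move=> f g /VMO_Linfty_rep[f0 rf vf] /VMO_Linfty_rep[g0 rg vg].
  apply/VMO_Linfty_rep; exists (fun t => f0 t + g0 t); first exact: repD.
  by case: rf rg => [_ _ ? _] [_ _ ? _]; exact: vmoD.
- move=> c f /VMO_Linfty_rep[f0 rf vf].
  apply/VMO_Linfty_rep; exists (fun t => c * f0 t).
    exact: repM (rep_bcv (bcv_cst c)) rf.
  by case: rf => [_ _ b0 _]; exact: (vmoM (bcv_cst c) b0 (vmo_cst c) vf).
- move=> f g /VMO_Linfty_rep[f0 rf vf] /VMO_Linfty_rep[g0 rg vg].
  apply/VMO_Linfty_rep; exists (fun t => f0 t * g0 t); first exact: repM.
  by case: rf rg => [_ _ ? _] [_ _ ? _]; exact: vmoM.
- move=> f /VMO_Linfty_rep[f0 rf vf].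
  apply/VMO_Linfty_rep; exists (fun t => (f0 t)^J); first exact: repJ.
  by case: rf => [_ _ ? _]; exact: vmoJ.
move=> f /[dup] Lf /Linfty_rep[f0 rf] H.
apply/VMO_Linfty_rep; exists f0 => //; have [pf mf bf ff] := rf.
apply: vmo_closed => // e e0.
have se0 : 0 < Num.sqrt e by rewrite sqrtr_gt0.
have [g /VMO_Linfty_rep[g0 rg vg] fg] := H _ se0; have [pg mg bg gg] := rg.
exists g0 => // a l l0; rewrite -(av_cst a e l0) /av ler_wpM2l ?invr_ge0 ?(ltW l0)//.
(* the bound [e] holds only almost everywhere, hence the truncation *)
pose q t := Num.min (nsq (f0 t - g0 t)) e.
have bd : bcv (fun t => f0 t - g0 t) by exact: bcvB.
have bq : brv q.
  have [p1 m1 [M HM]] := brv_nsq bd; split.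
  - by move=> t; rewrite /q p1.
  - by apply: measurable_minr => //.
  - exists M => t; rewrite (le_trans _ (HM t))// ger0_norm ?le_min ?nsq_ge0 ?(ltW e0)//.
    by rewrite ger0_norm ?nsq_ge0// ge_min lexx.
rewrite (@Rint_ae _ q).
- apply: int_arc_le => //; first exact: brv_cst.
  by move=> t _; rewrite /q ge_min lexx orbT.
- by case: (brv_nsq bd).
- by case: bq.
have /ess_supP H1 := ltW fg.
move: (@filterI _ _ (ae_filter_ringOfSetsType mu) _ _ H1
  (@filterI _ _ (ae_filter_ringOfSetsType mu) _ _ ff gg)).
apply: aeS => t [+ [ft gt]].
rewrite /q lee_fin ft gt => ne; apply/esym/min_idPl.
rewrite -normc_sqr -(sqr_sqrtr (ltW e0)) ler_sqr// nnegrE//.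
by case: (f0 t - g0 t) => ? ? /=; exact: sqrtr_ge0.
Qed.

Lemma cluster_maximal (M : set (R -> C)) :
  Cstar_subalgebra M -> toeplitz_cluster_property M -> M `<=` VMO `&` Linfty.
Proof.
move=> HM Hcl f Mf; have [f0 rf] := Linfty_rep (Cstar_sub HM Mf).
apply/VMO_Linfty_rep; exists f0 => //; have [_ _ bf _] := rf.
apply: decay_vmo => //; apply: cluster_decay => // e e0.
have [N1 [N2 [N10 N20 H]]] := Hcl _ _ (Cstar_conj HM Mf) Mf e e0.
exists N1, N2; split; [exact: N10|exact: N20|move=> n nN].
by rewrite -(defect_rep n (repJ rf) rf); exact: H.
Qed.

End Representatives.

(** * A positive functional on polynomials *)

Section PolyFunctional.
Context {R : realType}.
Notation C := R[i].

(** Averaging over [[0, s]] divides the coefficient of degree [i] by [i + 1]. *)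
Lemma poly_avg_ge0 N (a : 'I_N -> R) :
  (forall s, 0 <= s < 1 -> 0 <= \sum_(i < N) a i * s ^+ i) ->
  forall s, 0 <= s <= 1 -> 0 <= \sum_(i < N) a i / i.+1%:R * s ^+ i.
Proof.
move=> H s /andP[s0 s1]; have [s00|sn0] := eqVneq s 0.
  have := H 0; rewrite lexx ltr01 => /(_ isT); rewrite s00.
  congr (_ <= _); apply: eq_bigr => i _; case: i => [[|i] ip] /=.
    by rewrite divr1.
  by rewrite !expr0n /= !mulr0.
have sp : 0 < s by rewrite lt_neqAle eq_sym sn0.
pose p : {poly R} := \sum_(i < N) (a i / i.+1%:R) *: 'X^(i.+1).
have pE x : p.[x] = x * \sum_(i < N) a i / i.+1%:R * x ^+ i.
  rewrite horner_sum mulr_sumr; apply: eq_bigr => i _.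
  by rewrite hornerZ hornerXn exprS mulrCA.
have dpE x : p^`().[x] = \sum_(i < N) a i * x ^+ i.
  rewrite /p raddf_sum horner_sum; apply: eq_bigr => i _ /=.
  rewrite derivZ derivXn /= hornerZ hornerMn hornerXn -(mulr_natr (x ^+ i)).
  by rewrite (mulrC (x ^+ i)) mulrA divfK ?pnatr_eq0.
have : p.[0] <= p.[s].
  apply: (@ler_hornerW _ 0 s) => //.
  - move=> x; rewrite in_itv /= => /andP[x0 xs].
    by rewrite dpE H// (ltW x0) (lt_le_trans xs s1).
  - by rewrite in_itv /= lexx.
  - by rewrite in_itv /= lexx s0.
by rewrite !pE mul0r pmulr_rge0.
Qed.

(** Averaging twice produces the weights [1 / (i + 1)^2], which are the moments of
[log (1 / s)] on the unit interval. *)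
Lemma poly_dbl_avg_ge0 N (a : 'I_N -> R) :
  (forall s, 0 <= s < 1 -> 0 <= \sum_(i < N) a i * s ^+ i) ->
  0 <= \sum_(i < N) a i / i.+1%:R ^+ 2.
Proof.
move=> H; have H1 := poly_avg_ge0 H.
have := @poly_avg_ge0 N (fun i => a i / i.+1%:R).
have H2 s : 0 <= s < 1 -> 0 <= \sum_(i < N) a i / i.+1%:R * s ^+ i.
  by move=> /andP[s0 s1]; rewrite H1// s0 ltW.
move=> /(_ H2 1); rewrite ler01 lexx => /(_ isT).
congr (_ <= _); apply: eq_bigr => i _.
by rewrite expr1n mulr1 expr2 invfM mulrA.
Qed.

(** * Polynomials in a complex variable and its conjugate *)

(* In [{poly {poly C}}] the inner variable stands for [z], the outer one for
   its conjugate. *)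
Notation CC := {poly {poly C}}.
Implicit Types (W x y : CC) (p q : {poly C}) (z : C).

Definition ev z W : C := W.[z^J%:P].[z].

Definition cj p : {poly C} := map_poly (@conjc R) p.

(** Complex conjugation of the values exchanges the two variables. *)
Definition star W : CC := swapXY (map_poly (map_poly (@conjc R)) W).

(** The derivatives in the conjugate variable and in [z]. *)
Definition Db W : CC := W^`().
Definition D W : CC := swapXY (swapXY W)^`().

Lemma evD z x y : ev z (x + y) = ev z x + ev z y.
Proof. by rewrite /ev !hornerD. Qed.
Lemma evN z x : ev z (- x) = - ev z x.
Proof. by rewrite /ev !hornerN. Qed.
Lemma evM z x y : ev z (x * y) = ev z x * ev z y.
Proof. by rewrite /ev !hornerM. Qed.
Lemma evC z p : ev z p%:P = p.[z].
Proof. by rewrite /ev hornerC. Qed.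
Lemma ev_cst z c : ev z c%:P%:P = c.
Proof. by rewrite evC hornerC. Qed.
Lemma ev1 z : ev z 1 = 1.
Proof. by rewrite /ev !hornerC. Qed.
Lemma ev_mapC z p : ev z (map_poly polyC p) = p.[z^J].
Proof.
by rewrite /ev -(horner2_swapXY (map_poly polyC p)) swapXY_map_polyC hornerC.
Qed.

Lemma coef_star W i j : (star W)`_i`_j = (W`_j`_i)^J.
Proof. by rewrite /star coef_swapXY !coef_map. Qed.

Lemma star_inv W : star (star W) = W.
Proof. by apply/polyP => i; apply/polyP => j; rewrite !coef_star conjcK. Qed.

Lemma starD x y : star (x + y) = star x + star y.
Proof. by rewrite /star !rmorphD. Qed.
Lemma starN x : star (- x) = - star x.
Proof.
by apply/polyP => i; apply/polyP => j; rewrite !coefN !coef_star !coefN conjcN.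
Qed.
Lemma starM x y : star (x * y) = star x * star y.
Proof. by rewrite /star !rmorphM. Qed.
Lemma starC p : star p%:P = map_poly polyC (cj p).
Proof. by rewrite /star map_polyC /= swapXY_polyC. Qed.
Lemma star_mapC p : star (map_poly polyC p) = (cj p)%:P.
Proof.
have cjK : cj (cj p) = p.
  by apply/polyP => i; rewrite !coef_map /= conjcK.
by rewrite -[in LHS]cjK -starC star_inv.
Qed.

Lemma ev_star z W : ev z (star W) = (ev z W)^J.
Proof.
rewrite /ev /star horner2_swapXY.
have -> : z%:P = map_poly (@conjc R) (z^J)%:P by rewrite map_polyC /= conjcK.
by rewrite horner_map /= horner_map.
Qed.

Lemma coef_Db W i j : (Db W)`_i`_j = W`_i.+1`_j *+ i.+1.
Proof. by rewrite /Db coef_deriv coefMn. Qed.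

Lemma coef_D W i j : (D W)`_i`_j = W`_i`_j.+1 *+ j.+1.
Proof. by rewrite /D coef_swapXY coef_deriv coefMn coef_swapXY. Qed.

Lemma D_Db W : D (Db W) = Db (D W).
Proof.
apply/polyP => i; apply/polyP => j; rewrite !(coef_D, coef_Db).
by rewrite mulrnAC.
Qed.

Lemma D_star W : D (star W) = star (Db W).
Proof.
apply/polyP => i; apply/polyP => j.
by rewrite coef_D !coef_star coef_Db rmorphMn.
Qed.

Lemma Db_star W : Db (star W) = star (D W).
Proof.
apply/polyP => i; apply/polyP => j.
by rewrite coef_Db !coef_star coef_D rmorphMn.
Qed.

Lemma DbD x y : Db (x + y) = Db x + Db y. Proof. exact: derivD. Qed.
Lemma DbN x : Db (- x) = - Db x. Proof. exact: derivN. Qed.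
Lemma DbM x y : Db (x * y) = Db x * y + x * Db y. Proof. exact: derivM. Qed.
Lemma DbC p : Db p%:P = 0. Proof. exact: derivC. Qed.
Lemma Db_mapC p : Db (map_poly polyC p) = map_poly polyC p^`().
Proof. exact: deriv_map. Qed.

Lemma DD x y : D (x + y) = D x + D y.
Proof. by rewrite /D rmorphD derivD rmorphD. Qed.
Lemma DN x : D (- x) = - D x.
Proof.
by apply/polyP => i; apply/polyP => j; rewrite !coefN !coef_D !coefN mulNrn.
Qed.
Lemma DM x y : D (x * y) = D x * y + x * D y.
Proof. by rewrite /D rmorphM derivM rmorphD !rmorphM /= !swapXYK. Qed.
Lemma DC p : D p%:P = p^`()%:P.
Proof. by rewrite /D swapXY_polyC deriv_map swapXY_map_polyC. Qed.
Lemma D_mapC p : D (map_poly polyC p) = 0.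
Proof. by rewrite /D swapXY_map_polyC derivC rmorph0. Qed.

(** Integration against [log (1 / |z|^2)] over the unit disc with normalized area:
the terms [z^i zbar^j] with [i <> j] integrate to zero, and the powers of [|z|^2]
to the moments of a logarithm.  The bound [N] is any bound for the diagonal. *)
Definition Lam N W : C := \sum_(i < N) W`_i`_i / (i.+1%:R) ^+ 2.

Lemma LamD N x y : Lam N (x + y) = Lam N x + Lam N y.
Proof.
by rewrite /Lam -big_split; apply: eq_bigr => i _; rewrite !coefD mulrDl.
Qed.

Lemma LamZ N (c : C) x : Lam N (c%:P%:P * x) = c * Lam N x.
Proof.
by rewrite /Lam mulr_sumr; apply: eq_bigr => i _; rewrite !coefCM mulrA.
Qed.

Lemma LamN N x : Lam N (- x) = - Lam N x.
Proof. by rewrite /Lam -sumrN; apply: eq_bigr => i _; rewrite !coefN mulNr. Qed.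

(** Green's formula: the factor [(i + 1)^2] produced by the two derivatives cancels
the weight, and what is left is the mean over the circle minus the value at the
centre. *)
Lemma Lam_green N W :
  Lam N (D (Db W)) = \sum_(i < N.+1) W`_i`_i - W`_0`_0.
Proof.
rewrite big_ord_recl /= addrAC subrr add0r; apply: eq_bigr => i _.
rewrite coef_D coef_Db /bump /= add1n -mulrnA -(mulr_natr _ (i.+1 * i.+1)) natrM -expr2.
by rewrite mulfK// expf_neq0// pnatr_eq0.
Qed.

End PolyFunctional.

(** * Polynomials on circles *)

Section HankelCore.
Context {R : realType}.
Notation C := R[i].
Notation CC := {poly {poly C}}.
Implicit Types (W x y : CC) (p q u v : {poly C}) (z : C).

Lemma expiX (t : R) (n : nat) : expi t ^+ n = ek n%:Z t.
Proof.
elim: n => [|n IH]; first by rewrite expr0 ek0.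
by rewrite exprS IH -addn1 PoszD addrC ekD /ek mul1r.
Qed.

Lemma sum_ord_pick (n j : nat) (F : nat -> C) :
  \sum_(i < n) F i * (i%:Z - j%:Z == 0)%:R = if (j < n)%N then F j else 0.
Proof.
case: ifP => jn.
  rewrite (bigD1 (Ordinal jn))//= subrr eqxx mulr1 big1 ?addr0// => i ij.
  rewrite subr_eq0 eqz_nat (_ : (nat_of_ord i == j) = false) ?mulr0//.
  by apply: negbTE; apply: contra ij => /eqP ij; apply/eqP/val_inj.
rewrite big1// => i _; rewrite subr_eq0 eqz_nat (_ : (nat_of_ord i == j) = false).
  by rewrite mulr0.
by apply/negbTE; apply: contraFN jn => /eqP <-.
Qed.

Lemma sum_ord_ext (n m : nat) (F : nat -> C) :
  (forall i, (n <= i)%N -> F i = 0) -> (forall i, (m <= i)%N -> F i = 0) ->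
  \sum_(i < n) F i = \sum_(i < m) F i.
Proof.
wlog nm : n m / (n <= m)%N.
  by move=> H Hn Hm; case/orP: (leq_total n m) => ?; [|symmetry]; exact: H.
move=> Hn _; rewrite -(subnKC nm) big_split_ord /= [X in _ = _ + X]big1 ?addr0//.
by move=> i _; rewrite Hn// leq_addr.
Qed.

(** On the circle of radius [r] the modes [z^i zbar^j] with [i <> j] have mean
zero. *)
Lemma E_ev (r : R) W :
  E (fun t => ev (r%:C * expi t) W) = \sum_(j < size W) W`_j`_j * (r%:C ^+ 2) ^+ j.
Proof.
pose c i j : C := W`_j`_i * r%:C ^+ (i + j).
rewrite (E_ext (g := fun t => \sum_(j < size W) \sum_(i < size W`_j)
    c i j * ek (i%:Z - j%:Z) t)).
  have bc i j : bcv (fun t => c i j * ek (i%:Z - j%:Z) t).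
    by apply: bcvZ; exact: bcv_ek.
  rewrite E_sum => [|j]; last by apply: bcv_sum => i; exact: bc.
  apply: eq_bigr => j _; rewrite E_sum => [|i]; last exact: bc.
  rewrite (eq_bigr (fun i : 'I_(size W`_j) => c i j * (i%:Z - j%:Z == 0)%:R)).
    rewrite (sum_ord_pick _ _ (fun i => c i j)).
    case: ltnP => [_|H]; first by rewrite /c -exprM mul2n addnn.
    by rewrite (nth_default 0 H) mul0r.
  by move=> i _; rewrite EZ ?E_ek//; exact: bcv_ek.
move=> t; rewrite /ev (horner_coef W) horner_sum; apply: eq_bigr => j _.
rewrite hornerM horner_exp hornerC (horner_coef W`_j) mulr_suml; apply: eq_bigr => i _.
rewrite conjcM conjc_real expiJ !exprMn /c exprD ekD expiX.
rewrite (_ : expi (- t) ^+ j = ek (- j%:Z) t); first by ring.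
by rewrite expiX /ek mulrN mulrNz mulNr.
Qed.

Lemma bcv_ev (r : R) W : bcv (fun t => ev (r%:C * expi t) W).
Proof.
rewrite (_ : (fun t => _) = (fun t => \sum_(j < size W) \sum_(i < size W`_j)
    (W`_j`_i * r%:C ^+ (i + j)) * ek (i%:Z - j%:Z) t)).
  by apply: bcv_sum => j; apply: bcv_sum => i; apply: bcvZ; exact: bcv_ek.
apply/funext => t; rewrite /ev (horner_coef W) horner_sum; apply: eq_bigr => j _.
rewrite hornerM horner_exp hornerC (horner_coef W`_j) mulr_suml; apply: eq_bigr => i _.
rewrite conjcM conjc_real expiJ !exprMn exprD ekD expiX.
rewrite (_ : expi (- t) ^+ j = ek (- j%:Z) t); first by ring.
by rewrite expiX /ek mulrN mulrNz mulNr.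
Qed.

Definition pos z : Prop := exists2 q : R, 0 <= q & z = q%:C.

Definition diag_below N W : Prop := forall i, (N <= i)%N -> W`_i`_i = 0.

Lemma diag_size N W : (size W <= N)%N -> diag_below N W.
Proof. by move=> WN i Ni; rewrite (nth_default 0 (leq_trans WN Ni)) coef0. Qed.

Lemma trace_circle N W (r : R) : diag_below N W ->
  E (fun t => ev (r%:C * expi t) W) = \sum_(i < N) W`_i`_i * (r%:C ^+ 2) ^+ i.
Proof.
move=> HN; rewrite E_ev.
apply: (sum_ord_ext (F := fun i => W`_i`_i * (r%:C ^+ 2) ^+ i)) => i Hi.
  by rewrite (diag_size (leqnn _) Hi) mul0r.
by rewrite (HN i Hi) mul0r.
Qed.

Lemma E_pos f : bcv f -> (forall t, pos (f t)) -> pos (E f).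
Proof.
move=> bf pf; exists (Er (fun t => Re (f t))).
  rewrite -(Er_cst 0); apply: Er_le => [||t]; first exact: brv_cst.
    by case: bf.
  by have [q q0 ->] := pf t.
rewrite -E_real; apply: E_ext => t.
by have [q _ ->] := pf t.
Qed.

Lemma Im_sum (I : Type) (r : seq I) (F : I -> C) :
  Im (\sum_(i <- r) F i) = \sum_(i <- r) Im (F i).
Proof. by elim/big_rec2: _ => // i a b _ <-; rewrite cImD. Qed.

(** The means of [W] over the circles of radius [sqrt s] are the values at [s] of a
polynomial with the diagonal coefficients of [W]; they are nonnegative, and [Lam]
averages them twice. *)
Lemma Lam_pos N W : diag_below N W -> (forall z, nsq z < 1 -> pos (ev z W)) ->
  pos (Lam N W).
Proof.
move=> HN HW.
have H s : 0 <= s < 1 -> pos (\sum_(i < N) W`_i`_i * s%:C ^+ i).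
  move=> /andP[s0 s1]; have := trace_circle (Num.sqrt s) HN.
  rewrite -rmorphXn /= sqr_sqrtr// => <-; apply: E_pos; first exact: bcv_ev.
  by move=> t; apply: HW; rewrite nsqM nsq_expi mulr1 nsq_real sqr_sqrtr.
have ReI (i : nat) (s : R) (w : C) : Re (w * s%:C ^+ i) = Re w * s ^+ i.
  by rewrite -rmorphXn /=; case: w => a b /=; ring.
have ImI (i : nat) (s : R) (w : C) : Im (w * s%:C ^+ i) = Im w * s ^+ i.
  by rewrite -rmorphXn /=; case: w => a b /=; ring.
have dv (i : nat) (w : C) : w / i.+1%:R ^+ 2 = w * ((i.+1%:R ^+ 2)^-1)%:C.
  by rewrite rmorphV ?unitfE ?expf_neq0 ?pnatr_eq0// rmorphXn /= rmorph_nat.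
exists (\sum_(i < N) Re (W`_i`_i) / i.+1%:R ^+ 2).
  apply: poly_dbl_avg_ge0 => s /H[q q0 /(congr1 (@complex.Re R))].
  by rewrite cRe_sum; under eq_bigr do rewrite ReI; move=> ->.
apply: complexP; rewrite /Lam.
  rewrite cRe_sum /=; apply: eq_bigr => i _; rewrite dv.
  by case: (W`_i`_i) => a b /=; ring.
rewrite Im_sum /=; under eq_bigr do rewrite dv.
have I0 s : 0 <= s < 1 -> \sum_(i < N) Im (W`_i`_i) * s ^+ i = 0.
  move=> /H[q q0 /(congr1 (@complex.Im R))].
  by rewrite Im_sum; under eq_bigr do rewrite ImI.
have ImE (i : nat) (w : C) : Im (w * ((i.+1%:R ^+ 2)^-1)%:C) = Im w / i.+1%:R ^+ 2.
  by case: w => a b /=; ring.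
under eq_bigr do rewrite ImE.
apply/le_anti/andP; split; last first.
  by apply: poly_dbl_avg_ge0 => s /I0 ->.
rewrite -oppr_ge0 -sumrN; under eq_bigr do rewrite -mulNr.
apply: (@poly_dbl_avg_ge0 _ _ (fun i : 'I_N => - Im (W`_i`_i))) => s /I0 I0s.
by under eq_bigr do rewrite mulNr; rewrite sumrN I0s oppr0.
Qed.

(** [Lam] applied to [x * star y] is a positive hermitian form in [x] and [y]. *)
Lemma CS_Lam N x y : diag_below N (x * star x) -> diag_below N (x * star y) ->
  diag_below N (y * star x) -> diag_below N (y * star y) ->
  nsq (Lam N (x * star y)) <= Re (Lam N (x * star x)) * Re (Lam N (y * star y)).
Proof.
move=> hxx hxy hyx hyy.
have yyp : pos (Lam N (y * star y)).
  apply: Lam_pos => // z _; exists (nsq (ev z y)); first exact: nsq_ge0.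
  by rewrite evM ev_star nsqE.
have Lstar W : Lam N (star W) = (Lam N W)^J.
  rewrite /Lam conjc_sum; apply: eq_bigr => i _.
  rewrite coef_star conjcM; congr (_ * _).
  by rewrite conjc_inv rmorphXn /= rmorph_nat.
apply: CS_of_pos => [|l]; first by have [q q0 ->] := yyp.
pose w := x + (l^J)%:P%:P * y.
have cl : star ((l^J)%:P%:P : CC) = l%:P%:P.
  by rewrite starC /cj map_polyC /= map_polyC /= conjcK.
have wE : w * star w = x * star x + (l%:P%:P * (x * star y) +
    ((l^J)%:P%:P * (y * star x) + (l * l^J)%:P%:P * (y * star y))).
  by rewrite /w starD starM cl !polyCM; ring.
have dw : diag_below N (w * star w).
  move=> i Ni; rewrite wE !coefD !coefCM hxx// hxy// hyx// hyy//.
  by rewrite !mulr0 !addr0.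
have : pos (Lam N (w * star w)).
  apply: Lam_pos => // z _; exists (nsq (ev z w)); first exact: nsq_ge0.
  by rewrite evM ev_star nsqE.
rewrite wE !LamD !LamZ => -[q q0 /(congr1 (@complex.Re R)) /= Hq].
rewrite (_ : _ + _ = q)//.
rewrite -Hq -(_ : star (x * star y) = y * star x); last first.
  by rewrite starM star_inv mulrC.
rewrite Lstar -nsqE !cReD; have [r _ ->] := yyp.
by case: (Lam N (x * star y)) => a b; case: (l) => c d /=; ring.
Qed.

End HankelCore.

(** * The pointwise inequality, in an abstract differential ring *)

Section DifferentialRing.
Context {R : realType}.
Notation C := R[i].
Variable A : comNzRingType.
Implicit Types (d : A -> A) (x y z : A).

Definition derivation d : Prop :=
  (forall x y, d (x + y) = d x + d y) /\
  (forall x y, d (x * y) = d x * y + x * d y).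

Lemma derivation0 d : derivation d -> d 0 = 0.
Proof. by case=> dD _; apply: (addrI (d 0)); rewrite -dD !addr0. Qed.

Lemma derivation1 d : derivation d -> d 1 = 0.
Proof.
by case=> _ dM; apply: (addrI (d 1)); rewrite addr0 -{3}(mul1r 1) dM mul1r mulr1.
Qed.

Lemma derivationN d x : derivation d -> d (- x) = - d x.
Proof.
move=> dd; apply: (addrI (d x)); rewrite subrr -(derivation0 dd).
by case: dd => dD _; rewrite -dD subrr.
Qed.

(** The quadratic Taylor polynomial of the exponential.  With [h = 1 / 2] it is
logarithmically convex on [[-2, 0]]. *)
Definition quad (h x : A) : A := 1 + x + h * (x * x).

Lemma derivation_quad d h x : derivation d -> h + h = 1 -> d h = 0 ->
  d (quad h x) = (1 + x) * d x.
Proof.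
move=> dd hh dh; have d1 := derivation1 dd; case: dd => dD dM.
rewrite /quad !dD !dM d1 dh.
transitivity (d x + (h + h) * (x * d x)); first by ring.
by rewrite hh; ring.
Qed.

Variables (D Db star : A -> A).
Hypotheses (dD : derivation D) (dDb : derivation Db).
Hypothesis D_Db : forall x, D (Db x) = Db (D x).
Hypothesis D_star : forall x, D (star x) = star (Db x).
Hypothesis Db_star : forall x, Db (star x) = star (D x).
Hypothesis star0 : star 0 = 0.
Hypothesis starD : forall x y, star (x + y) = star x + star y.
Hypothesis starM : forall x y, star (x * y) = star x * star y.
Hypothesis starK : forall x, star (star x) = x.

Lemma laplace_quad h x y y' : h + h = 1 -> D h = 0 -> Db h = 0 ->
  Db y = 0 -> D y' = 0 -> D (Db y') = 0 ->
  D (Db (quad h x * (y * y'))) = D x * Db x * (y * y')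
    + (1 + x) * D (Db x) * (y * y') + (1 + x) * Db x * (D y * y')
    + (1 + x) * D x * (y * Db y') + quad h x * (D y * Db y').
Proof.
move=> hh Dh Dbh hy hy' hyy.
have D1 := derivation1 dD.
have DQ := derivation_quad x dD hh Dh; have DbQ := derivation_quad x dDb hh Dbh.
have [DA DM] := dD; have [DbA DbM] := dDb.
rewrite !DbM DbQ hy mul0r add0r !DA !DM DQ DA D1 hy' hyy; ring.
Qed.

(** Both [H] and [G] are harmonic, so the Laplacian of [H - |G|^2] only involves
first derivatives of [G]. *)
Lemma laplace_excess x y : D (Db x) = 0 -> D (Db y) = 0 ->
  D (Db (x - y * star y)) = - (D y * star (D y) + Db y * star (Db y)).
Proof.
move=> hx hy.
have [DA DM] := dD; have [DbA DbM] := dDb.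
have DbN z : Db (- z) = - Db z by exact: derivationN.
have DN z : D (- z) = - D z by exact: derivationN.
rewrite DbA DbN DbM DA DN hx DA !DM hy.
by rewrite [D (Db (star y))]D_Db !D_star !Db_star hy star0; ring.
Qed.

Variable e : {rmorphism A -> C}.
Hypothesis e_star : forall x, e (star x) = (e x)^J.

(** The Laplacian of [(1 + phi + phi^2 / 2) |v|^2], for [v] holomorphic and
[phi = - s (H - |G|^2)] in [[-1/2, 0]], is the sum of
[(1 + phi) (d dbar phi) |v|^2], of the square [|phi' v + (1 + phi) v'|^2] and of a
nonnegative multiple of [|v'|^2]; the first term is at least
[s / 2 |dbar G|^2 |v|^2] and the others are nonnegative.  The evaluation at a point
is the ring morphism [e]; scalars of the ring are elements killed by both
derivations. *)
Lemma laplace_pos (h cs ck H G v : A) (s q : R) :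
  h + h = 1 -> D h = 0 -> Db h = 0 -> e h = (2^-1)%:C ->
  D cs = 0 -> Db cs = 0 -> star cs = cs -> e cs = s%:C -> 0 < s ->
  e ck = (s / 2)%:C ->
  D (Db H) = 0 -> star H = H -> D (Db G) = 0 -> Db v = 0 ->
  0 <= s * q <= 2^-1 -> e H = (nsq (e G) + q)%:C ->
  let phi := - cs * (H - G * star G) in
  let x := Db G * v in
  exists2 r : R, 0 <= r &
    e (D (Db (quad h phi * (v * star v))) - ck * (x * star x)) = r%:C.
Proof.
move=> hh Dh Dbh eh Dcs Dbcs scs ecs s0 eck DDH HH DDG Dbv /andP[sq0 sq1] eH phi x.
have Dvs : D (star v) = 0 by rewrite D_star Dbv star0.
have DDbvs : D (Db (star v)) = 0.
  by rewrite D_Db Dvs; exact: derivation0.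
have starN z : star (- z) = - star z.
  by apply: (addrI (star z)); rewrite -starD !subrr.
have starphi : star phi = phi.
  by rewrite /phi starM starN scs starD starN HH starM starK (mulrC (star G)).
have Dbphi : Db phi = star (D phi) by rewrite -Db_star starphi.
have DDbphi : D (Db phi) = cs * (D G * star (D G) + Db G * star (Db G)).
  have [DA DM] := dD; have [DbA DbM] := dDb.
  rewrite /phi DbM derivationN// Dbcs oppr0 mul0r add0r DM derivationN// Dcs.
  by rewrite (laplace_excess DDH DDG); ring.
rewrite (laplace_quad _ hh Dh Dbh Dbv Dvs DDbvs) DDbphi Dbphi Db_star.
have phiE : e phi = (- (s * q))%:C.
  rewrite /phi rmorphM rmorphN rmorphB rmorphM /= ecs eH e_star -nsqE.
  by rewrite -rmorphB -rmorphN -rmorphM /=; congr (_%:C); ring.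
clearbody phi.
rewrite /x starM !(rmorphM, rmorphD, rmorphB, rmorphN, rmorph1) /= !e_star phiE ecs eck.
rewrite ?eh ?phiE.
move: (e (D phi)) (e v) (e (D v)) (e (D G)) (e (Db G)) => {phiE Dbphi DDbphi starphi}.
move=> al vz v1 g1 g2.
move: (s * q) sq0 sq1 => p p0 p1.
(* completing the square in the terms with first derivatives of [v] *)
exists (((1 - p) * (s * (nsq g1 + nsq g2)) - s / 2 * nsq g2) * nsq vz +
    nsq (al * vz + (1 - p)%:C * v1) + (p - p ^+ 2 / 2) * nsq v1).
  have := nsq_ge0 g1; have := nsq_ge0 g2; have := nsq_ge0 vz.
  have := nsq_ge0 v1; have := nsq_ge0 (al * vz + (1 - p)%:C * v1).
  set n1 := nsq _; set n2 := nsq v1; set n3 := nsq vz.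
  set n4 := nsq g2; set n5 := nsq g1 => h1 h2 h3 h4 h5.
  have h6 : 0 <= (1 - p) * (s * (n5 + n4)) - s / 2 * n4.
    have : 0 <= (2^-1 - p) * (s * (n5 + n4)).
      rewrite mulr_ge0//; first by lra.
      exact: mulr_ge0 (ltW s0) (addr_ge0 h5 h4).
    have := mulr_ge0 (ltW s0) h5.
    by lra.
  have h7 : 0 <= p - p ^+ 2 / 2 by nra.
  exact: addr_ge0 (addr_ge0 (mulr_ge0 h6 h3) h1) (mulr_ge0 h7 h2).
case: al vz v1 g1 g2 => [a1 a2] [b1 b2] [c1 c2] [d1 d2] [f1 f2].
by apply: complexP; rewrite /nsq /=; field.
Qed.

End DifferentialRing.

(** * Carleson embedding and Hankel forms *)

Section HankelBound.
Context {R : realType}.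
Notation C := R[i].
Notation CC := {poly {poly C}}.
Implicit Types (W x y : CC) (p q u v : {poly C}) (z : C).

Lemma Lam_ext N M W : diag_below N W -> diag_below M W -> Lam N W = Lam M W.
Proof.
move=> HN HM; apply: (sum_ord_ext (F := fun i => W`_i`_i / i.+1%:R ^+ 2)) => i Hi.
  by rewrite HN// mul0r.
by rewrite HM// mul0r.
Qed.

Lemma horner_tp p (t : R) : p.[expi t] = tp 0 (fun i : 'I_(size p) => p`_i) t.
Proof.
by rewrite horner_coef; apply: eq_bigr => i _; rewrite expiX add0r.
Qed.

(** The squared norm in H^2 of the polynomial [p]. *)
Definition psq p : R := \sum_(i < size p) nsq p`_i.

Lemma Er_nsq_horner p : Er (fun t => nsq p.[expi t]) = psq p.
Proof.
by rewrite /psq -(Er_nsq_tp 0); congr Er; apply/funext => t; rewrite horner_tp.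
Qed.

Lemma ev0 W : ev 0 W = W`_0`_0.
Proof. by rewrite /ev conjc0 !horner_coef0. Qed.

Definition cst (c : C) : CC := c%:P%:P.

Lemma D_cst c : D (cst c) = 0. Proof. by rewrite /cst DC derivC. Qed.
Lemma Db_cst c : Db (cst c) = 0. Proof. exact: DbC. Qed.
Lemma star_cst (r : R) : star (cst r%:C) = cst r%:C.
Proof.
rewrite /cst starC /cj map_polyC map_polyC; congr (_%:P%:P).
exact: conjc_real.
Qed.

Lemma cst_half : cst (2^-1)%:C + cst (2^-1)%:C = 1.
Proof.
rewrite /cst -!polyCD -rmorphD /=; congr (_%:P%:P).
by rewrite (_ : 2^-1 + 2^-1 = 1 :> R)//; field.
Qed.

Lemma evcst z c : ev z (cst c) = c. Proof. exact: ev_cst. Qed.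
Lemma D1 : D (1 : CC) = 0. Proof. exact: (D_cst 1). Qed.

Lemma cstM (c : C) x i : (cst c * x)`_i`_i = c * x`_i`_i.
Proof. by rewrite /cst !coefCM. Qed.
Lemma Lam_cst N c x : Lam N (cst c * x) = c * Lam N x.
Proof. exact: LamZ. Qed.

Definition ev_rmorphism z : {rmorphism CC -> C} :=
  (horner_eval z \o horner_eval z^J%:P)%FUN.

Lemma LamE N W : Lam N W = \sum_(i < N) W`_i`_i / i.+1%:R ^+ 2.
Proof. by []. Qed.

Lemma ev_rmorphismE z W : ev_rmorphism z W = ev z W.
Proof. by []. Qed.

#[local] Opaque D Db star ev Lam cst.

Lemma Db0 : Db (0 : CC) = 0. Proof. exact: (DbC 0). Qed.
Lemma star0 : star (0 : CC) = 0.
Proof. by apply: (addrI (star 0)); rewrite -starD !addr0. Qed.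

Definition harm_ext (a b : {poly C}) : CC := a%:P + map_poly polyC b.

(** Garsia's form of a bound on the norm in BMO of the trigonometric polynomial with
harmonic extension [a(z) + b(zbar)].  The harmonic extension [H] of its squared
modulus is carried as a polynomial, which keeps the whole argument algebraic. *)
Definition garsia_le (a b : {poly C}) (eta2 : R) : Prop :=
  exists H : CC, [/\ D (Db H) = 0, star H = H,
    forall t, ev (expi t) H = (nsq (ev (expi t) (harm_ext a b)))%:C &
    forall z, nsq z < 1 -> exists2 q : R, 0 <= q <= eta2 &
      ev z H = (nsq (ev z (harm_ext a b)) + q)%:C].

(** Carleson embedding for the measure [|dbar G|^2 log (1 / |z|^2)].  With [V] the
excess [H - |G|^2] and [phi = - V / (2 eta2)] in [[-1/2, 0]], the function
[w = (1 + phi + phi^2 / 2) |v|^2] equals [|v|^2] on the circle, and its Laplacian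
is at least [|dbar G|^2 |v|^2 / (4 eta2)] by [laplace_pos].  Green's formula bounds
the integral of the Laplacian by the mean of [w] over the circle. *)
Lemma carleson_embedding (a b v : {poly C}) (eta2 : R) N : 0 < eta2 ->
  garsia_le a b eta2 ->
  diag_below N (Db (harm_ext a b) * v%:P * star (Db (harm_ext a b) * v%:P)) ->
  Re (Lam N (Db (harm_ext a b) * v%:P * star (Db (harm_ext a b) * v%:P)))
    <= 4 * eta2 * psq v.
Proof.
move=> e0 [H [DDH HH circ disc]].
have DDbG : D (Db (harm_ext a b)) = 0.
  by rewrite /harm_ext DbD DbC Db_mapC add0r D_mapC.
move: (harm_ext a b) DDbG circ disc => G DDbG circ disc.
set x := Db G * v%:P => hx.
pose s : R := (2 * eta2)^-1.
have s0 : 0 < s by rewrite invr_gt0 mulr_gt0.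
pose phi := - cst s%:C * (H - G * star G).
pose w := quad (cst (2^-1)%:C) phi * (v%:P * star v%:P).
pose W := D (Db w) - cst (s / 2)%:C * (x * star x).
pose N' := (N + size w)%N.
have dx : diag_below N' (x * star x).
  by move=> i Hi; apply: hx; rewrite (leq_trans _ Hi)// leq_addr.
have dw i : (N' <= i)%N -> w`_i`_i = 0.
  by move=> Hi; apply: (diag_size (leqnn _)); rewrite (leq_trans _ Hi)// leq_addl.
have dDDw : diag_below N' (D (Db w)).
  move=> i Hi; rewrite coef_D coef_Db dw ?mul0rn//.
  by rewrite (leq_trans Hi).
have posW : pos (Lam N' W).
  apply: Lam_pos.
    move=> i Hi; rewrite /W coefB coefB dDDw// sub0r cstM dx//.
    by rewrite mulr0 oppr0.
  move=> z z1; have [q /andP[q0 qe] Hz] := disc z z1.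
  have dD : derivation (D : CC -> CC) by split; [exact: DD|exact: DM].
  have dDb : derivation (Db : CC -> CC) by split; [exact: DbD|exact: DbM].
  have es y : ev_rmorphism z (star y) = (ev_rmorphism z y)^J.
    by rewrite !ev_rmorphismE; exact: ev_star.
  have ec (r : R) : ev_rmorphism z (cst r%:C) = r%:C.
    by rewrite ev_rmorphismE; exact: evcst.
  have sq : 0 <= s * q <= 2^-1.
    rewrite mulr_ge0 ?(ltW s0)//=.
    apply: (@le_trans _ _ (s * eta2)); first by rewrite ler_wpM2l// ltW.
    by rewrite le_eqVlt; apply/orP; left; apply/eqP; rewrite /s; field; rewrite gt_eqF.
  have eH : ev_rmorphism z H = (nsq (ev_rmorphism z G) + q)%:C.
    by rewrite !ev_rmorphismE.
  have [r r0 rE] := @laplace_pos R CC D Db star dD dDb D_Db D_star Db_star star0 starD starM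
    star_inv (ev_rmorphism z) es (cst (2^-1)%:C) (cst s%:C) (cst (s / 2)%:C)
    H G v%:P s q cst_half (D_cst _) (Db_cst _) (ec _) (D_cst _) (Db_cst _)
    (star_cst _) (ec _) s0 (ec _) DDH HH DDbG (DbC v) sq eH.
  by exists r; [exact: r0|rewrite -rE ev_rmorphismE].
have evw z (q : R) : ev z H = (nsq (ev z G) + q)%:C ->
    ev z w = ((1 - s * q + (s * q) ^+ 2 / 2) * nsq v.[z])%:C.
  move=> Hz; have phiE : ev z phi = (- (s * q))%:C.
    rewrite /phi evM evN evcst evD evN (evM z G) ev_star Hz -nsqE.
    rewrite -rmorphN -rmorphB -rmorphM /=; congr (_%:C); ring.
  rewrite /w evM /quad (evD z (1 + phi)) (evD z 1) ev1 (evM z (cst _)) (evM z phi).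
  rewrite phiE evcst (evM z v%:P) ev_star evC -nsqE.
  rewrite -(rmorph1 (real_complex R)) -!rmorphM -!rmorphD -rmorphM /=.
  by congr (_%:C); field.
have tr : \sum_(i < N'.+1) w`_i`_i = (psq v)%:C.
  have dw' : diag_below N'.+1 w by move=> i /ltnW; exact: dw.
  have := trace_circle 1 dw'; rewrite rmorph1 expr1n.
  under [RHS]eq_bigr do rewrite expr1n mulr1.
  move=> <-; rewrite -Er_nsq_horner -E_real; apply: E_ext => t; rewrite mul1r.
  rewrite (evw _ 0); last by rewrite circ addr0.
  by congr (_%:C); ring.
have w00 : exists2 r : R, 0 <= r & w`_0`_0 = r%:C.
  have [|q /andP[q0 qe] Hq] := disc 0; first by rewrite nsq0 ltr01.
  exists ((1 - s * q + (s * q) ^+ 2 / 2) * nsq v.[0]).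
    rewrite mulr_ge0 ?nsq_ge0//.
    by have := sqr_ge0 (1 - s * q); rewrite sqrrB expr1n mul1r mulr2n; lra.
  by rewrite -ev0 (evw _ _ Hq).
have [r r0 rE] := w00; have [q q0 qE] := posW.
move: qE; rewrite /W LamD LamN Lam_cst Lam_green tr rE (Lam_ext dx hx).
move=> /(congr1 (@complex.Re R)).
case: (Lam N (x * star x)) => l1 l2 /=.
rewrite !mul0r !subr0 => qE.
have : s / 2 * l1 <= psq v by lra.
rewrite mulrC -ler_pdivlMr ?divr_gt0// => /le_trans; apply.
by rewrite le_eqVlt; apply/orP; left; apply/eqP; rewrite /s; field; rewrite gt_eqF.
Qed.

Lemma Lam_sq_ge0 N x : diag_below N (x * star x) -> 0 <= Re (Lam N (x * star x)).
Proof.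
move=> hx; have [|q q0 ->//] := @Lam_pos R N (x * star x) hx.
move=> z _; exists (nsq (ev z x)); first exact: nsq_ge0.
by rewrite evM ev_star nsqE.
Qed.

Lemma psq_ge_sum p n : \sum_(i < n) nsq p`_i <= psq p.
Proof.
have [pn|np] := leqP (size p) n.
  rewrite -(subnKC pn) big_split_ord /= [X in _ + X]big1 ?addr0// => i _.
  by rewrite nth_default ?nsq0// leq_addr.
rewrite /psq -(subnKC (ltnW np)) big_split_ord /= lerDl.
by apply: sumr_ge0 => i _; exact: nsq_ge0.
Qed.

Lemma coef_mapCM p q i : (map_poly polyC p * q%:P)`_i`_i = p`_i * q`_i.
Proof. by rewrite coefMC coef_map coefCM. Qed.

Lemma Lam_deriv N p q : Lam N (map_poly polyC p^`() * q^`()%:P) =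
  \sum_(i < N) p`_i.+1 * q`_i.+1.
Proof.
rewrite LamE; apply: eq_bigr => i _; rewrite coef_mapCM !coef_deriv.
rewrite -(mulr_natr p`_i.+1) -(mulr_natr q`_i.+1) mulrACA -expr2.
by rewrite mulfK// expf_neq0// pnatr_eq0.
Qed.

(** The Hankel form of [G] is [Lam (dbar G (u v)')]; the product rule and
Cauchy-Schwarz reduce it to the embedding. *)
Lemma hankel_bound (a b u v : {poly C}) (eta2 : R) : 0 < eta2 ->
  garsia_le a b eta2 ->
  nsq (\sum_(i < size (u * v)) b`_i.+1 * (u * v)`_i.+1) <=
    16 * eta2 * (psq u * psq v).
Proof.
move=> e0 Hg; pose g := Db (harm_ext a b).
pose yu : CC := (u^`())%:P; pose yv : CC := (v^`())%:P.
pose xu := g * u%:P; pose xv := g * v%:P.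
have gE : g = map_poly polyC b^`().
  by rewrite /g /harm_ext DbD DbC Db_mapC add0r.
pose N := (size (xv * star xv)%R + size (xv * yu)%R + size (star yu * star xv)%R
  + size (star yu * yu)%R + size (xu * star xu)%R + size (xu * yv)%R
  + size (star yv * star xu)%R + size (star yv * yv)%R + size (u * v)%R)%N.
have dN W : (size W <= N)%N -> diag_below N W by exact: diag_size.
have psq_deriv p : Re (Lam N (star p^`()%:P * p^`()%:P)) =
    \sum_(i < N) nsq p`_i.+1.
  rewrite starC {1}/cj -deriv_map Lam_deriv cRe_sum; apply: eq_bigr => i _.
  by rewrite coef_map mulrC -nsqE.
have half p q : diag_below N (g * p%:P * star (g * p%:P)) ->
    diag_below N (g * p%:P * q^`()%:P) ->
    diag_below N (star q^`()%:P * star (g * p%:P)) ->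
    diag_below N (star q^`()%:P * q^`()%:P) ->
    nsq (Lam N (g * p%:P * q^`()%:P)) <= 4 * eta2 * psq p * psq q.
  move=> h1 h2 h3 h4; have := @CS_Lam R N (g * p%:P) (star q^`()%:P).
  rewrite star_inv => /(_ h1 h2 h3 h4) /le_trans; apply.
  apply: ler_pM.
  - exact: Lam_sq_ge0.
  - by rewrite psq_deriv; apply: sumr_ge0 => i _; exact: nsq_ge0.
  - exact: carleson_embedding.
  - rewrite psq_deriv; apply: le_trans (psq_ge_sum q N.+1).
    by rewrite big_ord_recl lerDr nsq_ge0.
have S : Lam N (xv * yu + xu * yv) =
    \sum_(i < size (u * v)) b`_i.+1 * (u * v)`_i.+1.
  rewrite (_ : xv * yu + xu * yv = g * ((u * v)^`())%:P).
    rewrite gE Lam_deriv.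
    apply: (sum_ord_ext (F := fun i => b`_i.+1 * (u * v)`_i.+1)) => i Hi.
      rewrite [X in _ * X]nth_default ?mulr0// (leq_trans _ (leqW Hi))//.
      by rewrite /N leq_addl.
    by rewrite [X in _ * X]nth_default ?mulr0// (leq_trans Hi).
  by rewrite derivM polyCD !polyCM /xv /xu /yu /yv -!mulrA -mulrDr (mulrC v%:P).
rewrite -S LamD (le_trans (nsqD_le _ _))//.
have h1 : nsq (Lam N (xv * yu)) <= 4 * eta2 * psq v * psq u.
  by apply: half; apply: dN; rewrite -/xv -/yu /N; lia.
have h2 : nsq (Lam N (xu * yv)) <= 4 * eta2 * psq u * psq v.
  by apply: half; apply: dN; rewrite -/xu -/yv /N; lia.
move: (nsq (Lam N (xv * yu))) (nsq (Lam N (xu * yv))) h1 h2 => n1 n2.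
by move: (psq u) (psq v) => p1 p2; lra.
Qed.

End HankelBound.

(** * Poisson averages *)

Section Poisson.
Context {R : realType}.
Notation C := R[i].
Implicit Types (f g : R -> C) (z : C) (r s t : R) (K : nat).

(** The kernel at [z] depends on [t] through the product of the conjugate of [z] and
of the boundary point only. *)
Definition zeta z t : C := z^J * expi t.

Definition poisson z t : R := (1 - nsq z) / nsq (1 - zeta z t).

Lemma nsq_zeta z t : nsq (zeta z t) = nsq z.
Proof. by rewrite /zeta nsqM nsqJ nsq_expi mulr1. Qed.

Lemma nsq_1zeta_ge z r t : 0 <= r -> r < 1 -> nsq z <= r ^+ 2 ->
  (1 - r) ^+ 2 <= nsq (1 - zeta z t).
Proof.
move=> r0 r1 zr; have : Re (zeta z t) <= r by apply: Re_le_of_nsq; rewrite ?nsq_zeta.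
case: (zeta z t) => a b /= ar; rewrite /nsq /= sub0r sqrrN.
apply: (@le_trans _ _ ((1 - a) ^+ 2)); last by rewrite lerDl sqr_ge0.
by rewrite ler_sqr ?nnegrE ?subr_ge0 ?(ltW r1)//; lra.
Qed.

Lemma sqrt_lt1 z : nsq z < 1 -> exists r, [/\ 0 <= r, r < 1 & nsq z = r ^+ 2].
Proof.
move=> z1; exists (Num.sqrt (nsq z)); rewrite sqrtr_ge0 sqr_sqrtr ?nsq_ge0//.
by split=> //; rewrite -sqrtr1 ltr_sqrt.
Qed.

Lemma nsq_1zeta_gt0 z t : nsq z < 1 -> 0 < nsq (1 - zeta z t).
Proof.
move=> /sqrt_lt1[r [r0 r1 zr]].
apply: lt_le_trans (nsq_1zeta_ge t r0 r1 _); last by rewrite zr.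
by rewrite exprn_gt0// subr_gt0.
Qed.

Lemma poisson_ge0 z t : nsq z < 1 -> 0 <= poisson z t.
Proof. by move=> z1; rewrite divr_ge0 ?nsq_ge0// subr_ge0 ltW. Qed.

Lemma poisson_le z r t : 0 <= r -> r < 1 -> nsq z = r ^+ 2 ->
  poisson z t <= 2 / (1 - r).
Proof.
move=> r0 r1 zr; have z1 : nsq z < 1 by rewrite zr expr_lt1.
have r1' : 0 < 1 - r by rewrite subr_gt0.
rewrite /poisson ler_pdivrMr ?nsq_1zeta_gt0//.
apply: (@le_trans _ _ (2 / (1 - r) * (1 - r) ^+ 2)); last first.
  rewrite ler_wpM2l ?divr_ge0 ?(ltW r1')//.
  by apply: nsq_1zeta_ge => //; rewrite zr.
rewrite zr (_ : 2 / (1 - r) * _ = 2 * (1 - r)); last by field; rewrite gt_eqF.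
by nra.
Qed.

Lemma brv_poisson z : nsq z < 1 -> brv (poisson z).
Proof.
move=> z1; have e2 : 2 * pi = pi *+ 2 :> R by rewrite mulr2n mulrDl mul1r.
split.
- move=> t; rewrite /poisson /zeta; congr (_ / nsq (_ - _ * _)).
  by rewrite /expi e2 cosD2pi sinD2pi.
- apply: continuous_measurable_fun.
  pose q t := 1 + nsq z - 2 * (Re z * cos t + Im z * sin t).
  have qE t : nsq (1 - zeta z t) = q t.
    rewrite /q /zeta /nsq; have := cos2Dsin2 t.
    by case: z z1 @q => a b _ _ /=; rewrite !expr2; nra.
  rewrite (_ : poisson z = fun t => (1 - nsq z) * (q t)^-1); last first.
    by apply/funext => t; rewrite /poisson qE.
  move=> t; apply: cvgM; first exact: cvg_cst.
  apply: cvgV; first by rewrite -qE gt_eqF ?nsq_1zeta_gt0.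
  apply: cvgB; first exact: cvg_cst.
  apply: cvgM; first exact: cvg_cst.
  apply: cvgD; apply: cvgM; [exact: cvg_cst|exact: continuous_cos|exact: cvg_cst|].
  exact: continuous_sin.
- have [r [r0 r1 zr]] := sqrt_lt1 z1; exists (2 / (1 - r)) => t.
  by rewrite ger0_norm ?poisson_ge0// poisson_le.
Qed.

Definition Az z f : C := E (fun t => f t * (poisson z t)%:C).
Definition Ar z (q : R -> R) : R := Er (fun t => q t * poisson z t).

(** The Poisson average by partial sums of the Fourier series: the difference tends
to zero uniformly on smaller discs, which reduces identities between averages to
identities between polynomials. *)
Definition trunc z K f : C :=
  \sum_(k < K) z ^+ k * coef f k%:Z
  + \sum_(k < K) (if k == 0%N :> nat then 0 else z^J ^+ k * coef f (- k%:Z)).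

Lemma bcv_poisson z : nsq z < 1 -> bcv (fun t => (poisson z t)%:C).
Proof. by move=> z1; apply: bcv_real; exact: brv_poisson. Qed.

Lemma nsq_E_le f : bcv f -> nsq (E f) <= Er (fun t => nsq (f t)).
Proof.
move=> bf; have := CS_E bf (bcv_cst 1).
rewrite (_ : Er (fun t => nsq 1) = 1) ?mulr1; last first.
  by rewrite Er_cst /nsq /= expr1n expr0n addr0.
by congr (nsq _ <= _); apply: E_ext => t; rewrite conjc1 mulr1.
Qed.

Definition poisson_sum z K t : C :=
  \sum_(k < K) (zeta z t)^J ^+ k
  + \sum_(k < K) (if k == 0%N :> nat then 0 else (zeta z t) ^+ k).

Lemma zetaX z t k : zeta z t ^+ k = z^J ^+ k * ek k%:Z t.
Proof. by rewrite /zeta exprMn expiX. Qed.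

Lemma conjcX (w : C) k : (w ^+ k)^J = w^J ^+ k.
Proof. exact: rmorphXn. Qed.

Lemma zetaJX z t k : (zeta z t)^J ^+ k = z ^+ k * ek (- k%:Z) t.
Proof. by rewrite -conjcX zetaX conjcM conjcX conjcK ekJ. Qed.

Lemma bcv_poisson_sum z K : bcv (poisson_sum z K).
Proof.
apply: bcvD; apply: bcv_sum => k.
  apply: (bcv_ext (f := fun t => z ^+ k * ek (- k%:Z) t)) => [t|].
    by rewrite zetaJX.
  by apply: bcvZ; exact: bcv_ek.
case: (k == 0%N :> nat); first exact: bcv_cst.
apply: (bcv_ext (f := fun t => z^J ^+ k * ek k%:Z t)) => [t|].
  by rewrite zetaX.
by apply: bcvZ; exact: bcv_ek.
Qed.

Lemma truncE z K f : bcv f -> trunc z K f = E (fun t => f t * poisson_sum z K t).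
Proof.
move=> bf; pose F1 (k : 'I_K) t := z ^+ k * (f t * ek (- k%:Z) t).
pose F2 (k : 'I_K) t := if k == 0%N :> nat then 0 else z^J ^+ k * (f t * ek k%:Z t).
have b1 k : bcv (F1 k) by apply: bcvZ; exact: bcv_coef.
have b2 k : bcv (F2 k).
  by rewrite /F2; case: (k == 0%N :> nat); [exact: bcv_cst|apply: bcvZ; exact: bcv_coef].
rewrite (E_ext (g := fun t => \sum_k F1 k t + \sum_k F2 k t)).
  rewrite ED ?E_sum//; try exact: bcv_sum.
  rewrite /trunc; congr (_ + _); apply: eq_bigr => k _.
    by rewrite EZ//; exact: bcv_coef.
  rewrite /F2; case: (k == 0%N :> nat); first by rewrite E_cst.
  by rewrite EZ ?/coef ?opprK//; exact: bcv_coef.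
move=> t; rewrite /poisson_sum mulrDr !mulr_sumr; congr (_ + _).
  by apply: eq_bigr => k _; rewrite zetaJX /F1 mulrCA.
apply: eq_bigr => k _; rewrite /F2; case: (k == 0%N :> nat); first by rewrite mulr0.
by rewrite zetaX mulrCA.
Qed.

(** The kernel is the sum of two geometric series, in [zeta] and in its conjugate. *)
Lemma poisson_rest z r K t : 0 <= r -> r < 1 -> nsq z <= r ^+ 2 -> (0 < K)%N ->
  nsq ((poisson z t)%:C - poisson_sum z K t) <= (2 * r ^+ K / (1 - r)) ^+ 2.
Proof.
move=> r0 r1 zr K0; set w := zeta z t.
have z1 : nsq z < 1 by rewrite (le_lt_trans zr)// expr_lt1.
have wz : nsq w = nsq z by rewrite nsq_zeta.
have n0 : 0 < nsq (1 - w) by exact: nsq_1zeta_gt0.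
have w1 : 1 - w != 0 by apply: contraTneq n0 => ->; rewrite nsq0 ltxx.
have w1' : 1 - w^J != 0.
  by apply: contraNneq w1 => h; rewrite -(conjcK (1 - w)) conjcD conjc1 conjcN h conjc0.
have gs : \sum_(k < K) w ^+ k = (1 - w)^-1 - w ^+ K / (1 - w).
  apply: (mulIf w1); rewrite mulrBl mulVf// divfK//.
  by have := subrX1 w K; rewrite -(opprB 1 w) mulNr mulrC => /(congr1 -%R);
    rewrite opprB opprK => ->.
have sE : poisson_sum z K t = (\sum_(k < K) w ^+ k)^J + (\sum_(k < K) w ^+ k - 1).
  rewrite /poisson_sum conjc_sum -/w; congr (_ + _).
    by apply: eq_bigr => k _; rewrite conjcX.
  case: (K) K0 => // n _; rewrite !big_ord_recl /= expr0 add0r addrAC subrr add0r.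
  by apply: eq_bigr => k _.
set d := w ^+ K / (1 - w).
have pE : (poisson z t)%:C = (1 - w)^-1 + ((1 - w)^-1)^J - 1.
  have hJ : (1 - w)^J = 1 - w^J by rewrite conjcD conjc1 conjcN.
  rewrite conjc_inv hJ /poisson -/w -wz rmorphM rmorphV ?unitfE ?gt_eqF//=.
  rewrite nsqE hJ rmorphB rmorph1 /= nsqE.
  by field; rewrite w1 w1'.
have -> : (poisson z t)%:C - poisson_sum z K t = (2 * Re d)%:C.
  rewrite sE gs pE -/d.
  have -> : (2 * Re d)%:C = d + d^J.
    by case: (d) => a b; apply: complexP => /=; ring.
  by rewrite conjcD conjcN; ring.
rewrite nsq_real exprMn (_ : (2 * r ^+ K / (1 - r)) ^+ 2 =
  2 ^+ 2 * ((r ^+ K) ^+ 2 / (1 - r) ^+ 2)); last by field; rewrite subr_eq0 gt_eqF.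
rewrite ler_wpM2l ?exprn_ge0//.
apply: (@le_trans _ _ (nsq d)); first by rewrite /nsq lerDl sqr_ge0.
have -> : nsq d = nsq w ^+ K / nsq (1 - w).
  have e1 : nsq d * nsq (1 - w) = nsq (w ^+ K) by rewrite -nsqM /d divfK.
  rewrite -[LHS](mulfK (lt0r_neq0 n0)) e1; congr (_ / _).
  elim: (K) => [|n IH]; first by rewrite !expr0 /nsq /= expr1n expr0n addr0.
  by rewrite !exprS nsqM IH.
have n1r := nsq_1zeta_ge t r0 r1 zr.
apply: ler_pM.
- by rewrite exprn_ge0// nsq_ge0.
- by rewrite invr_ge0 nsq_ge0.
- by rewrite -exprM mulnC exprM wz lerXn2r ?nnegrE ?nsq_ge0 ?exprn_ge0.
- by rewrite lef_pV2 ?posrE// exprn_gt0// subr_gt0.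
Qed.

Lemma Az_trunc z r K f M : 0 <= r -> r < 1 -> nsq z <= r ^+ 2 -> (0 < K)%N ->
  bcv f -> (forall t, nsq (f t) <= M) ->
  nsq (Az z f - trunc z K f) <= M * (2 * r ^+ K / (1 - r)) ^+ 2.
Proof.
move=> r0 r1 zr K0 bf fM.
have z1 : nsq z < 1 by rewrite (le_lt_trans zr)// expr_lt1.
have bp := bcv_poisson z1; have bs := bcv_poisson_sum z K.
rewrite truncE// -EB; [|exact: bcvM|exact: bcvM].
have bd : bcv (fun t => f t * ((poisson z t)%:C - poisson_sum z K t)).
  by apply: bcvM => //; exact: bcvB.
rewrite (E_ext (g := fun t => f t * ((poisson z t)%:C - poisson_sum z K t))); last first.
  by move=> t; rewrite mulrBr.
rewrite (le_trans (nsq_E_le bd))// -[leRHS]Er_cst.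
apply: Er_le => [||t]; [exact: brv_nsq|exact: brv_cst|].
by rewrite nsqM ler_pM ?nsq_ge0// poisson_rest.
Qed.

Lemma expr_small r (e : R) : 0 <= r -> r < 1 -> 0 < e ->
  exists K0, forall K, (K0 <= K)%N -> r ^+ K <= e.
Proof.
move=> r0 r1 e0; have : `|r| < 1 by rewrite ger0_norm.
move=> /cvg_expr /cvgrPdist_le /(_ _ e0)[K0 _ H]; exists K0 => K /H /=.
by rewrite sub0r normrN ger0_norm ?exprn_ge0.
Qed.

Lemma trunc_small r (M e : R) : 0 <= r -> r < 1 -> 0 <= M -> 0 < e ->
  exists K0, forall K, (K0 <= K)%N ->
    (0 < K)%N /\ M * (2 * r ^+ K / (1 - r)) ^+ 2 <= e.
Proof.
move=> r0 r1 M0 e0; have r1' : 0 < 1 - r by rewrite subr_gt0.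
pose c := 4 * (M + 1) / (1 - r) ^+ 2.
have c0 : 0 < c by rewrite divr_gt0 ?exprn_gt0// mulr_gt0// ltr_wpDl.
have [|K0 HK] := @expr_small r (Num.min 1 (e / c)) r0 r1.
  by rewrite lt_min ltr01 divr_gt0.
exists K0.+1 => K K0K; split; first exact: leq_trans K0K.
have := HK K (ltnW K0K); rewrite le_min => /andP[h1 h2].
have rK0 : 0 <= r ^+ K by rewrite exprn_ge0.
apply: (@le_trans _ _ (c * r ^+ K)); last by rewrite mulrC -ler_pdivlMr.
rewrite (_ : M * _ = 4 * M / (1 - r) ^+ 2 * (r ^+ K * r ^+ K)); last first.
  by field; rewrite gt_eqF.
apply: ler_pM.
- by rewrite divr_ge0 ?exprn_ge0 ?(ltW r1')// mulr_ge0.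
- by rewrite mulr_ge0.
- by rewrite /c ler_wpM2r ?invr_ge0 ?exprn_ge0 ?(ltW r1')//; lra.
- by rewrite -[leRHS]mulr1 ler_wpM2l.
Qed.

Lemma Az_eq z f c : nsq z < 1 -> bcv f ->
  (exists K0, forall K, (K0 <= K)%N -> trunc z K f = c) -> Az z f = c.
Proof.
move=> z1 bf [K0 HK]; have [r [r0 r1 zr]] := sqrt_lt1 z1.
have [M fM] := bcv_bound bf.
have M0 : 0 <= M by rewrite (le_trans (nsq_ge0 (f 0)) (fM 0)).
apply/eqP; rewrite -subr_eq0; apply/eqP/nsq_eq0/le_anti; rewrite nsq_ge0 andbT.
apply/ler_addgt0Pr => e e0; rewrite add0r.
have [K1 HK1] := trunc_small r0 r1 M0 e0.
have [Kp He] := HK1 (maxn K0 K1) (leq_maxr _ _).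
rewrite -(HK (maxn K0 K1)) ?leq_maxl//; apply: le_trans He.
by apply: Az_trunc => //; rewrite zr.
Qed.

Lemma Az_mode z (i j : nat) : nsq z < 1 ->
  Az z (ek (i%:Z - j%:Z)) =
    if (j <= i)%N then z ^+ (i - j) else z^J ^+ (j - i).
Proof.
move=> z1; apply: Az_eq => //; first exact: bcv_ek.
exists (i + j).+1 => K HK; rewrite /trunc.
have ce k : coef (ek (i%:Z - j%:Z)) k = (i%:Z - j%:Z == k)%:R :> C.
  rewrite /coef (E_ext (g := ek (i%:Z - j%:Z - k))).
    by rewrite E_ek subr_eq0.
  by move=> t; rewrite -ekD.
case: leqP => ij.
- have iK : (i - j < K)%N by lia.
  have {}ce k : coef (ek (i%:Z - j%:Z)) k = ((i - j)%N%:Z == k)%:R :> C.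
    by rewrite ce subzn.
  rewrite (bigD1 (Ordinal iK))//= ce eqxx mulr1 big1 => [|k ki]; last first.
    rewrite ce eqz_nat (_ : (i - j == k)%N = false) ?mulr0//.
    by apply: contraNF ki => /eqP h; apply/eqP/val_inj.
  rewrite addr0 big1 ?addr0// => k _; case: eqP => // k0.
  by rewrite ce (_ : _ == _ = false) ?mulr0//; apply/eqP; lia.
- have iK : (j - i < K)%N by lia.
  rewrite big1 ?add0r => [|k _]; last first.
    by rewrite ce (_ : _ == _ = false) ?mulr0//; apply/eqP; lia.
  rewrite (bigD1 (Ordinal iK))//= ce (_ : (j - i == 0)%N = false); last by lia.
  rewrite (_ : _ == _ = true) ?mulr1; last by apply/eqP; lia.
  rewrite big1 ?addr0// => k ki; case: eqP => // k0.
  rewrite ce (_ : _ == _ = false) ?mulr0//; apply: contraNF ki => /eqP h.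
  by apply/eqP/val_inj => /=; lia.
Qed.

End Poisson.

(** * Variance for the Poisson kernel *)

Section PoissonVariance.
Context {R : realType}.
Notation C := R[i].
Notation mu := (@lebesgue_measure R).
Implicit Types (f g : R -> C) (z : C) (r s t : R).

Lemma brvM_poisson z (q : R -> R) : nsq z < 1 -> brv q ->
  brv (fun t => q t * poisson z t).
Proof. by move=> z1 bq; apply: brvM => //; exact: brv_poisson. Qed.

Lemma ArD z p q : nsq z < 1 -> brv p -> brv q ->
  Ar z (fun t => p t + q t) = Ar z p + Ar z q.
Proof.
move=> z1 bp bq; rewrite /Ar -ErD; [|exact: brvM_poisson|exact: brvM_poisson].
by congr Er; apply/funext => t; rewrite mulrDl.
Qed.

Lemma ArZ z c q : nsq z < 1 -> brv q -> Ar z (fun t => c * q t) = c * Ar z q.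
Proof.
move=> z1 bq; rewrite /Ar -ErZ; last exact: brvM_poisson.
by congr Er; apply/funext => t; rewrite mulrA.
Qed.

Lemma Ar_le z p q : nsq z < 1 -> brv p -> brv q -> (forall t, p t <= q t) ->
  Ar z p <= Ar z q.
Proof.
move=> z1 bp bq pq; apply: Er_le => [||t]; [exact: brvM_poisson|exact: brvM_poisson|].
by rewrite ler_wpM2r ?poisson_ge0.
Qed.

Lemma Az_real z (q : R -> R) : Az z (fun t => (q t)%:C) = (Ar z q)%:C.
Proof.
rewrite /Az /Ar -E_real; apply: E_ext => t.
by apply: complexP => /=; ring.
Qed.

Lemma Ar_cst z c : nsq z < 1 -> Ar z (fun=> c) = c.
Proof.
move=> z1; rewrite (_ : (fun=> c) = (fun t => c * 1)); last first.
  by apply/funext => t; rewrite mulr1.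
rewrite ArZ//; last exact: brv_cst.
suff -> : Ar z (fun=> 1) = 1 by rewrite mulr1.
apply: (@complexI R); rewrite -Az_real.
have := Az_mode 0 0 z1; rewrite leqnn subnn expr0 => h.
transitivity (1 : C) => //; rewrite -h; congr Az; apply/funext => t.
by rewrite subrr ek0.
Qed.

Lemma AzD z f g : nsq z < 1 -> bcv f -> bcv g ->
  Az z (fun t => f t + g t) = Az z f + Az z g.
Proof.
move=> z1 bf bg; have bp := bcv_poisson z1.
rewrite /Az -ED; [|exact: bcvM|exact: bcvM].
by apply: E_ext => t; rewrite mulrDl.
Qed.

Lemma AzZ z c f : nsq z < 1 -> bcv f -> Az z (fun t => c * f t) = c * Az z f.
Proof.
move=> z1 bf; rewrite /Az -EZ; last by apply: bcvM => //; exact: bcv_poisson.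
by apply: E_ext => t; rewrite mulrA.
Qed.

Lemma Az_cst z c : nsq z < 1 -> Az z (fun=> c) = c.
Proof.
move=> z1; rewrite (_ : (fun=> c) = (fun t => c * (1%:C))); last first.
  by apply/funext => t; rewrite mulr1.
rewrite AzZ//; last exact: bcv_cst.
by rewrite (Az_real z (fun=> 1)) Ar_cst// mulr1.
Qed.

Lemma Az_sum z (I : Type) (s : seq I) (F : I -> R -> C) : nsq z < 1 ->
  (forall i, bcv (F i)) ->
  Az z (fun t => \sum_(i <- s) F i t) = \sum_(i <- s) Az z (F i).
Proof.
move=> z1 bF; rewrite /Az -E_sum => [|i].
  by apply: E_ext => t; rewrite mulr_suml.
by apply: bcvM => //; exact: bcv_poisson.
Qed.

(** The variance of [f] under the probability measure of density [poisson z]. *)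
Definition Var z f : R := Ar z (fun t => nsq (f t - Az z f)).

(** The decomposition of a second moment around [c] into the variance and the
square of the bias: the mean minimizes it. *)
Lemma Ar_nsqB z f c : nsq z < 1 -> bcv f ->
  Ar z (fun t => nsq (f t - c)) = Var z f + nsq (Az z f - c).
Proof.
move=> z1 bf; set m := Az z f.
have bd : bcv (fun t => f t - m) by apply: bcvB => //; exact: bcv_cst.
have bdc : bcv (fun t => (f t - m) * (m - c)^J) by apply: bcvM => //; exact: bcv_cst.
have b2 := brv_nsq bd.
rewrite (_ : (fun t => nsq (f t - c)) = (fun t => nsq (f t - m) +
   (nsq (m - c) + 2 * Re ((f t - m) * (m - c)^J)))); last first.
  apply/funext => t; rewrite addrA -nsqD; congr nsq; ring.
have b3 : brv (fun t => 2 * Re ((f t - m) * (m - c)^J)) by apply: brvZ; case: bdc.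
rewrite ArD//; last by apply: brvD => //; exact: brv_cst.
rewrite ArD//; last exact: brv_cst.
rewrite Ar_cst// ArZ//; last by case: bdc.
suff -> : Ar z (fun t => Re ((f t - m) * (m - c)^J)) = 0 by rewrite mulr0 addr0.
have h0 : Az z (fun t => (f t - m) * (m - c)^J) = 0.
  rewrite (_ : (fun t => _) = (fun t => (m - c)^J * (f t + - m))); last first.
    by apply/funext => t; rewrite mulrC.
  rewrite (AzZ _ z1 bd) (AzD z1 bf (bcv_cst (- m))) Az_cst//.
  by rewrite subrr mulr0.
transitivity (Re (Az z (fun t => (f t - m) * (m - c)^J))); last by rewrite h0.
rewrite /Ar /Az /E /=; congr Er; apply/funext => t.
by case: ((f t - m) * (m - c)^J) => a b /=; ring.
Qed.

Lemma Var_le z f c : nsq z < 1 -> bcv f -> Var z f <= Ar z (fun t => nsq (f t - c)).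
Proof. by move=> z1 bf; rewrite Ar_nsqB// lerDl nsq_ge0. Qed.

Lemma Var_ge0 z f : nsq z < 1 -> bcv f -> 0 <= Var z f.
Proof.
move=> z1 bf; rewrite -(Ar_cst 0 z1); apply: Ar_le => // [||t].
- exact: brv_cst.
- by apply: brv_nsqB.
- exact: nsq_ge0.
Qed.

Lemma Ar_nsq z f : nsq z < 1 -> bcv f ->
  Ar z (fun t => nsq (f t)) = Var z f + nsq (Az z f).
Proof.
move=> z1 bf; have := Ar_nsqB 0 z1 bf; rewrite subr0 => <-.
by congr Ar; apply/funext => t; rewrite subr0.
Qed.

Lemma VarD_le z f g : nsq z < 1 -> bcv f -> bcv g ->
  Var z (fun t => f t + g t) <= 2 * Var z f + 2 * Var z g.
Proof.
move=> z1 bf bg; set a := Az z f; set b := Az z g.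
have b1 := brv_nsqB a bf; have b2 := brv_nsqB b bg.
apply: (le_trans (Var_le (a + b) z1 (bcvD bf bg))).
have e1 := ArZ 2 z1 b1; have e2 := ArZ 2 z1 b2.
have e3 := ArD z1 (brvZ 2 b1) (brvZ 2 b2).
apply: (@le_trans _ _ (Ar z (fun t => 2 * nsq (f t - a) + 2 * nsq (g t - b)))); last first.
  by rewrite e3 e1 e2.
apply: Ar_le => // [||t].
- by apply: brv_nsqB; exact: bcvD.
- by apply: brvD; exact: brvZ.
- by rewrite opprD addrACA; exact: nsqD_le.
Qed.

Lemma nsq_1zeta r th t : nsq (1 - zeta (r%:C * expi th) t) =
  (1 - r) ^+ 2 + 2 * r * (1 - cos (t - th)).
Proof.
rewrite /zeta conjcM conjc_real expiJ -mulrA -expiD (addrC (- th)).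
rewrite /nsq /=; have := cos2Dsin2 (t - th).
move: (cos (t - th)) (sin (t - th)) => c s cs.
have : r ^+ 2 * (c ^+ 2 + s ^+ 2) = r ^+ 2 by rewrite cs mulr1.
by rewrite !expr2; lra.
Qed.

Lemma nsq_polar r th : nsq (r%:C * expi th) = r ^+ 2.
Proof. by rewrite nsqM nsq_expi mulr1 nsq_real. Qed.

Lemma cos_gap (k x : R) : 0 <= k -> k <= 1 -> k <= x -> x <= pi ->
  k ^+ 2 / 8 <= 1 - cos x.
Proof.
move=> k0 k1 kx xpi.
have hk : k / 4 <= sin (k / 2).
  have k2 : 0 <= k / 2 by rewrite divr_ge0.
  have [c /andP[c0 ck] ->] := sin_mvt k2.
  have : 2^-1 <= cos c by have := cos_ge c; rewrite expr2; nra.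
  by nra.
have : cos x <= cos k.
  rewrite leNgt ltr_cos ?in_itv /= -?leNgt//.
  - by rewrite (le_trans k0 kx).
  - by rewrite k0 (le_trans kx).
rewrite (cos_half k); have := sqr_ge0 (sin (k/2)); rewrite !expr2; nra.
Qed.

Lemma cos_gap_abs (k x : R) : 0 <= k -> k <= 1 -> k <= `|x| -> `|x| <= pi ->
  k ^+ 2 / 8 <= 1 - cos x.
Proof. by move=> k0 k1 kx xpi; rewrite -cos_norm; exact: cos_gap. Qed.

(** Outside an arc much longer than [1 - r], the Poisson kernel of radius [r] is
small compared with the kernel of a smaller radius, whose total mass is one. *)
Lemma poisson_tail (K r th t : R) : 1 <= K -> 2^-1 <= r -> r < 1 ->
  K * (1 - r) <= 1 -> K * (1 - r) <= `|t - th| -> `|t - th| <= pi ->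
  poisson (r%:C * expi th) t <=
  20 / K * poisson ((1 - K * (1 - r))%:C * expi th) t.
Proof.
move=> K1 r2 r1 k1 kx xpi; set k := K * (1 - r) in k1 kx *.
have k0 : 0 < k by rewrite mulr_gt0 ?subr_gt0// (lt_le_trans ltr01).
have := cos_gap_abs (ltW k0) k1 kx xpi.
rewrite /poisson !nsq_polar !nsq_1zeta; set y := 1 - cos (t - th) => ky.
have y0 : 0 < y by rewrite (lt_le_trans _ ky)// divr_gt0// exprn_gt0.
have K0 : 0 < K by rewrite (lt_le_trans ltr01).
apply: (@le_trans _ _ (2 * (1 - r) / y)).
  have d0 : 0 < (1 - r) ^+ 2 + 2 * r * y.
    by rewrite ltr_wpDl ?sqr_ge0// mulr_gt0// mulr_gt0//; lra.
  rewrite ler_pdivrMr// mulrAC ler_pdivlMr//.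
  have h : y <= (1 - r) ^+ 2 + 2 * r * y.
    by have := sqr_ge0 (1 - r); nra.
  rewrite (_ : 1 - r ^+ 2 = (1 - r) * (1 + r)); last by ring.
  apply: ler_pM => //.
  - by rewrite mulr_ge0 ?subr_ge0 ?(ltW r1)//; lra.
  - exact: ltW.
  - rewrite mulrC ler_wpM2r ?subr_ge0 ?(ltW r1)//; lra.
have d0 : 0 < (1 - (1 - k)) ^+ 2 + 2 * (1 - k) * y.
  by rewrite ltr_pwDl ?mulr_ge0 ?subr_ge0 ?(ltW y0)// opprB addrC subrK exprn_gt0.
rewrite mulrA ler_pdivlMr//.
have e1 : 1 - (1 - k) = k by ring.
rewrite e1 in d0 *.
have h1 : k ^+ 2 + 2 * (1 - k) * y <= 10 * y.
  by move: ky k0 y0; rewrite !expr2; nra.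
have h2 : k <= 1 - (1 - k) ^+ 2 by rewrite !expr2; nra.
apply: (@le_trans _ _ (2 * (1 - r) / y * (10 * y))).
  rewrite ler_wpM2l// divr_ge0 ?(ltW y0)// mulr_ge0// subr_ge0 ltW//.
rewrite (_ : _ * (10 * y) = 20 / K * k); last first.
  by rewrite /k; field; rewrite !gt_eqF.
by rewrite ler_wpM2l// divr_ge0// ltW.
Qed.

Lemma polar z : nsq z < 1 -> exists r th,
  [/\ 0 <= r, r < 1, nsq z = r ^+ 2 & z = r%:C * expi th].
Proof.
move=> z1; have [r [r0 r1 zr]] := sqrt_lt1 z1.
have [rz|rn] := eqVneq r 0.
  exists 0, 0; rewrite lexx ltr01 zr rz; split=> //.
  by rewrite mul0r; apply: nsq_eq0; rewrite zr rz expr0n.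
pose w := z / r%:C.
have rC : r%:C != 0 :> C by apply: contraNneq rn => /complexI ->.
have zw : z = r%:C * w by rewrite /w mulrC divfK.
have w1 : nsq w = 1.
  have := congr1 nsq zw; rewrite nsqM nsq_real zr => h.
  by apply: (mulfI (expf_neq0 2 rn)); rewrite mulr1 -h.
have [th wE] : exists th, w = expi th.
  move: w1; case: (w) => a b; rewrite /nsq /= => ab.
  have a1 : -1 <= a <= 1.
    by rewrite -ler_norml -(expr_le1 (ltn0Sn 1)) ?normr_ge0// real_normK ?num_real//;
      have := sqr_ge0 b; lra.
  have sa : sin (acos a) = `|b|.
    rewrite sin_acos// -sqrtr_sqr; congr Num.sqrt.
    by rewrite -ab addrC addKr.
  have ca : cos (acos a) = a by rewrite acosK ?in_itv.
  have [b0|/ltW b0] := leP 0 b.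
    by exists (acos a); rewrite /expi ca sa ger0_norm.
  by exists (- acos a); rewrite /expi cosN sinN ca sa ler0_norm// opprK.
by exists r, th; split=> //; rewrite zw wE.
Qed.

End PoissonVariance.

(** * Vanishing variance at the boundary *)

Section VanishingVariance.
Context {R : realType}.
Notation C := R[i].
Notation mu := (@lebesgue_measure R).
Implicit Types (f g : R -> C) (z : C) (r s t th : R).

(** Outside the arc of half length [k] around [th] the function [p] is replaced by
its majorant. *)
Lemma Er_middle (p u : R -> R) th k : brv p -> brv u -> (forall t, 0 <= u t) ->
  0 <= k -> k <= pi ->
  (forall t, k <= `|t - th| -> `|t - th| <= pi -> p t <= u t) ->
  Er p <= Er u + (2 * pi)^-1 * \int[mu]_(t in arc (th - k) (2 * k)) p t.
Proof.
move=> bp bu u0 k0 kpi pu.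
have split3 q : brv q -> \int[mu]_(t in `[0, (2 * pi)%R]) q t =
    \int[mu]_(t in arc (th - pi) (pi - k)) q t +
    (\int[mu]_(t in arc (th - k) (2 * k)) q t +
    \int[mu]_(t in arc (th + k) (pi - k)) q t).
  move=> bq; rewrite -(int_period (th - pi) bq) /arc.
  have -> : th - pi + (pi - k) = th - k by ring.
  have -> : th - k + 2 * k = th + k by ring.
  have -> : th + k + (pi - k) = th - pi + 2 * pi by ring.
  have h1 : th - pi <= th - k by lra.
  have h2 : th - k <= th + k by lra.
  have h3 : th + k <= th - pi + 2 * pi by lra.
  by rewrite (int_split bq h1 (le_trans h2 h3)) (int_split bq h2 h3).
rewrite /Er -mulrDr ler_pM2l ?invr_gt0 ?mulr_gt0 ?pi_gt0//.
rewrite !split3//.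
have h1 : \int[mu]_(t in arc (th - pi) (pi - k)) p t <=
    \int[mu]_(t in arc (th - pi) (pi - k)) u t.
  apply: int_arc_le => // t; rewrite /arc /= in_itv /= => /andP[t1 t2].
  by apply: pu; rewrite ler0_norm; lra.
have h2 : \int[mu]_(t in arc (th + k) (pi - k)) p t <=
    \int[mu]_(t in arc (th + k) (pi - k)) u t.
  apply: int_arc_le => // t; rewrite /arc /= in_itv /= => /andP[t1 t2].
  by apply: pu; rewrite ger0_norm; lra.
have h3 : 0 <= \int[mu]_(t in arc (th - k) (2 * k)) u t.
  rewrite -[leLHS](mul0r (2 * k)) -(int_arc_cst 0 (th - k)) ?mulr_ge0//.
  by apply: int_arc_le => //; exact: brv_cst.
move: h1 h2 h3; set a1 := Rintegral _ _ _; set a2 := Rintegral _ _ _.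
set a3 := Rintegral _ _ _; set a4 := Rintegral _ _ _; set a5 := Rintegral _ _ _.
set a6 := Rintegral _ _ _.
move: a1 a2 a3 a4 a5 a6 => a1 a2 a3 a4 a5 a6; lra.
Qed.

(** The variance is at most the second moment around the mean over the arc of half
length [K (1 - r)].  On the arc the kernel is at most [2 / (1 - r)], which costs a
factor [K] against the normalization of the oscillation; outside the arc the tail is
of order [1 / K]. *)
Lemma Var_arc f M (K r th : R) : bcv f -> (forall t, nsq (f t) <= M) ->
  1 <= K -> 2^-1 <= r -> r < 1 -> K * (1 - r) <= 1 ->
  Var (r%:C * expi th) f <=
    200 * M / K + K * osc2 f (th - K * (1 - r)) (2 * (K * (1 - r))).
Proof.
move=> bf fM K1 r2 r1 k1; set k := K * (1 - r) in k1 *.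
have K0 : 0 < K by rewrite (lt_le_trans ltr01).
have r1' : 0 < 1 - r by rewrite subr_gt0.
have k0 : 0 < k by rewrite mulr_gt0.
have kk0 : 0 < 2 * k by rewrite mulr_gt0.
have r0 : 0 <= r by rewrite (le_trans _ r2)// invr_ge0.
have pi2 : (2 : R) <= pi by exact: pi_ge2.
set z := r%:C * expi th; set c := arc_mean f (th - k) (2 * k).
have z1 : nsq z < 1 by rewrite /z nsq_polar expr_lt1.
have M0 : 0 <= M by rewrite (le_trans (nsq_ge0 (f 0)) (fM 0)).
pose q t := nsq (f t - c).
have bq : brv q by exact: brv_nsqB.
have q0 t : 0 <= q t by exact: nsq_ge0.
have qM t : q t <= 10 * M.
  have := nsqD_le (f t) (- c); rewrite nsqN -/(q t).
  have := arc_mean_bound (th - k) kk0 bf fM; rewrite -/c.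
  by have := fM t; lra.
apply: (le_trans (Var_le c z1 bf)); rewrite -/q.
pose z' : C := (1 - k)%:C * expi th.
have z'1 : nsq z' < 1 by rewrite /z' nsq_polar expr_lt1// ?subr_ge0// ltrBlDr ltrDl.
pose u t := 10 * M * (20 / K) * poisson z' t.
have bu : brv u by apply: brvZ; exact: brv_poisson.
have c0 : 0 <= 10 * M * (20 / K) by rewrite mulr_ge0 ?divr_ge0 ?mulr_ge0// ltW.
have u0 t : 0 <= u t by rewrite mulr_ge0 ?poisson_ge0.
have := @Er_middle (fun t => q t * poisson z t) u th k
  (brvM_poisson z1 bq) bu u0 (ltW k0) _ _.
rewrite -/(Ar z q) => H; apply: (le_trans (H _ _)) => [|t tk tpi|]; first by lra.
  rewrite /u -mulrA ler_pM ?poisson_ge0//.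
  exact: poisson_tail.
apply: lerD.
  rewrite /u ErZ; last exact: brv_poisson.
  have := Ar_cst 1 z'1; rewrite /Ar; under [X in Er X]eq_fun do rewrite mul1r.
  move=> ->; rewrite mulr1; rewrite le_eqVlt; apply/orP; left; apply/eqP; field.
  by rewrite gt_eqF.
have h : \int[mu]_(t in arc (th - k) (2 * k)) (q t * poisson z t) <=
    2 / (1 - r) * \int[mu]_(t in arc (th - k) (2 * k)) q t.
  rewrite -int_arcZ//; apply: int_arc_le => [||t _].
  - exact: brvM_poisson.
  - exact: brvZ.
  - rewrite mulrC ler_wpM2r// (poisson_le _ r0 r1)//.
    by rewrite /z nsq_polar.
have ip : 0 < (2 * pi)^-1 :> R by rewrite invr_gt0 mulr_gt0// pi_gt0.
apply: (@le_trans _ _ ((2 * pi)^-1 * (2 / (1 - r) * (2 * k * osc2 f (th - k) (2 * k))))).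
  rewrite ler_pM2l// (le_trans h)// /osc2 -/c -/q mulVKf ?gt_eqF//.
have o0 := osc2_ge0 f (th - k) kk0.
rewrite (_ : _ * _ = 2 / pi * (K * osc2 f (th - k) (2 * k))); last first.
  move: (osc2 _ _ _) (@pi_gt0 R) => o; move: (pi : R) => p p0.
  by rewrite /k; field; rewrite !gt_eqF.
rewrite -[leRHS]mul1r; apply: ler_wpM2r; first by rewrite mulr_ge0 ?(ltW K0).
by rewrite ler_pdivrMr ?mul1r ?pi_gt0.
Qed.

(** The averages of [f] against the Poisson kernels concentrated at a boundary
point are averages over short arcs up to a kernel tail, so that vanishing mean
oscillation makes the Poisson variance vanish at the boundary. *)
Lemma vmo_Var f (e : R) : bcv f -> vmo f -> 0 < e ->
  exists r0, [/\ 0 < r0, r0 < 1 &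
    forall z, r0 ^+ 2 <= nsq z -> nsq z < 1 -> Var z f <= e].
Proof.
move=> bf vf e0; have [M fM] := bcv_bound bf.
have M0 : 0 <= M by rewrite (le_trans (nsq_ge0 (f 0)) (fM 0)).
pose K := 1 + 400 * M / e.
have K1 : 1 <= K by rewrite lerDl divr_ge0 ?mulr_ge0 ?ler0n ?(ltW e0).
have K0 : 0 < K by rewrite (lt_le_trans ltr01).
have [d d0 H] := vf (e / (2 * K)) (divr_gt0 e0 (mulr_gt0 (ltr0Sn _ 1) K0)).
(* [x] bounds [1 - r]: the half length [K (1 - r)] of the arc is then at most [1] and
   at most [d / 4] *)
pose x := Num.min (2^-1) (Num.min (K^-1) (d / (4 * K))).
have x0 : 0 < x by rewrite !lt_min !invr_gt0 K0 ltr0Sn divr_gt0// mulr_gt0.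
have x2 : x <= 2^-1 by rewrite ge_min lexx.
have xK : K * x <= 1.
  by rewrite mulrC -ler_pdivlMr// mul1r !ge_min lexx orbT.
have xd : K * x <= d / 4.
  rewrite mulrC -ler_pdivlMr// -mulrA -invfM mulrC !ge_min.
  by rewrite (mulrC _ d) lexx !orbT.
exists (1 - x); split; [lra|lra|] => z zx z1.
have [r [th [r0 r1 zr ->]]] := polar z1.
have xr : 1 - x <= r.
  by rewrite -(ler_pXn2r (ltn0Sn 1)) ?nnegrE ?subr_ge0 -?zr//; lra.
have Kr : K * (1 - r) <= K * x by rewrite ler_wpM2l ?(ltW K0)//; lra.
have r1' : 0 < K * (1 - r) by rewrite mulr_gt0 ?subr_gt0.
have pi2 : (2 : R) <= pi by exact: pi_ge2.
apply: (le_trans (Var_arc th bf fM K1 _ r1 (le_trans Kr xK))); first by lra.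
have h1 : 200 * M / K <= e / 2.
  rewrite ler_pdivrMr// /K mulrDr mulr1 (_ : e / 2 * _ = 200 * M); last first.
    by field; rewrite gt_eqF.
  by rewrite lerDr divr_ge0// ltW.
have h2 : K * osc2 f (th - K * (1 - r)) (2 * (K * (1 - r))) <= e / 2.
  rewrite mulrC -ler_pdivlMr// -mulrA -invfM; apply/ltW/H; lra.
move: h1 h2; set a := K * osc2 _ _ _; move: a => a; lra.
Qed.

End VanishingVariance.

(** * Trigonometric polynomials and their harmonic extensions *)

Section TrigonometricPolynomials.
Context {R : realType}.
Notation C := R[i].
Notation CC := {poly {poly C}}.
Implicit Types (f g : R -> C) (z : C) (t : R) (a b : {poly C}).

Definition ptrig a b t : C := ev (expi t) (harm_ext a b).

Lemma ev_harm_ext z a b : ev z (harm_ext a b) = a.[z] + b.[z^J].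
Proof. by rewrite /harm_ext evD evC ev_mapC. Qed.

Lemma expiJX t (n : nat) : (expi t)^J ^+ n = ek (- n%:Z) t.
Proof. by rewrite -conjcX expiX ekJ. Qed.

Lemma ptrigE a b t : ptrig a b t =
  \sum_(i < size a) a`_i * ek i%:Z t + \sum_(j < size b) b`_j * ek (- j%:Z) t.
Proof.
rewrite /ptrig ev_harm_ext !horner_coef; congr (_ + _); apply: eq_bigr => i _.
  by rewrite expiX.
by rewrite expiJX.
Qed.

Lemma bcv_ptrig a b : bcv (ptrig a b).
Proof.
apply: bcv_ext (fun t => esym (ptrigE a b t)) _; apply: bcvD; apply: bcv_sum => i;
  by apply: bcvZ; exact: bcv_ek.
Qed.

Lemma cj_horner a z : (cj a).[z^J] = (a.[z])^J.
Proof. exact: (horner_map (@conjc R)). Qed.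

Lemma ptrigJ a b t : (ptrig a b t)^J = ptrig (cj b) (cj a) t.
Proof.
rewrite /ptrig !ev_harm_ext conjcD -!cj_horner addrC; congr (_ + _).
by rewrite conjcK.
Qed.

Lemma ptrigB a b a' b' t : ptrig (a - a') (b - b') t = ptrig a b t - ptrig a' b' t.
Proof. by rewrite /ptrig !ev_harm_ext !hornerD !hornerN; ring. Qed.

Lemma Az_ptrig z a b : nsq z < 1 -> Az z (ptrig a b) = ev z (harm_ext a b).
Proof.
move=> z1; have -> : ptrig a b = fun t =>
    \sum_(i < size a) a`_i * ek i%:Z t + \sum_(j < size b) b`_j * ek (- j%:Z) t.
  by apply/funext => t; exact: ptrigE.
have bm i c : bcv (fun t => c * ek i t) by apply: bcvZ; exact: bcv_ek.
rewrite AzD//; [|exact: bcv_sum|exact: bcv_sum].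
rewrite !Az_sum// ev_harm_ext !horner_coef; congr (_ + _); apply: eq_bigr => i _.
  rewrite AzZ//; last exact: bcv_ek.
  by have := Az_mode i 0 z1; rewrite subr0 leq0n subn0 => ->.
rewrite AzZ//; last exact: bcv_ek.
have := Az_mode 0 i z1; rewrite sub0r subn0 => ->.
by rewrite leqn0; case: eqP => // ->; rewrite !expr0.
Qed.

(** * The harmonic extension of the squared modulus *)

Lemma D0 : D (0 : CC) = 0.
Proof. by have := @DC R 0; rewrite derivC !polyC0. Qed.

(** The harmonic extension of the mode of index [i - j]. *)
Definition hmode (i j : nat) : CC :=
  if (j <= i)%N then ('X^(i - j))%:P else map_poly polyC 'X^(j - i).

Lemma hmode_harmonic i j : D (Db (hmode i j)) = 0.
Proof.
rewrite /hmode; case: ifP => _; first by rewrite DbC; exact: D0.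
by rewrite D_Db D_mapC; exact: Db0.
Qed.

Lemma star_hmode i j : star (hmode i j) = hmode j i.
Proof.
rewrite /hmode; case: ltngtP => ij.
- by rewrite starC /cj map_polyXn.
- by rewrite star_mapC /cj map_polyXn.
- by rewrite ij subnn expr0 starC /cj !rmorph1.
Qed.

Lemma ev_hmode z i j : ev z (hmode i j) =
  if (j <= i)%N then z ^+ (i - j) else z^J ^+ (j - i).
Proof. by rewrite /hmode; case: ifP => _; rewrite ?evC ?ev_mapC hornerXn. Qed.

Lemma ev_hmode_expi t i j : ev (expi t) (hmode i j) = ek (i%:Z - j%:Z) t.
Proof.
rewrite ev_hmode; case: ifP => ij; first by rewrite expiX -subzn.
by rewrite expiJX -subzn ?opprB//; lia.
Qed.

Lemma ev_sum z (I : Type) (s : seq I) (F : I -> CC) :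
  ev z (\sum_(i <- s) F i) = \sum_(i <- s) ev z (F i).
Proof.
elim: s => [|x s IH]; first by rewrite !big_nil; exact: (ev_cst z 0).
by rewrite !big_cons evD IH.
Qed.

Lemma DDb_sum (I : Type) (s : seq I) (F : I -> CC) :
  (forall i, D (Db (F i)) = 0) -> D (Db (\sum_(i <- s) F i)) = 0.
Proof.
move=> H; elim: s => [|x s IH]; first by rewrite big_nil Db0; exact: D0.
by rewrite big_cons (DbD (F x)) DD H IH addr0.
Qed.

Lemma star_sum (I : Type) (s : seq I) (F : I -> CC) :
  star (\sum_(i <- s) F i) = \sum_(i <- s) star (F i).
Proof.
elim: s => [|x s IH]; first by rewrite !big_nil; exact: star0.
by rewrite !big_cons (starD (F x)) IH.
Qed.

(** For a trigonometric polynomial the Poisson extension of the squared modulus is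
again a polynomial in [z] and its conjugate, so that the Poisson variance is the
defect in the definition of [garsia_le]. *)
Lemma garsia_modes (I : finType) (c : I -> C) (m : I -> nat) (L : int) a b eta2 :
  (forall t, ptrig a b t = \sum_x c x * ek ((m x)%:Z - L) t) ->
  (forall z, nsq z < 1 -> Var z (ptrig a b) <= eta2) -> garsia_le a b eta2.
Proof.
move=> pE hV; pose w x y : CC := cst (c x * (c y)^J) * hmode (m x) (m y).
have DDw x y : D (Db (w x y)) = 0.
  rewrite /w DbM Db_cst mul0r add0r DM D_cst mul0r add0r hmode_harmonic mulr0.
  by [].
have nsqp t : (nsq (ptrig a b t))%:C =
    \sum_x \sum_y (c x * (c y)^J) * ek ((m x)%:Z - (m y)%:Z) t.
  rewrite nsqE pE conjc_sum mulr_suml; apply: eq_bigr => x _.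
  rewrite mulr_sumr; apply: eq_bigr => y _.
  rewrite conjcM ekJ mulrACA -ekD; congr (_ * ek _ t); lia.
exists (\sum_x \sum_y w x y); split.
- by apply: DDb_sum => x; exact: DDb_sum.
- rewrite star_sum exchange_big /=; apply: eq_bigr => y _; rewrite star_sum.
  apply: eq_bigr => x _; rewrite /w starM star_hmode; congr (_ * _).
  by rewrite /cst starC /cj !map_polyC /= conjcM conjcK mulrC.
- move=> t; rewrite -/(ptrig a b t) nsqp ev_sum; apply: eq_bigr => x _.
  rewrite ev_sum; apply: eq_bigr => y _.
  by rewrite /w evM evcst ev_hmode_expi.
move=> z z1; exists (Var z (ptrig a b)).
  by rewrite hV// Var_ge0//; exact: bcv_ptrig.
rewrite -Az_ptrig// addrC -Ar_nsq//; last exact: bcv_ptrig.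
rewrite -Az_real (_ : (fun t => (nsq (ptrig a b t))%:C) = fun t =>
    \sum_x \sum_y (c x * (c y)^J) * ek ((m x)%:Z - (m y)%:Z) t); last first.
  by apply/funext.
have bm k y : bcv (fun t => k * ek y t) by apply: bcvZ; exact: bcv_ek.
rewrite Az_sum// => [|x]; last exact: bcv_sum.
rewrite ev_sum; apply: eq_bigr => x _; rewrite Az_sum// ev_sum.
apply: eq_bigr => y _; rewrite AzZ//; last exact: bcv_ek.
by rewrite Az_mode// /w evM evcst ev_hmode.
Qed.

(** The modes are shifted by the size of [b] to become natural numbers. *)
Lemma garsia_of_Var a b eta2 :
  (forall z, nsq z < 1 -> Var z (ptrig a b) <= eta2) -> garsia_le a b eta2.
Proof.
apply: (@garsia_modes ('I_(size a) + 'I_(size b))%type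
  (fun x => match x with inl i => a`_i | inr j => b`_j end)
  (fun x => match x with inl i => (size b + i)%N | inr j => (size b - j)%N end)
  (size b)%:Z) => t.
rewrite ptrigE big_sumType /=; congr (_ + _); apply: eq_bigr => i _.
  by rewrite PoszD addrC addKr.
congr (_ * ek _ t); have := ltn_ord i; lia.
Qed.

(** * Band-limited functions *)

(** Finite spectrum in [[-d, d]], in the form of Parseval's identity for every
window that contains it: this form is stable under sums and products by modes
without any bookkeeping of coefficients. *)
Definition band (d : nat) f : Prop := bcv f /\
  forall lo n, lo <= - d%:Z -> d%:Z < lo + n%:Z -> bq lo n f = 0.

Lemma band_le d d' f : (d <= d')%N -> band d f -> band d' f.
Proof. by move=> dd [bf H]; split=> // lo n h1 h2; apply: H; lia. Qed.

Lemma bandD d f g : band d f -> band d g -> band d (fun t => f t + g t).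
Proof.
move=> [bf Hf] [bg Hg]; split; first exact: bcvD.
move=> lo n h1 h2; apply/le_anti; rewrite bq_ge0 ?andbT; last exact: bcvD.
by rewrite (le_trans (bqD_le lo n bf bg))// Hf// Hg// mulr0 addr0.
Qed.

Lemma bandZ d z f : band d f -> band d (fun t => z * f t).
Proof.
move=> [bf Hf]; split; first exact: bcvZ.
by move=> lo n h1 h2; rewrite bqZ// Hf// mulr0.
Qed.

Lemma band_ekM d k f : band d f -> band (d + `|k|) (fun t => ek k t * f t).
Proof.
move=> [bf Hf]; split; first by apply: bcvM => //; exact: bcv_ek.
by move=> lo n h1 h2; rewrite bq_ek; apply: Hf; lia.
Qed.

Lemma band_cst z : band 0 (fun=> z).
Proof.
split=> [|lo n h1 h2]; first exact: bcv_cst.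
apply/le_anti; rewrite bq_ge0 ?andbT; last exact: bcv_cst.
rewrite /bq Er_cst subr_le0 /energy.
have ln : (`|lo| < n)%N by lia.
rewrite (bigD1 (Ordinal ln))//= (_ : lo + `|lo|%N = 0); last by lia.
rewrite /coef (E_ext (g := fun=> z)) ?E_cst ?lerDl ?sumr_ge0// => [i _|t].
  exact: nsq_ge0.
by rewrite oppr0 ek0 mulr1.
Qed.

Lemma band_sum d (I : Type) (s : seq I) (F : I -> R -> C) :
  (forall i, band d (F i)) -> band d (fun t => \sum_(i <- s) F i t).
Proof.
move=> H; elim: s => [|x s IH].
  rewrite (_ : (fun t => _) = fun=> 0); last by apply/funext => t; rewrite big_nil.
  by apply: band_le (band_cst 0).
rewrite (_ : (fun t => _) = fun t => F x t + \sum_(i <- s) F i t); last first.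
  by apply/funext => t; rewrite big_cons.
exact: bandD.
Qed.

Lemma band_ek k : band `|k| (ek k).
Proof.
have := band_ekM k (band_cst 1); rewrite add0n; congr band.
by apply/funext => t; rewrite mulr1.
Qed.

Lemma band_ptrig a b : band (size a + size b) (ptrig a b).
Proof.
have -> : ptrig a b = fun t =>
    \sum_(i < size a) a`_i * ek i%:Z t + \sum_(j < size b) b`_j * ek (- j%:Z) t.
  by apply/funext => t; exact: ptrigE.
apply: bandD; apply: band_sum => i; apply: bandZ;
  apply: band_le (band_ek _); have := ltn_ord i; lia.
Qed.

Lemma bandM_tp d f n (c : 'I_n -> C) :
  band d f -> band (d + n) (fun t => f t * tp 0 c t).
Proof.
move=> bf; rewrite (_ : (fun t => _) = fun t =>
    \sum_(j < n) c j * (ek (0 + j%:Z) t * f t)); last first.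
  apply/funext => t; rewrite /tp mulr_sumr; apply: eq_bigr => j _; ring.
apply: band_sum => j; apply: bandZ; apply: band_le (band_ekM _ bf).
by have := ltn_ord j; lia.
Qed.

End TrigonometricPolynomials.

(** * Poisson smoothing *)

Section Smoothing.
Context {R : realType}.
Notation C := R[i].
Implicit Types (f g : R -> C) (z w : C) (r t : R).

Lemma Ar_Re z g : Ar z (fun t => Re (g t)) = Re (Az z g).
Proof. by rewrite /Ar /Az /E /=; congr Er; apply/funext => t; case: (g t) => a b /=; ring. Qed.

Lemma Ar0 (q : R -> R) : Ar 0 q = Er q.
Proof.
rewrite /Ar; congr Er; apply/funext => t.
by rewrite /poisson /zeta conjc0 mul0r subr0 nsq0 subr0 /nsq /= expr0n /= addr0
  expr1n divr1 mulr1.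
Qed.

(** Young's inequality with weight [d] for the cross term. *)
Lemma nsq_close (d M : R) (x y : C) : 0 < d -> d <= 1 ->
  nsq (x - y) <= d ^+ 2 -> nsq y <= M ->
  nsq x <= nsq y + d * (M + 2) /\ nsq y <= nsq x + d * (M + 2).
Proof.
move=> d0 d1; set e := x - y => ed yM.
have -> : nsq x = nsq y + (nsq e + 2 * Re (e * y^J)).
  by rewrite addrCA addrA -nsqD /e subrK.
have d2 : d ^+ 2 <= d by rewrite expr2 -[leRHS]mul1r ler_wpM2r// ltW.
have aux P : 0 <= d ^+ 2 * nsq y + nsq e - d * P -> P <= d * (M + 1).
  have : d ^+ 2 * nsq y <= d ^+ 2 * M by rewrite ler_wpM2l ?sqr_ge0.
  move: ed; move: (nsq e) (nsq y) => ee yy ed h h'.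
  by rewrite -(ler_pM2l d0) mulrA -expr2 mulrDr mulr1; lra.
have h1 : 2 * Re (e * y^J) <= d * (M + 1).
  apply: aux; have := nsq_ge0 (d%:C * y - e).
  by case: (e) (y) => p q [u v]; rewrite /nsq /= !expr2; lra.
have h2 : - (2 * Re (e * y^J)) <= d * (M + 1).
  apply: aux; have := nsq_ge0 (d%:C * y + e).
  by case: (e) (y) => p q [u v]; rewrite /nsq /= !expr2; lra.
have := nsq_ge0 e; move: (nsq e) (Re _) h1 h2 ed => ee X; lra.
Qed.

Lemma trunc_unif f r d : bcv f -> 0 <= r -> r < 1 -> 0 < d ->
  exists K0, forall K, (K0 <= K)%N -> forall w, nsq w <= r ^+ 2 ->
    nsq (trunc w K f - Az w f) <= d ^+ 2.
Proof.
move=> bf r0 r1 d0; have [M fM] := bcv_bound bf.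
have M0 : 0 <= M by rewrite (le_trans (nsq_ge0 (f 0)) (fM 0)).
have [K0 H] := trunc_small r0 r1 M0 (exprn_gt0 2 d0).
exists K0 => K /H [Kp He] w wr; rewrite -nsqN opprB.
exact: le_trans (Az_trunc r0 r1 wr Kp bf fM) He.
Qed.

(** * Partial sums of the Poisson extension as trigonometric polynomials *)

Definition apoly r K f := \poly_(i < K) (r%:C ^+ i * coef f i%:Z).
Definition bpoly r K f :=
  \poly_(i < K) (if i == 0%N then 0 else r%:C ^+ i * coef f (- i%:Z)).

Lemma ev_smooth z r K f :
  ev z (harm_ext (apoly r K f) (bpoly r K f)) = trunc (r%:C * z) K f.
Proof.
rewrite ev_harm_ext !horner_poly /trunc conjcM conjc_real.
congr (_ + _); apply: eq_bigr => i _; first by rewrite exprMn mulrAC.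
by case: eqP => _; rewrite ?mul0r// exprMn mulrAC.
Qed.

Definition smooth r K f : R -> C := ptrig (apoly r K f) (bpoly r K f).

Lemma smoothE r K f t : smooth r K f t = trunc (r%:C * expi t) K f.
Proof. by rewrite /smooth /ptrig ev_smooth. Qed.

Lemma Az_smooth z r K f : nsq z < 1 -> Az z (smooth r K f) = trunc (r%:C * z) K f.
Proof. by move=> z1; rewrite Az_ptrig// ev_smooth. Qed.

Lemma nsq_Az_le z f : nsq z < 1 -> bcv f -> nsq (Az z f) <= Ar z (fun t => nsq (f t)).
Proof. by move=> z1 bf; rewrite Ar_nsq// lerDr Var_ge0. Qed.

(** Averages of [f] and of its squared modulus are replaced by partial sums up to
[e], uniformly on the disc of radius [r].  Partial sums are trigonometric
polynomials on each circle, whose Poisson averages are exact evaluations: this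
takes the place of the semigroup property of the Poisson kernel. *)
Lemma nsq_smooth f r e : bcv f -> 0 <= r -> r < 1 -> 0 < e ->
  exists K0, forall K, (K0 <= K)%N -> [/\
    (forall w, nsq w <= r ^+ 2 -> nsq (trunc w K f) <= nsq (Az w f) + e),
    (forall w, nsq w <= r ^+ 2 -> nsq (Az w f) <= nsq (trunc w K f) + e),
    (forall w, nsq w <= r ^+ 2 -> Ar w (fun t => nsq (f t)) <=
       Re (trunc w K (fun t => (nsq (f t))%:C)) + e) &
    (forall w, nsq w <= r ^+ 2 ->
       Re (trunc w K (fun t => (nsq (f t))%:C)) <=
       Ar w (fun t => nsq (f t)) + e)].
Proof.
move=> bf r0 r1 e0; have [M fM] := bcv_bound bf.
have M0 : 0 <= M by rewrite (le_trans (nsq_ge0 (f 0)) (fM 0)).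
have M2 : 0 < M + 2 by rewrite ltr_wpDl.
pose d := Num.min 1 (e / (M + 2)).
have d0 : 0 < d by rewrite lt_min ltr01 divr_gt0.
have d1 : d <= 1 by rewrite ge_min lexx.
have de : d * (M + 2) <= e by rewrite -ler_pdivlMr// ge_min lexx orbT.
have bu := bcv_real (brv_nsq bf).
have [K1 H1] := trunc_unif bf r0 r1 d0.
have [K2 H2] := trunc_unif bu r0 r1 d0.
have AM w : nsq w <= r ^+ 2 -> nsq (Az w f) <= M.
  move=> wr; have w1 : nsq w < 1 by rewrite (le_lt_trans wr)// expr_lt1.
  rewrite (le_trans (nsq_Az_le w1 bf))// -[leRHS](Ar_cst M w1).
  by apply: Ar_le => //; [exact: brv_nsq|exact: brv_cst].
have d_e : d <= e.
  by apply: le_trans de; rewrite -[leLHS]mulr1 ler_wpM2l ?(ltW d0)//; lra.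
exists (maxn K1 K2) => K; rewrite geq_max => /andP[K1K K2K].
have F w : nsq w <= r ^+ 2 -> `|Re (trunc w K (fun t => (nsq (f t))%:C)) -
    Ar w (fun t => nsq (f t))| <= e.
  move=> /(H2 _ K2K); rewrite Az_real; set T := trunc _ _ _; set a := Ar _ _.
  move=> h; apply: le_trans d_e; rewrite -(ler_pXn2r (ltn0Sn 1)) ?nnegrE ?(ltW d0)//.
  rewrite real_normK ?num_real//; apply: le_trans h.
  by case: (T) => x y; rewrite /nsq /= lerDl sqr_ge0.
split=> w wr.
- have [h _] := nsq_close d0 d1 (H1 _ K1K _ wr) (AM _ wr).
  by apply: (le_trans h); rewrite lerD2l.
- have [_ h] := nsq_close d0 d1 (H1 _ K1K _ wr) (AM _ wr).
  by apply: (le_trans h); rewrite lerD2l.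
- by have := F _ wr; rewrite ler_norml; lra.
- by have := F _ wr; rewrite ler_norml; lra.
Qed.

(** By Jensen's inequality the squared modulus of the smoothed function is at most
the smoothed squared modulus; the average at [z] turns the latter into the average
at [r z] of [|f|^2], while the averages of the two functions agree up to [e]. *)
Lemma Var_smooth f r e : bcv f -> 0 <= r -> r < 1 -> 0 < e ->
  exists K0, forall K, (K0 <= K)%N -> forall z, nsq z < 1 ->
    Var z (smooth r K f) <= Var (r%:C * z) f + e.
Proof.
move=> bf r0 r1 e0; have e4 : 0 < e / 4 by rewrite divr_gt0.
have [K0 H] := nsq_smooth bf r0 r1 e4; exists K0 => K /H[h1 h2 h3 h4] z z1.
set u := fun t => (nsq (f t))%:C in h3 h4.
have bp := bcv_ptrig (apoly r K f) (bpoly r K f).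
have bU := bcv_ptrig (apoly r K u) (bpoly r K u).
have wr t : nsq (r%:C * expi t) <= r ^+ 2 by rewrite nsq_polar.
have zr : nsq (r%:C * z) <= r ^+ 2.
  by rewrite nsqM nsq_real -[leRHS]mulr1 ler_wpM2l ?sqr_ge0 ?ltW.
have rz1 : nsq (r%:C * z) < 1 by rewrite (le_lt_trans zr)// expr_lt1.
have w1 t : nsq (r%:C * expi t) < 1 by rewrite nsq_polar expr_lt1.
have bU1 : brv (fun t => Re (smooth r K u t)) := bU.1.
have bc := brv_cst (e / 4 + e / 4).
have step : Ar z (fun t => nsq (smooth r K f t)) <=
    Re (trunc (r%:C * z) K u) + (e / 4 + e / 4).
  rewrite -(Az_smooth _ _ _ z1) -Ar_Re -(Ar_cst (e / 4 + e / 4) z1) -(ArD z1 bU1 bc).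
  have b2 : brv (fun t => nsq (smooth r K f t)) := brv_nsq bp.
  apply: (Ar_le z1 b2 (brvD bU1 bc)) => t; rewrite !smoothE.
  rewrite (le_trans (h1 _ (wr t)))// addrA lerD2r.
  by rewrite (le_trans (nsq_Az_le (w1 t) bf))// h3.
have e1 := Ar_nsq z1 bp; have e2 := Ar_nsq rz1 bf.
rewrite -/(smooth r K f) (Az_smooth _ _ _ z1) in e1.
have := h2 _ zr; have := h4 _ zr; move: step e1 e2.
set A1 := Ar _ _; set A2 := Ar _ _; move: A1 A2 => A1 A2.
set V1 := Var _ _; set V2 := Var _ _; move: V1 V2 => V1 V2.
set N1 := nsq _; set N2 := nsq _; move: N1 N2 => N1 N2.
set T := Re _; move: T => T; lra.
Qed.

(** * Distance to the partial sums in the mean *)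

Lemma coef_two_sided (al be : nat -> C) K : be 0%N = 0 ->
  let p t := \sum_(i < K) al i * ek i%:Z t + \sum_(j < K) be j * ek (- j%:Z) t in
  (forall i, (i < K)%N -> coef p i%:Z = al i) /\
  (forall j, (0 < j < K)%N -> coef p (- j%:Z) = be j).
Proof.
move=> be0 p.
have bm c k : bcv (fun t => c * ek k t) by apply: bcvZ; exact: bcv_ek.
have ce k l : coef (ek k) l = (k == l)%:R :> C.
  rewrite /coef (E_ext (g := ek (k - l))); first by rewrite E_ek subr_eq0.
  by move=> t; rewrite -ekD.
have cs (c : nat -> C) (F : nat -> int) l :
    coef (fun t => \sum_(i < K) c i * ek (F i) t) l =
    \sum_(i < K) c i * (F i == l)%:R.
  rewrite /coef (E_ext (g := fun t => \sum_(i < K) c i * (ek (F i) t * ek (- l) t))).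
    rewrite E_sum => [|i]; last by apply: bcvZ; apply: bcv_coef; exact: bcv_ek.
    apply: eq_bigr => i _; rewrite EZ; last by apply: bcv_coef; exact: bcv_ek.
    by rewrite -/(coef _ l) ce.
  by move=> t; rewrite mulr_suml; apply: eq_bigr => i _; rewrite mulrA.
have cp l : coef p l = \sum_(i < K) al i * (i%:Z == l)%:R
    + \sum_(i < K) be i * (- i%:Z == l)%:R.
  by rewrite /p fcoefD ?(cs al Posz) ?(cs be (fun i => - i%:Z))//; exact: bcv_sum.
split=> [i iK|j /andP[j0 jK]]; rewrite cp.
- rewrite (bigD1 (Ordinal iK))//= eqxx mulr1 big1 => [|k ki]; last first.
    rewrite (_ : _ == _ = false) ?mulr0//; apply: contraNF ki => /eqP[h].
    exact/eqP/val_inj.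
  rewrite addr0 big1 ?addr0// => k _; case: (eqVneq (k : nat) 0%N) => [->|k0].
    by rewrite be0 mul0r.
  by rewrite (_ : _ == _ = false) ?mulr0//; apply/eqP; lia.
- rewrite big1 ?add0r => [|k _]; last first.
    by rewrite (_ : _ == _ = false) ?mulr0//; apply/eqP; lia.
  rewrite (bigD1 (Ordinal jK))//= eqxx mulr1 big1 ?addr0// => k ki.
  rewrite (_ : _ == _ = false) ?mulr0//; apply: contraNF ki => /eqP h.
  by apply/eqP/val_inj => /=; lia.
Qed.

(** The partial sums [p] contract every Fourier coefficient of [f] by a factor in
[[0, 1]], so that [f - p] and [p] have a nonnegative inner product. *)
Lemma Er_nsqB_smooth f r K : bcv f -> 0 <= r -> r <= 1 ->
  Er (fun t => nsq (f t - smooth r K f t)) <=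
  Er (fun t => nsq (f t)) - Er (fun t => nsq (smooth r K f t)).
Proof.
move=> bf r0 r1; set p := smooth r K f.
have bp : bcv p by exact: bcv_ptrig.
have bd : bcv (fun t => f t - p t) by exact: bcvB.
have -> : Er (fun t => nsq (f t)) = Er (fun t => nsq (f t - p t + p t)).
  by congr Er; apply/funext => t; rewrite subrK.
rewrite (Er_nsqD bd bp) addrAC addrK lerDl mulr_ge0//.
pose al (i : nat) := r%:C ^+ i * coef f i%:Z.
pose be (i : nat) := if i == 0%N then 0 else r%:C ^+ i * coef f (- i%:Z).
have be0 : be 0%N = 0 by [].
have pE : p = fun t => \sum_(i < K) al i * ek i%:Z t + \sum_(j < K) be j * ek (- j%:Z) t.
  apply/funext => t; rewrite /p smoothE /trunc conjcM conjc_real.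
  congr (_ + _); apply: eq_bigr => i _.
    by rewrite exprMn expiX mulrAC.
  by rewrite /be; case: eqP => _; rewrite ?mul0r// exprMn expiJX mulrAC.
have [ca cb] := @coef_two_sided al be K be0; rewrite -pE in ca cb.
have bm c k : bcv (fun t => c * ((f t - p t) * ek k t)).
  by apply: bcvZ; apply: bcvM => //; exact: bcv_ek.
have -> : E (fun t => (f t - p t) * (p t)^J) =
    \sum_(i < K) (al i)^J * (coef f i%:Z - coef p i%:Z) +
    \sum_(j < K) (be j)^J * (coef f (- j%:Z) - coef p (- j%:Z)).
  rewrite (E_ext (g := fun t =>
    \sum_(i < K) (al i)^J * ((f t - p t) * ek (- i%:Z) t) +
    \sum_(j < K) (be j)^J * ((f t - p t) * ek (- - j%:Z) t))); last first.
    move=> t; rewrite {2}pE conjcD !conjc_sum mulrDr !mulr_sumr.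
    by congr (_ + _); apply: eq_bigr => i _; rewrite conjcM ekJ mulrCA.
  rewrite ED; [|exact: bcv_sum|exact: bcv_sum].
  have cB k : E (fun t => (f t - p t) * ek (- k) t) = coef f k - coef p k.
    rewrite /coef -EB; [|exact: bcv_coef|exact: bcv_coef].
    by apply: E_ext => t; rewrite mulrBl.
  rewrite !E_sum//; congr (_ + _); apply: eq_bigr => i _;
    by rewrite EZ ?cB//; apply: bcvM => //; exact: bcv_ek.
have term (n : nat) (c : C) : 0 <= Re ((r%:C ^+ n * c)^J * (c - r%:C ^+ n * c)).
  rewrite -rmorphXn /=; case: c => x y /=.
  have rn0 : 0 <= r ^+ n by rewrite exprn_ge0.
  have rn1 : r ^+ n <= 1 by rewrite exprn_ile1.
  move: (r ^+ n) rn0 rn1 => s s0 s1.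
  rewrite [leRHS](_ : _ = s * (1 - s) * (x ^+ 2 + y ^+ 2)); last by ring.
  by rewrite mulr_ge0 ?addr_ge0 ?sqr_ge0// mulr_ge0// subr_ge0.
rewrite cReD !cRe_sum addr_ge0// sumr_ge0// => i _.
  by rewrite ca// /al.
rewrite /be; case: (posnP i) => [->|i0]; first by rewrite conjc0 mul0r.
by rewrite cb ?i0 ?ltn_ord// /be (gtn_eqF i0).
Qed.

(** The mean of the pointwise variance on the circle of radius [r] is
[E |f|^2 - E |F|^2], with [F] the smoothed function. *)
Lemma L2_smooth f r S e : bcv f -> 0 <= r -> r < 1 -> 0 < e ->
  (forall z, nsq z = r ^+ 2 -> Var z f <= S) ->
  exists K0, forall K, (K0 <= K)%N ->
    Er (fun t => nsq (f t - smooth r K f t)) <= S + e.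
Proof.
move=> bf r0 r1 e0 HS; have e3 : 0 < e / 3 by rewrite divr_gt0.
have [K0 H] := nsq_smooth bf r0 r1 e3; exists K0 => K /H[h1 h2 h3 h4].
set u := fun t => (nsq (f t))%:C in h3 h4.
have bp := bcv_ptrig (apoly r K f) (bpoly r K f).
have bU := bcv_ptrig (apoly r K u) (bpoly r K u).
have wr t : nsq (r%:C * expi t) <= r ^+ 2 by rewrite nsq_polar.
have w1 t : nsq (r%:C * expi t) < 1 by rewrite nsq_polar expr_lt1.
have z1 : nsq (0 : C) < 1 by rewrite nsq0.
apply: (le_trans (Er_nsqB_smooth K bf r0 (ltW r1))).
have h0 : Er (fun t => nsq (f t)) <= Er (fun t => Re (smooth r K u t)) + e / 3.
  rewrite -!Ar0 Ar_Re Az_smooth// mulr0 h3// nsq0 sqr_ge0//.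
suff : Er (fun t => Re (smooth r K u t)) <=
    Er (fun t => nsq (smooth r K f t)) + (S + (e / 3 + e / 3)).
  by move: h0; set A := Er _; set B := Er _; set D := Er _;
    move: A B D => A B D; lra.
have b2 : brv (fun t => nsq (smooth r K f t)) := brv_nsq bp.
have bU1 : brv (fun t => Re (smooth r K u t)) := bU.1.
have bc := brv_cst (S + (e / 3 + e / 3)).
rewrite -[X in _ + X]Er_cst -(ErD b2 bc); apply: (Er_le bU1 (brvD b2 bc)) => t.
rewrite !smoothE; have := h4 _ (wr t); rewrite Ar_nsq//.
have := h2 _ (wr t); have := HS _ (nsq_polar r t).
set V := Var _ _; set N1 := nsq _; set N2 := nsq _; set T := Re _.
move: V N1 N2 T => V N1 N2 T; lra.
Qed.

(** * Approximation by trigonometric polynomials *)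

Lemma poisson_le_center z r t : 0 < r -> r < 1 -> nsq z <= r -> poisson z t <= 4 / (1 - r).
Proof.
move=> r0 r1 zr; have z1 : nsq z < 1 by rewrite (le_lt_trans zr).
have [s [s0 s1 zs]] := sqrt_lt1 z1.
apply: (le_trans (poisson_le t s0 s1 zs)).
rewrite ler_pdivrMr ?subr_gt0// mulrAC ler_pdivlMr ?subr_gt0//.
rewrite zs in zr; have := sqr_ge0 (1 - s); move: zr; rewrite !expr2; lra.
Qed.

Lemma Var_le_center z r f : 0 < r -> r < 1 -> nsq z <= r -> bcv f ->
  Var z f <= 4 / (1 - r) * Er (fun t => nsq (f t)).
Proof.
move=> r0 r1 zr bf; have z1 : nsq z < 1 by rewrite (le_lt_trans zr).
apply: (le_trans (Var_le 0 z1 bf)); rewrite /Ar -ErZ; last exact: brv_nsq.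
apply: Er_le => [||t].
- by apply: brvM_poisson => //; exact: brv_nsqB.
- by apply: brvZ; exact: brv_nsq.
- by rewrite subr0 mulrC ler_wpM2r ?nsq_ge0// poisson_le_center.
Qed.

Lemma Var_opp z f : nsq z < 1 -> bcv f -> Var z (fun t => - f t) = Var z f.
Proof.
move=> z1 bf; have e0 : (fun t => - f t) = (fun t => -1 * f t).
  by apply/funext => t; rewrite mulN1r.
rewrite /Var e0 AzZ// mulN1r; congr Ar; apply/funext => t.
by rewrite ?mulN1r -opprD nsqN.
Qed.

Lemma Var_conj z f : nsq z < 1 -> bcv f -> Var z (fun t => (f t)^J) = Var z f.
Proof.
move=> z1 bf; have e0 : Az z (fun t => (f t)^J) = (Az z f)^J.
  rewrite /Az -EJ; last by apply: bcvM => //; exact: bcv_poisson.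
  by apply: E_ext => t; rewrite conjcM conjc_real.
rewrite /Var e0; congr Ar; apply/funext => t.
by rewrite -conjcN -conjcD nsqJ.
Qed.

Lemma bcv_smooth r K f : bcv (smooth r K f).
Proof. exact: bcv_ptrig. Qed.

Lemma smooth_ptrig r K f : smooth r K f = ptrig (apoly r K f) (bpoly r K f).
Proof. by []. Qed.

(* from here on smoothed functions are compared by their parameters *)
#[local] Opaque smooth ptrig apoly bpoly.

(** Differences of partial sums of large radii have small variance at every point
of the disc: near the boundary each of the two has, and in a fixed smaller disc
their difference is small in the mean. *)
Lemma vmo_approx f eta2 : bcv f -> vmo f -> 0 < eta2 ->
  exists a0 b0 : {poly C}, forall tau : R, 0 < tau -> exists a b : {poly C},
  [/\ garsia_le a b eta2, garsia_le (cj b) (cj a) eta2 &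
      Er (fun t => nsq (f t - ptrig a0 b0 t - ptrig a b t)) <= tau].
Proof.
move=> bf vf e0; have e8 : 0 < eta2 / 8 by rewrite divr_gt0.
(* [rho] separates the two regions; [sg] is small with respect to the bound
   [4 / (1 - rho)] on the kernels of the inner region *)
have [rho [rho0 rho1 Hrho]] := vmo_Var bf vf e8.
have rho1' : 0 < 1 - rho by rewrite subr_gt0.
pose sg := (1 - rho) * eta2 / 32.
have sg0 : 0 < sg by rewrite divr_gt0// mulr_gt0.
have alg1 (u v w : C) : v + - w = (u - w) + - (u - v) by ring.
have alg2 (u v w : C) : u - w - (v + - w) = u - v by ring.
have quarter x y : x <= eta2 / 4 -> y <= eta2 / 4 -> 2 * x + 2 * y <= eta2.
  by move=> *; lra.
have four x y : x <= sg -> y <= sg -> 2 * x + 2 * y <= 4 * sg.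
  by move=> *; lra.
have center x : x <= 4 * sg -> 4 / (1 - rho) * x <= eta2.
  move=> hx; rewrite mulrAC ler_pdivrMr//.
  have : 4 * (4 * sg) <= eta2 * (1 - rho) by rewrite /sg; nra.
  by lra.
(* radii at least [(1 + rho) / 2] have a square at least [rho], so that [r z] stays
   in the region where the variance is small when [|z|^2 >= rho] *)
have small_radius s : 0 < s -> exists2 r, 0 <= r < 1 & (1 + rho) / 2 <= r /\
    forall z, nsq z = r ^+ 2 -> Var z f <= s.
  move=> s0; have [r1 [r10 r11 Hr]] := vmo_Var bf vf s0.
  exists (Num.max r1 ((1 + rho) / 2)).
    by rewrite le_max (ltW r10)/= gt_max r11/=; lra.
  split=> [|z zr]; first by rewrite le_max lexx orbT.
  apply: Hr; rewrite zr.
    by rewrite ler_pXn2r ?nnegrE ?le_max ?(ltW r10) ?lexx.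
  by rewrite expr_lt1 ?le_max ?(ltW r10)// gt_max r11/=; lra.
have approx s : 0 < s -> exists r K, [/\ 0 <= r, r < 1,
    (forall z, nsq z < 1 -> rho <= nsq z -> Var z (smooth r K f) <= eta2 / 4) &
    Er (fun t => nsq (f t - smooth r K f t)) <= s].
  move=> s0; have s2 : 0 < s / 2 by rewrite divr_gt0.
  have [r /andP[r0 r1] [rr Hr]] := small_radius _ s2.
  have [K1 H1] := Var_smooth bf r0 r1 e8.
  have [K2 H2] := L2_smooth bf r0 r1 s2 Hr.
  exists r, (maxn K1 K2); split=> // [z z1 rz|].
    apply: (le_trans (H1 _ (leq_maxl _ _) z z1)).
    have h : Var (r%:C * z) f <= eta2 / 8.
      have n0 := nsq_ge0 z.
      have r2 : rho <= r ^+ 2.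
        have : ((1 + rho) / 2) ^+ 2 <= r ^+ 2.
          by rewrite ler_pXn2r ?nnegrE//; lra.
        by have := sqr_ge0 (1 - rho); rewrite !expr2; lra.
      have r21 : r ^+ 2 <= 1 by rewrite expr_le1 ?(ltW r1).
      apply: Hrho; rewrite nsqM nsq_real.
        by rewrite expr2 ler_pM ?(ltW rho0).
      by rewrite (le_lt_trans _ z1)// ler_piMl.
    by lra.
  by apply: (le_trans (H2 _ (leq_maxr _ _))); lra.
have [r [K [r0 r1 V0 L0]]] := approx sg sg0.
exists (apoly r K f), (bpoly r K f) => tau tau0.
have m0 : 0 < Num.min tau sg by rewrite lt_min tau0.
have [r' [K' [r'0 r'1 V1 L1]]] := approx _ m0.
have [mt ms] : Num.min tau sg <= tau /\ Num.min tau sg <= sg.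
  by rewrite !ge_min !lexx orbT.
have L1' := le_trans L1 ms; have {L1 ms} L1 := le_trans L1 mt.
exists (apoly r' K' f - apoly r K f), (bpoly r' K' f - bpoly r K f).
set p := ptrig (_ - _) (_ - _).
have pE : p = fun t => smooth r' K' f t + - smooth r K f t.
  by apply/funext => t; rewrite /p ptrigB -!smooth_ptrig.
have bp : bcv p by exact: bcv_ptrig.
have bs s L : bcv (smooth s L f) := bcv_smooth s L f.
have Vp z : nsq z < 1 -> Var z p <= eta2.
  move=> z1; have [zr|zr] := leP rho (nsq z).
    rewrite pE (le_trans (VarD_le z1 (bs _ _) (bcvN (bs _ _))))//.
    rewrite (Var_opp z1 (bs r K)); apply: quarter; first exact: V1.
    exact: V0.
  apply: (le_trans (Var_le_center rho0 rho1 (ltW zr) bp)); apply: center.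
  have -> : (fun t => nsq (p t)) =
      (fun t => nsq ((f t - smooth r K f t) + - (f t - smooth r' K' f t))).
    by apply/funext => t; rewrite pE (alg1 (f t)).
  have bd s L : bcv (fun t => f t - smooth s L f t) by exact: bcvB.
  apply: (le_trans (Er_nsqD_le (bd _ _) (bcvN (bd _ _)))).
  have -> : (fun t => nsq (- (f t - smooth r' K' f t))) =
      (fun t => nsq (f t - smooth r' K' f t)).
    by apply/funext => t; rewrite nsqN.
  exact (four _ _ L0 L1').
split.
- exact: garsia_of_Var.
- apply: garsia_of_Var => z z1.
  have -> : ptrig (cj (bpoly r' K' f - bpoly r K f)) (cj (apoly r' K' f - apoly r K f))
      = fun t => (p t)^J by apply/funext => t; rewrite /p ptrigJ.
  by rewrite Var_conj// Vp.
- apply: le_trans L1; rewrite le_eqVlt; apply/orP; left; apply/eqP; congr Er.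
  apply/funext => t /=; rewrite -smooth_ptrig -/p pE.
  by rewrite (alg2 (f t)).
Qed.

End Smoothing.

(** * Energy outside the window *)

Section HankelEnergy.
Context {R : realType}.
Notation C := R[i].
Notation CC := {poly {poly C}}.
Implicit Types (f g h : R -> C) (a b F : {poly C}).

(** Only the modes of [p] of negative index pair with an analytic polynomial that
vanishes at the origin. *)
Lemma E_ptrig_horner a b F : F`_0 = 0 ->
  E (fun t => ptrig a b t * F.[expi t]) = \sum_(i < size F) b`_i.+1 * F`_i.+1.
Proof.
move=> F0; pose W := harm_ext a b * F%:P.
have Wd i : W`_i`_i = b`_i * F`_i.
  rewrite /W /harm_ext mulrDl !coefD coef_mapCM -polyCM coefC.
  case: eqP => [->|_]; last by rewrite coef0 add0r.
  by rewrite coef0M F0 !mulr0 addr0.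
have dW : diag_below (size F).+1 W.
  by move=> i hi; rewrite Wd (nth_default _ (ltnW hi)) mulr0.
have <- : E (fun t => ev (1%:C * expi t) W) = E (fun t => ptrig a b t * F.[expi t]).
  by apply: E_ext => t; rewrite mul1r /W evM evC.
rewrite (trace_circle 1 dW) big_ord_recl Wd F0 mulr0 mul0r add0r.
by apply: eq_bigr => i _; rewrite !expr1n mulr1 Wd.
Qed.

Lemma tp_poly n (c : 'I_n -> C) (m : 'I_n -> nat) t :
  (\sum_(i < n) c i *: 'X^(m i)).[expi t] = \sum_(i < n) c i * ek (m i)%:Z t.
Proof.
by rewrite horner_sum; apply: eq_bigr => i _; rewrite hornerZ hornerXn expiX.
Qed.

(** The energy of [p X] in the modes of negative index is the value at the product
of [X] with the conjugate of that part of [p X] of a Hankel form of [p]. *)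
Lemma neg_energy n (c : 'I_n -> C) a b (eta2 : R) K : 0 < eta2 ->
  garsia_le a b eta2 ->
  energy (- K%:Z) K (fun t => ptrig a b t * tp 0 c t) <=
    16 * eta2 * \sum_(i < n) nsq (c i).
Proof.
move=> e0 hab; set q := fun t => _.
have bq' : bcv q by apply: bcvM; [exact: bcv_ptrig|exact: bcv_tp].
pose d (j : 'I_K) := coef q (- K%:Z + j%:Z).
pose S := \sum_(j < K) nsq (d j); rewrite -[energy _ _ _]/S.
pose u := \sum_(i < n) c i *: 'X^i.
pose v := \sum_(j < K) (d j)^J *: 'X^(K - j).
have uE t : u.[expi t] = tp 0 c t.
  by rewrite /u (tp_poly c (fun i => i)); apply: eq_bigr => i _; rewrite add0r.
have vE t : v.[expi t] = (tp (- K%:Z) d t)^J.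
  rewrite /v (tp_poly (fun j => (d j)^J) (fun j => (K - j)%N)) conjc_sum.
  apply: eq_bigr => j _; rewrite conjcM ekJ; congr (_ * ek _ t).
  by have := ltn_ord j; lia.
have pu : psq u = \sum_(i < n) nsq (c i).
  rewrite -Er_nsq_horner -(Er_nsq_tp 0 c); congr Er; apply/funext => t.
  by rewrite uE.
have pv : psq v = S.
  rewrite -Er_nsq_horner /S -(Er_nsq_tp (- K%:Z) d); congr Er; apply/funext => t.
  by rewrite vE nsqJ.
have v0 : v`_0 = 0.
  rewrite /v coef_sum big1// => j _; rewrite coefZ coefXn.
  by rewrite (_ : (0 == K - j)%N = false) ?mulr0//; have := ltn_ord j; lia.
have F0 : (u * v)`_0 = 0 by rewrite coef0M v0 mulr0.
have SE : S%:C = \sum_(i < size (u * v)) b`_i.+1 * (u * v)`_i.+1.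
  rewrite -(E_ptrig_horner a b F0).
  transitivity (E (fun t => q t * (tp (- K%:Z) d t)^J)).
    rewrite E_tpJ// rmorph_sum; apply: eq_bigr => j _.
    by rewrite -[LHS]/((nsq (d j))%:C) nsqE mulrC.
  by apply: E_ext => t; rewrite hornerM uE vE /q mulrA.
have := hankel_bound u v e0 hab; rewrite -SE nsq_real pu pv.
have S0 : 0 <= S by rewrite sumr_ge0// => j _; exact: nsq_ge0.
move: S0; rewrite le_eqVlt => /orP[/eqP <- _|S0].
  by rewrite mulr_ge0 ?mulr_ge0 ?(ltW e0)// sumr_ge0// => j _; exact: nsq_ge0.
by rewrite mulrA expr2 ler_pM2r.
Qed.

(** Complex conjugation followed by a shift exchanges the modes beyond the window
with those before it. *)
Lemma pos_energy n (c : 'I_n -> C) a b (eta2 : R) K : 0 < eta2 ->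
  garsia_le (cj b) (cj a) eta2 ->
  energy n%:Z K (fun t => ptrig a b t * tp 0 c t) <=
    16 * eta2 * \sum_(i < n) nsq (c i).
Proof.
move=> e0 hab; set q := fun t => _.
have bq' : bcv q by apply: bcvM; [exact: bcv_ptrig|exact: bcv_tp].
pose c' (i : 'I_n) := (c (rev_ord i))^J.
have -> : \sum_(i < n) nsq (c i) = \sum_(i < n) nsq (c' i).
  by rewrite (reindex_inj rev_ord_inj); apply: eq_bigr => i _; rewrite nsqJ.
apply: le_trans (neg_energy c' K e0 hab).
rewrite (_ : (fun t => _) = fun t => ek (n%:Z - 1) t * (q t)^J); last first.
  apply/funext => t; rewrite /q conjcM ptrigJ mulrCA; congr (_ * _).
  rewrite /tp conjc_sum mulr_sumr (reindex_inj rev_ord_inj).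
  apply: eq_bigr => i _; rewrite /c' rev_ordK conjcM ekJ mulrCA -ekD.
  by congr (_ * ek _ t); have := ltn_ord i; rewrite /=; lia.
rewrite /energy (reindex_inj rev_ord_inj) le_eqVlt; apply/orP; left; apply/eqP.
apply: eq_bigr => j _; rewrite coef_ek fcoefJ// nsqJ; congr (nsq (coef q _)).
by have := ltn_ord j; rewrite /=; lia.
Qed.

(** By Parseval's identity the energy outside the window is that of the modes before
it and after it. *)
Lemma garsia_bq n (c : 'I_n -> C) a b (eta2 : R) : 0 < eta2 ->
  garsia_le a b eta2 -> garsia_le (cj b) (cj a) eta2 ->
  bq 0 n (fun t => ptrig a b t * tp 0 c t) <= 32 * eta2 * \sum_(i < n) nsq (c i).
Proof.
move=> e0 h1 h2; set q := fun t => _.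
have [d [bq' Hd]] : exists d, band d q.
  by exists (size a + size b + n)%N; apply: bandM_tp; exact: band_ptrig.
pose K := d.+1.
have := Hd (- K%:Z) (K + n + K)%N; rewrite {1}/bq => H.
have {}H : Er (fun t => nsq (q t)) = energy (- K%:Z) (K + n + K) q.
  by apply/eqP; rewrite -subr_eq0; apply/eqP/H; rewrite /K; lia.
rewrite /bq H !energy_cat.
have -> : - K%:Z + K%:Z = 0 by lia.
have -> : - K%:Z + (K + n)%N%:Z = n%:Z by lia.
have := neg_energy c K e0 h1; have := pos_energy c K e0 h2; rewrite -/q.
move: (energy _ _ q) (energy _ _ q) (energy _ _ q) (\sum_(_ < _) _) => x y z s.
lra.
Qed.

Definition approximable (eta2 : R) g : Prop := forall tau : R, 0 < tau ->
  exists a b, [/\ garsia_le a b eta2, garsia_le (cj b) (cj a) eta2 &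
    Er (fun t => nsq (g t - ptrig a b t)) <= tau].

Lemma cjK a : cj (cj a) = a.
Proof. by apply/polyP => i; rewrite /cj !coef_map /= conjcK. Qed.

Lemma approximableJ eta2 g : approximable eta2 g -> approximable eta2 (fun t => (g t)^J).
Proof.
move=> H tau /H[a [b [h1 h2 h3]]]; exists (cj b), (cj a).
split; [exact: h2|by rewrite !cjK; exact: h1|].
apply: le_trans h3; rewrite le_eqVlt; apply/orP; left; apply/eqP; congr Er.
by apply/funext => t; rewrite -ptrigJ -conjcN -conjcD nsqJ.
Qed.

(** For fixed [n] and [X] the energy of [(g - p) X] is at most a constant times that
of [g - p], which is arbitrarily small. *)
Lemma approximable_bq n (c : 'I_n -> C) g (eta2 : R) : bcv g -> 0 < eta2 ->
  approximable eta2 g ->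
  bq 0 n (fun t => g t * tp 0 c t) <= 64 * eta2 * \sum_(i < n) nsq (c i).
Proof.
move=> bg e0 H; set S := \sum_(i < n) _.
have bX := bcv_tp 0 c; have [B XB] := bcv_bound bX.
have B0 : 0 <= B by rewrite (le_trans (nsq_ge0 (tp 0 c 0)) (XB 0)).
have B1 : 0 < 2 * (B + 1) by rewrite mulr_gt0// ltr_wpDl.
apply/ler_addgt0Pr => e ep.
have [a [b [h1 h2 h3]]] := H _ (divr_gt0 ep B1).
have bp := bcv_ptrig a b; have bd := bcvB bg bp.
have -> : (fun t => g t * tp 0 c t) = (fun t => ptrig a b t * tp 0 c t +
    (g t - ptrig a b t) * tp 0 c t).
  by apply/funext => t; rewrite -mulrDl addrC subrK.
apply: (le_trans (bqD_le 0 n (bcvM bp bX) (bcvM bd bX))).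
have k1 := garsia_bq c e0 h1 h2.
have k2 : bq 0 n (fun t => (g t - ptrig a b t) * tp 0 c t) <= e / 2.
  apply: (le_trans (bq_le _ _ _)).
  apply: (@le_trans _ _ (Er (fun t => B * nsq (g t - ptrig a b t)))).
    apply: Er_le => [||t]; [by apply: brv_nsq; exact: bcvM|by apply: brvZ; exact: brv_nsq|].
    by rewrite nsqM mulrC ler_wpM2r ?nsq_ge0.
  rewrite ErZ; last exact: brv_nsq.
  apply: (@le_trans _ _ (B * (e / (2 * (B + 1))))); first by rewrite ler_wpM2l.
  rewrite mulrA ler_pdivrMr// mulrA divfK//.
  by rewrite mulrDr mulr1 mulrC lerDl ltW.
move: k1 k2; rewrite -/S; move: (bq _ _ _) (bq _ _ _) => x y; lra.
Qed.

End HankelEnergy.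

(** * The cluster property for functions of vanishing mean oscillation *)

Section FiniteRank.
Context {R : realType}.
Notation C := R[i].
Implicit Types (f g h : R -> C).

Lemma rank_middle_columns n (A : 'M[C]_n) d :
  (forall i j : 'I_n, (d <= j)%N -> (j + d < n)%N -> A i j = 0) ->
  (\rank A <= d + d)%N.
Proof.
move=> A0; have [nd|nd] := leqP n (d + d).
  exact: leq_trans (rank_leq_row A) nd.
have dn : (d <= n)%N by lia.
have -> : A = A *m pid_mx d + A *m copid_mx (n - d).
  apply/matrixP => i j; rewrite -mulmxDr /copid_mx addrCA mulmxDr mulmx1 !mxE.
  rewrite (bigD1 j)//= !mxE eqxx /= big1 ?addr0 => [|k kj]; last first.
    by rewrite !mxE (_ : (k == j :> nat) = false) ?subrr ?mulr0//; exact: negbTE.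
  have -> : (j < n - d)%N = (j + d < n)%N by lia.
  have := A0 i j; case: (leqP d j) => dj; case: (ltnP (j + d) n) => jd //=.
  - by move=> ->//; rewrite mul0r addr0.
  - by rewrite subrr mulr0 addr0.
  - by rewrite subrr mulr0 addr0.
  - lia.
apply: (leq_trans (mxrank_add _ _)); apply: leq_add.
  by apply: (leq_trans (mxrankM_maxr _ _)); rewrite rank_pid_mx.
apply: (leq_trans (mxrankM_maxr _ _)); rewrite rank_copid_mx ?leq_subr//.
by rewrite subKn.
Qed.

Lemma defect_entry f g n (i j : 'I_n) : bcv f -> bcv g ->
  toeplitz_defect f g n i j =
  bes 0 n (fun t => ek j%:Z t * g t) (fun t => ek i%:Z t * (f t)^J).
Proof.
move=> bf bg.
have tpd (k : 'I_n) t : tp 0 (cv (delta_mx k 0)) t = ek k%:Z t :> C.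
  rewrite /tp /cv (bigD1 k)//= mxE !eqxx mul1r add0r big1 ?addr0// => l lk.
  by rewrite mxE (negbTE lk) mul0r.
have := defect_form (delta_mx j 0) (delta_mx i 0) bf bg.
rewrite (bigD1 i)//= big1 ?addr0 => [|k ki]; last first.
  by rewrite mxE (negbTE ki) conjc0 mul0r.
rewrite -colE !mxE !eqxx conjc1 mul1r => ->.
have gE : (fun t => g t * tp 0 (cv (delta_mx j 0)) t) = fun t => ek j%:Z t * g t.
  by apply/funext => t; rewrite tpd mulrC.
have fE : (fun t => (f t)^J * tp 0 (cv (delta_mx i 0)) t) =
    fun t => ek i%:Z t * (f t)^J.
  by apply/funext => t; rewrite tpd mulrC.
by rewrite gE fE.
Qed.

(** The product of [h] and of the mode of index [j] stays inside the window when [j]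
is at distance at least [d] from its ends, and the column [j] vanishes. *)
Lemma rank_defect_r f h d n : bcv f -> band d h ->
  (\rank (toeplitz_defect f h n) <= d + d)%N.
Proof.
move=> bf [bh Hh]; apply: rank_middle_columns => i j dj jd.
rewrite defect_entry//; apply: nsq_eq0; apply/le_anti; rewrite nsq_ge0 andbT.
have bj : bcv (fun t => ek j%:Z t * h t) by apply: bcvM => //; exact: bcv_ek.
have bi : bcv (fun t => ek i%:Z t * (f t)^J).
  by apply: bcvM; [exact: bcv_ek|exact: bcvJ].
apply: (le_trans (CS_bes 0 n bj bi)).
by rewrite bq_ek Hh ?mul0r//; lia.
Qed.

Lemma rank_defect_l h g d n : bcv g -> bcv h -> band d (fun t => (h t)^J) ->
  (\rank (toeplitz_defect h g n) <= d + d)%N.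
Proof.
move=> bg bh [bhJ Hh]; rewrite -mxrank_tr; apply: rank_middle_columns => j i di id.
rewrite mxE defect_entry//; apply: nsq_eq0; apply/le_anti; rewrite nsq_ge0 andbT.
have bj : bcv (fun t => ek j%:Z t * g t) by apply: bcvM => //; exact: bcv_ek.
have bi : bcv (fun t => ek i%:Z t * (h t)^J).
  by apply: bcvM; [exact: bcv_ek|exact: bcvJ].
apply: (le_trans (CS_bes 0 n bj bi)).
by rewrite (bq_ek _ _ _ (fun t => (h t)^J)) Hh ?mulr0//; lia.
Qed.

Lemma toeplitzD f g n : bcv f -> bcv g ->
  toeplitz (fun t => f t + g t) n = toeplitz f n + toeplitz g n.
Proof. by move=> bf bg; apply/matrixP => i j; rewrite !mxE !fourierE fcoefD. Qed.

Lemma defectDl f f' g n : bcv f -> bcv f' -> bcv g ->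
  toeplitz_defect (fun t => f t + f' t) g n =
  toeplitz_defect f g n + toeplitz_defect f' g n.
Proof.
move=> bf bf' bg; rewrite /toeplitz_defect toeplitzD// mulmxDl.
have -> : (fun t => (f t + f' t) * g t) = (fun t => f t * g t + f' t * g t).
  by apply/funext => t; rewrite mulrDl.
by rewrite (toeplitzD n (bcvM bf bg) (bcvM bf' bg)) opprD addrACA.
Qed.

Lemma defectDr f g g' n : bcv f -> bcv g -> bcv g' ->
  toeplitz_defect f (fun t => g t + g' t) n =
  toeplitz_defect f g n + toeplitz_defect f g' n.
Proof.
move=> bf bg bg'; rewrite /toeplitz_defect toeplitzD// mulmxDr.
have -> : (fun t => f t * (g t + g' t)) = (fun t => f t * g t + f t * g' t).
  by apply/funext => t; rewrite mulrDr.
by rewrite (toeplitzD n (bcvM bf bg) (bcvM bf bg')) opprD addrACA.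
Qed.

(** The polynomial [h] depends on [eta2] only; the approximations of the remainder
may have arbitrary degrees. *)
Lemma vmo_split f (eta2 : R) : bcv f -> vmo f -> 0 < eta2 -> exists h d,
  [/\ bcv h, band d h, band d (fun t => (h t)^J) &
      approximable eta2 (fun t => f t - h t)].
Proof.
move=> bf vf e0; have [a [b H]] := vmo_approx bf vf e0.
exists (ptrig a b), (maxn (size a + size b) (size (cj b) + size (cj a))); split=> //.
- exact: bcv_ptrig.
- exact: band_le (leq_maxl _ _) (band_ptrig a b).
- rewrite (_ : (fun t => _) = ptrig (cj b) (cj a)); last first.
    by apply/funext => t; rewrite ptrigJ.
  exact: band_le (leq_maxr _ _) (band_ptrig _ _).
Qed.

(** With [f = h + f'] and [g = k + g'], the defect of [f], [g] is the sum of those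
of [h], [g] and of [f'], [k], which have bounded rank, and of that of [f'], [g'],
whose norm is at most [64 eta2]. *)
Lemma vmo_cluster f g : bcv f -> bcv g -> vmo f -> vmo g ->
  type2_strong_cluster0 (toeplitz_defect f g).
Proof.
move=> bf bg vf vg e e0; have e1 : 0 < e / 128 by rewrite divr_gt0.
have [h [d [bh hd hJ ah]]] := vmo_split bf vf e1.
have [k [d' [bk kd kJ ak]]] := vmo_split bg vg e1.
exists (d + d + (d' + d')).+1, 1%N; split=> // n _.
have bfh := bcvB bf bh; have bgk := bcvB bg bk.
exists (toeplitz_defect h g n + toeplitz_defect (fun t => f t - h t) k n).
exists (toeplitz_defect (fun t => f t - h t) (fun t => g t - k t) n); split.
- have gE : (fun t => k t + (g t - k t)) = g.
    by apply/funext => t; rewrite addrC subrK.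
  have fE : (fun t => h t + (f t - h t)) = f.
    by apply/funext => t; rewrite addrC subrK.
  have := defectDr n bfh bk bgk; rewrite gE => Dr.
  have := defectDl n bh bfh bg; rewrite fE => ->.
  by rewrite Dr addrA.
- apply: leqW; apply: (leq_trans (mxrank_add _ _)); apply: leq_add.
    exact: (rank_defect_l n bg bh hJ).
  exact: (rank_defect_r n bfh kd).
- apply: (@le_lt_trans _ _ (e / 2)); last by rewrite ltr_pdivrMr// ltr_pMr// ltr1n.
  apply: opnorm_le; first by rewrite divr_ge0// ltW.
  have -> : (e / 2) ^+ 2 = (64 * (e / 128)) * (64 * (e / 128)) by field.
  apply: defect_vsq => // x.
    exact: (approximable_bq (cv x) bgk e1 ak).
  exact: (approximable_bq (cv x) (bcvJ bfh) e1 (approximableJ ah)).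
Qed.

Lemma VMO_Linfty_cluster : toeplitz_cluster_property (@VMO R `&` @Linfty R).
Proof.
move=> f g /VMO_Linfty_rep[f0 rf vf] /VMO_Linfty_rep[g0 rg vg] e e0.
have [_ _ bf _] := rf; have [_ _ bg _] := rg.
have [N1 [N2 [h1 h2 H]]] := vmo_cluster bf bg vf vg e0.
exists N1, N2; split; [exact: h1|exact: h2|move=> n nN].
by rewrite (defect_rep n rf rg); exact: H.
Qed.

End FiniteRank.

Theorem theorem1p3 (R : realType) :
  toeplitz_cluster_property (@VMO R `&` @Linfty R) /\
  Cstar_subalgebra (@VMO R `&` @Linfty R) /\
  (forall M : set (R -> R[i]),
     Cstar_subalgebra M -> toeplitz_cluster_property M ->
     M `<=` @VMO R `&` @Linfty R).
Proof.
split; first exact: VMO_Linfty_cluster.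
by split; [exact: VMO_Linfty_Cstar|exact: cluster_maximal].
Qed.
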